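(* Let $p$ be a prime number and $q=p^m$ with $m\geq 1$. Let $(G,M)$ be one of the following pairs: (i) $G=\mathrm{PSL}_2(q)$, where $m>1$ if $p\in\{2,3\}$, and $M$ is any non-trivial abelian subgroup of $G$ of central type; (ii) $G={}^2\!B_2(q)$ (the Suzuki group), where $p=2$ and $m>1$ is odd, and $M$ is any non-trivial abelian subgroup of $G$ of central type; (iii) $G=\mathrm{SL}_3(p)$ and $M$ is any non-trivial abelian $p$-subgroup of $G$ of central type. Let $K\subset\mathbb C$ be a number field large enough so that $KM\cong K^{|M|}$ as algebras, and let $\omega:\widehat{M}\times\widehat{M}\to K^{\times}\subset\mathbb C^\times$ be any normalized non-degenerate $2$-cocycle. Then the complex semisimple Hopf algebra $(\mathbb{C}G)_{\Omega_{M,\omega}}$ does not admit a Hopf order over any number ring.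
   Context: Central type: a finite abelian group $M$ is of central type if $M\cong E\times E$ for some group $E$ (equivalently, $\widehat M$ admits a non-degenerate $2$-cocycle). Twists: let $M$ be an abelian subgroup of a finite group $G$. Let $\widehat M$ be the group of characters $M\to \mathbb C^\times$ (which take values in $K^\times$ when $KM\cong K^{|M|}$), and for $\phi\in\widehat M$ put $e_\phi=\frac{1}{|M|}\sum_{v\in M}\phi(v^{-1})v$. A $2$-cocycle $\omega$ on $\widehat M$ (trivial action) is normalized if $\omega(\phi,\varepsilon)=\omega(\varepsilon,\phi)=1$ for the trivial character $\varepsilon$ and all $\phi$; it is non-degenerate if the skew-symmetric pairing $(\phi,\psi)\mapsto\omega(\phi,\psi)/\omega(\psi,\phi)$ on $\widehat M$ is non-degenerate. Put $\Omega=\Omega_{M,\omega}=\sum_{\phi,\psi\in\widehat M}\omega(\phi,\psi)\,e_\phi\otimes e_\psi\in \mathbb CG\otimes \mathbb CG$. The Hopf algebra $(\mathbb CG)_{\Omega}$ has the algebra structure and counit of $\mathbb CG$, coproduct $\Delta_\Omega(g)=\Omega(g\otimes g)\Omega^{-1}$ and antipode $S_\Omega(g)=Q\,g^{-1}Q^{-1}$ for $g\in G$, where $Q=\sum\Omega^{(1)}S(\Omega^{(2)})$, $\Omega=\sum\Omega^{(1)}\otimes\Omega^{(2)}$ and $S$ is the antipode of $\mathbb CG$. Hopf orders: let $H$ be a finite-dimensional Hopf algebra over a field $F$ and $R$ a subring of $F$. A Hopf order of $H$ over $R$ is a finitely generated projective $R$-submodule $X\subseteq H$ such that the natural map $X\otimes_R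 F\to H$ is an isomorphism and $1_H\in X$, $XX\subseteq X$, $\Delta(X)\subseteq X\otimes_R X$, $\varepsilon(X)\subseteq R$, $S(X)\subseteq X$. Here $F=\mathbb C$. A number ring is the ring of algebraic integers $\mathcal O_L$ of a number field $L\subset\mathbb C$. Suzuki group: for $q=2^{2n+1}$, $n\ge 1$, let $\theta$ be the automorphism $x\mapsto x^{2^{n+1}}$ of $\mathbb F_q$. Then ${}^2\!B_2(q)$ is the subgroup of $\mathrm{SL}_4(\mathbb F_q)$ generated by the matrices $u(a,b)=\begin{pmatrix}1&0&0&0\\ a&1&0&0\\ a\theta(a)+b&\theta(a)&1&0\\ a^2\theta(a)+ab+\theta(b)&b&a&1\end{pmatrix}$ ($a,b\in\mathbb F_q$), the matrices $\mathrm{diag}(a_1,a_2,a_2^{-1},a_1^{-1})$ with $\theta(a_1)=\kappa\theta(\kappa)$, $\theta(a_2)=\kappa$ ($\kappa\in\mathbb F_q^\times$), and the permutation matrix with $1$'s on the antidiagonal. Its order is $q^2(q-1)(q^2+1)$. *)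

(* Defs.v *)
From HB Require Import structures.
From mathcomp Require Import all_boot all_order all_fingroup all_algebra.
From mathcomp Require Import all_solvable all_field.
From mathcomp Require Import boolp reals complex.

Set Implicit Arguments.
Unset Strict Implicit.
Unset Printing Implicit Defensive.

Import GRing.Theory.
Local Open Scope ring_scope.

(* The function [x] stands for [\sum_g x g *: g]; the alias hides the pointwise
   ring structure of {ffun gT -> F}. *)
Definition galg (F : fieldType) (gT : finGroupType) := {ffun gT -> F^o}.

Section GroupAlgebra.
Variables (F : fieldType) (gT : finGroupType).

HB.instance Definition _ := Vector.copy (galg F gT) {ffun gT -> F^o}.

Implicit Types (x y z : galg F gT) (g h : gT).

Definition gel g : galg F gT := [ffun h => (h == g)%:R].

Definition galg_mul x y : galg F gT :=
  [ffun g => \sum_(h : gT) (x h : F) * (y (h^-1 * g)%g : F)].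

Fact galg_mulA : associative galg_mul.
Proof.
move=> x y z; apply/ffunP=> g; rewrite !ffunE.
under eq_bigr do rewrite ffunE big_distrr /=.
under [RHS]eq_bigr do rewrite ffunE big_distrl /=.
rewrite [RHS]exchange_big /=; apply: eq_bigr => h _.
rewrite (reindex_inj (mulgI h^-1)%g) /=; apply: eq_bigr => k _.
by rewrite mulrA invMg invgK -mulgA mulVKg.
Qed.

Fact galg_mul1r : left_id (gel 1) galg_mul.
Proof.
move=> x; apply/ffunP=> g; rewrite ffunE (bigD1 1%g) //= big1 => [|h /negPf h1].
  by rewrite ffunE eqxx mul1r invg1 mul1g addr0.
by rewrite ffunE h1 mul0r.
Qed.

Fact galg_mulr1 : right_id (gel 1) galg_mul.
Proof.
move=> x; apply/ffunP=> g; rewrite ffunE (bigD1 g) //= big1 => [|h /negPf hg].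
  by rewrite ffunE mulVg eqxx mulr1 addr0.
by rewrite ffunE -eq_mulVg1 hg mulr0.
Qed.

Fact galg_mulDl : left_distributive galg_mul +%R.
Proof.
move=> x y z; apply/ffunP=> g; rewrite !ffunE -big_split /=.
by apply: eq_bigr => h _; rewrite ffunE mulrDl.
Qed.

Fact galg_mulDr : right_distributive galg_mul +%R.
Proof.
move=> x y z; apply/ffunP=> g; rewrite !ffunE -big_split /=.
by apply: eq_bigr => h _; rewrite ffunE mulrDr.
Qed.

Fact galg_1neq0 : gel 1 != 0.
Proof.
by apply/eqP=> /ffunP/(_ 1%g)/eqP; rewrite !ffunE eqxx oner_eq0.
Qed.

HB.instance Definition _ := GRing.Zmodule_isNzRing.Build (galg F gT)
  galg_mulA galg_mul1r galg_mulr1 galg_mulDl galg_mulDr galg_1neq0.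

Fact galg_scaleAl (a : F) x y : a *: (x * y) = (a *: x) * y.
Proof.
apply/ffunP=> g; rewrite !ffunE scaler_sumr; apply: eq_bigr => h _.
by rewrite ffunE scalerAl.
Qed.

HB.instance Definition _ :=
  GRing.Lmodule_isLalgebra.Build F (galg F gT) galg_scaleAl.

Fact galg_scaleAr (a : F) x y : a *: (x * y) = x * (a *: y).
Proof.
apply/ffunP=> g; rewrite !ffunE scaler_sumr; apply: eq_bigr => h _.
by rewrite ffunE scalerAr.
Qed.

HB.instance Definition _ :=
  GRing.Lalgebra_isAlgebra.Build F (galg F gT) galg_scaleAr.
(* The inverse of a unit comes from finite dimensionality. *)
HB.instance Definition _ := Algebra_isFalgebra.Build F (galg F gT).

End GroupAlgebra.

Lemma galg_mulE (F : fieldType) (gT : finGroupType) (x y : galg F gT) g :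
  (x * y) g = \sum_(h : gT) (x h : F) * (y (h^-1 * g)%g : F).
Proof. by rewrite ffunE. Qed.

Lemma galg_oneE (F : fieldType) (gT : finGroupType) :
  1 = gel F (1%g : gT).
Proof. by []. Qed.

Lemma gelM (F : fieldType) (gT : finGroupType) (g h : gT) :
  gel F (g * h)%g = gel F g * gel F h.
Proof.
apply/ffunP=> k; rewrite galg_mulE ffunE (bigD1 g) //= big1 => [|l /negPf lg].
  by rewrite !ffunE eqxx mul1r addr0 (can2_eq (mulVKg g) (mulKg g)).
by rewrite ffunE lg mul0r.
Qed.

(* FG (x) FG is identified with F[G x G], g (x) h being the pair (g, h). *)
Definition tens (F : fieldType) (gT : finGroupType) (x y : galg F gT) :
  galg F (gT * gT)%type := [ffun u => (x u.1 : F) * (y u.2 : F)].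

(* The algebra structure is always that of FG. *)
Record hopf_structure (F : fieldType) (gT : finGroupType) := HopfStructure {
  comult : galg F gT -> galg F (gT * gT)%type;
  counit : galg F gT -> F;
  antipode : galg F gT -> galg F gT }.

Section Standard.
Variables (F : fieldType) (gT : finGroupType).

Definition galg_comult (x : galg F gT) : galg F (gT * gT)%type :=
  \sum_(g : gT) (x g : F) *: tens (gel F g) (gel F g).
Definition galg_counit (x : galg F gT) : F := \sum_(g : gT) (x g : F).
Definition galg_antipode (x : galg F gT) : galg F gT :=
  \sum_(g : gT) (x g : F) *: gel F g^-1.

Variable Omega : galg F (gT * gT)%type.

(* Q = \sum Omega^(1) S(Omega^(2)) *)
Definition twist_Q : galg F gT :=
  \sum_(u : gT * gT) (Omega u : F) *: (gel F u.1 * galg_antipode (gel F u.2)).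

Definition twisted : hopf_structure F gT := HopfStructure
  (fun x => Omega * galg_comult x * Omega^-1)
  galg_counit
  (fun x => twist_Q * galg_antipode x * twist_Q^-1).

End Standard.

(* As for class functions, a character of M is extended by 0 outside M. *)
Definition is_lchar (F : fieldType) (gT : finGroupType) (M : {set gT})
    (phi : {ffun gT -> F}) : bool :=
  [&& phi 1%g == 1,
      [forall u in M, forall v in M, phi (u * v)%g == phi u * phi v] &
      [forall u, (u \notin M) ==> (phi u == 0)]].

Record lchar (F : closedFieldType) (gT : finGroupType) (M : {group gT}) :=
  LChar { lchar_val :> {ffun gT -> F}; _ : is_lchar M lchar_val }.

Section CharacterGroup.
Variables (F : closedFieldType) (gT : finGroupType) (M : {group gT}).
Local Notation lchar := (@lchar F gT M).
Implicit Types phi psi chi : lchar.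

HB.instance Definition _ := [isSub for @lchar_val F gT M].
HB.instance Definition _ := [Choice of lchar by <:].

Lemma lchar1 phi : phi 1%g = 1.
Proof. by case/and3P: (valP phi) => /eqP. Qed.

Lemma lcharM phi : {in M &, {morph (phi : gT -> F) : u v / (u * v)%g >-> u * v}}.
Proof.
move=> u v Mu Mv; case/and3P: (valP phi) => _ /forall_inP/(_ u Mu).
by move/forall_inP/(_ v Mv)/eqP.
Qed.

Lemma lchar_out phi u : u \notin M -> phi u = 0.
Proof. by move=> nMu; case/and3P: (valP phi) => _ _ /forall_inP/(_ u nMu)/eqP. Qed.

Lemma lcharX phi u n : u \in M -> phi (u ^+ n)%g = phi u ^+ n.
Proof.
move=> Mu; elim: n => [|n IHn]; first by rewrite lchar1.
by rewrite expgS lcharM ?groupX // IHn exprS.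
Qed.

Lemma lchar_neq0 phi u : u \in M -> phi u != 0.
Proof.
move=> Mu; apply/eqP=> phi0.
have /eqP := lcharM phi Mu (groupVr Mu).
by rewrite mulgV lchar1 phi0 mul0r oner_eq0.
Qed.

Let M_rootPoly : {poly F} := 'X^#|M| - 1.
Let lchar_values : seq F := 0 :: sval (closed_field_poly_normal M_rootPoly).

Fact lchar_valuesP phi u : phi u \in lchar_values.
Proof.
rewrite inE; have [Mu | /lchar_out->] := boolP (u \in M); last by rewrite eqxx.
apply/orP; right; rewrite /lchar_values.
case: closed_field_poly_normal => r /= Dr.
rewrite -root_prod_XsubC -(@rootZ _ _ (lead_coef M_rootPoly)).
  by rewrite -Dr rootE !hornerE -lcharX // expg_cardG // lchar1 subrr.
by rewrite lead_coef_eq0 monic_neq0 // monicXnsubC.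
Qed.

Let lchar_code phi : {ffun gT -> 'I_(size lchar_values)} :=
  [ffun u => Ordinal (etrans (index_mem _ _) (lchar_valuesP phi u))].
Let lchar_decode (f : {ffun gT -> 'I_(size lchar_values)}) : option lchar :=
  insub [ffun u => lchar_values`_(f u)].

Fact lchar_codeK : pcancel lchar_code lchar_decode.
Proof.
move=> phi; rewrite /lchar_decode.
suff -> : [ffun u => lchar_values`_(lchar_code phi u)] = val phi by exact: valK.
by apply/ffunP=> u; rewrite !ffunE /= nth_index ?lchar_valuesP.
Qed.

HB.instance Definition _ := PCanIsCountable lchar_codeK.
HB.instance Definition _ : isFinite lchar := PCanIsFinite lchar_codeK.

Fact lchar_one_subproof : is_lchar M [ffun u => (u \in M)%:R : F].
Proof.
apply/and3P; split.
- by rewrite ffunE group1.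
- apply/forall_inP=> u Mu; apply/forall_inP=> v Mv.
  by rewrite !ffunE groupM // Mu Mv mulr1.
by apply/forall_inP=> u /negPf nMu; rewrite ffunE nMu.
Qed.
Definition lchar_one : lchar := LChar lchar_one_subproof.

Fact lchar_mul_subproof phi psi : is_lchar M [ffun u => phi u * psi u].
Proof.
apply/and3P; split.
- by rewrite ffunE !lchar1 mulr1.
- apply/forall_inP=> u Mu; apply/forall_inP=> v Mv.
  by rewrite !ffunE !lcharM // mulrACA.
by apply/forall_inP=> u nMu; rewrite ffunE lchar_out // mul0r.
Qed.
Definition lchar_mul phi psi : lchar := LChar (lchar_mul_subproof phi psi).

Fact lchar_inv_subproof phi : is_lchar M [ffun u => (phi u)^-1].
Proof.
apply/and3P; split.
- by rewrite ffunE lchar1 invr1.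
- apply/forall_inP=> u Mu; apply/forall_inP=> v Mv.
  by rewrite !ffunE lcharM // invfM.
by apply/forall_inP=> u nMu; rewrite ffunE lchar_out // invr0.
Qed.
Definition lchar_inv phi : lchar := LChar (lchar_inv_subproof phi).

Fact lchar_mulA : associative lchar_mul.
Proof. by move=> a b c; apply/val_inj/ffunP=> u; rewrite !ffunE mulrA. Qed.
Fact lchar_mul1g : left_id lchar_one lchar_mul.
Proof.
move=> a; apply/val_inj/ffunP=> u; rewrite !ffunE.
by have [|/lchar_out->] := boolP (u \in M); rewrite ?mul1r ?mulr0.
Qed.
Fact lchar_mulVg : left_inverse lchar_one lchar_inv lchar_mul.
Proof.
move=> a; apply/val_inj/ffunP=> u; rewrite !ffunE.
have [Mu|/lchar_out->] := boolP (u \in M); last by rewrite mulr0.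
by rewrite mulVf ?lchar_neq0.
Qed.

HB.instance Definition _ :=
  Finite_isGroup.Build lchar lchar_mulA lchar_mul1g lchar_mulVg.

Definition char_idem phi : galg F gT :=
  (#|M|%:R)^-1 *: \sum_(v in M) (phi v^-1%g : F) *: gel F v.

Definition twist_Omega (omega : lchar -> lchar -> F) : galg F (gT * gT)%type :=
  \sum_(phi : lchar) \sum_(psi : lchar)
    omega phi psi *: tens (char_idem phi) (char_idem psi).

End CharacterGroup.

Definition central_type (gT : finGroupType) (M : {group gT}) : Prop :=
  exists (eT : finGroupType) (E : {group eT}), M \isog setX E E.

Definition split_galg (K : fieldType) (gT : finGroupType) (M : {group gT}) :=
  exists f : galg K [subg M] -> {ffun 'I_#|M| -> K^o},
    [/\ bijective f, linear f, f 1 = 1 & {morph f : x y / x * y}].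

Section Cocycles.
Variables (A : finGroupType) (K : fieldType) (omega : A -> A -> K).

Definition cocycle2 : Prop :=
  (forall a b, omega a b != 0) /\
  (forall a b c, omega a b * omega (a * b)%g c = omega b c * omega a (b * c)%g).

Definition cocycle_normalized : Prop := forall a, omega a 1%g = 1 /\ omega 1%g a = 1.

Definition cocycle_nondegenerate : Prop :=
  forall a, (forall b, omega a b / omega b a = 1) -> a = 1%g.

End Cocycles.

Definition algint (L : fieldExtType rat) : {pred L} :=
  [pred x : L | `[< integralOver (intr : int -> L) x >]].

Section NumberRing.
Variable L : fieldExtType rat.

Fact algint_subring : subring_closed (@algint L).
Proof.
split=> [|x y|x y]; rewrite !inE.
- by apply/asboolP; exact: integral1.
- by move=> /asboolP Ix /asboolP Iy; apply/asboolP; exact: integral_sub.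
by move=> /asboolP Ix /asboolP Iy; apply/asboolP; exact: integral_mul.
Qed.

HB.instance Definition _ :=
  GRing.isSubringClosed.Build L (@algint L) algint_subring.

Record number_ring :=
  NumberRing { number_ring_val : L; _ : number_ring_val \in @algint L }.

HB.instance Definition _ := [isSub for number_ring_val].
HB.instance Definition _ := [Choice of number_ring by <:].
HB.instance Definition _ :=
  [SubChoice_isSubComNzRing of number_ring by <:].

End NumberRing.

Section Modules.
Variables (R : comNzRingType) (X : lmodType R).

Definition fin_generated : Prop :=
  exists (n : nat) (s : 'I_n -> X), forall x : X,
    exists c : 'I_n -> R, x = \sum_(i < n) c i *: s i.

Definition projective : Prop :=
  forall (U V : lmodType R) (g : {linear U -> V}) (h : {linear X -> V}),
    (forall v, exists u, g u = v) ->
  exists k : {linear X -> U}, forall x, g (k x) = h x.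

End Modules.

Section HopfOrders.
Variables (F : fieldType) (R : comNzRingType) (iota : {rmorphism R -> F}).

(* (H, tau) is the tensor product of the R-modules X and F, in the sense of its
   universal property; F is an R-module through iota. *)
Definition is_tensor_with_field (X : lmodType R) (H : zmodType)
    (tau : X -> F -> H) : Prop :=
  let balanced (A : zmodType) (beta : X -> F -> A) :=
    [/\ forall x y a, beta (x + y) a = beta x a + beta y a,
        forall x a b, beta x (a + b) = beta x a + beta x b &
        forall r x a, beta (r *: x) a = beta x (iota r * a)] in
  balanced H tau /\
  forall (A : zmodType) (beta : X -> F -> A), balanced A beta ->
    exists f : {additive H -> A}, (forall x a, f (tau x a) = beta x a) /\
      forall f' : {additive H -> A},
        (forall x a, f' (tau x a) = beta x a) -> f' =1 f.

(* R is a subring of F through iota, and X an R-submodule of FG through the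
   R-linear map j. The image of X (x)_R X in FG (x) FG is the set of finite sums
   of the j x (x) j y; the map onto it is injective since X is projective. *)
Record hopf_order (gT : finGroupType) (H : hopf_structure F gT)
    (X : lmodType R) (j : {linear X -> galg F gT | iota \; *:%R}) : Prop :=
  HopfOrder {
    ho_subring : injective iota;
    ho_submodule : injective j;
    ho_fin_generated : fin_generated X;
    ho_projective : projective X;
    ho_base_change : is_tensor_with_field (fun (x : X) (a : F) => a *: j x);
    ho_one : exists x, j x = 1;
    ho_mul : forall x y, exists z, j z = j x * j y;
    ho_comult : forall x, exists s : seq (X * X),
      comult H (j x) = \sum_(u <- s) tens (j u.1) (j u.2);
    ho_counit : forall x, exists r, counit H (j x) = iota r;
    ho_antipode : forall x, exists y, antipode H (j x) = j y }.

End HopfOrders.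

(* the inclusion of O_L in F, for L a subfield of F through iota *)
Definition number_ring_embedding (F : fieldType) (L : fieldExtType rat)
    (iota : {rmorphism L -> F}) : {rmorphism number_ring L -> F} :=
  (iota \o val : {rmorphism number_ring L -> F}).

Definition SLn (n : nat) (F : finFieldType) : {set {'GL_n[F]}} :=
  [set A | \det (GLval A) == 1].

Fact SLn_group_set n F : group_set (SLn n F).
Proof.
apply/group_setP; split=> [|A B]; first by rewrite inE det1.
by rewrite !inE det_mulmx => /eqP-> /eqP->; rewrite mulr1.
Qed.
Canonical SLn_group n F := Group (SLn_group_set n F).

Definition PSLn (n : nat) (F : finFieldType) :=
  (SLn n F / 'Z(SLn n F))%g.

Section Suzuki.
Variables (F : finFieldType) (n : nat).

Definition mx4 (s : seq (seq F)) : 'M[F]_4 :=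
  \matrix_(i < 4, j < 4) (nth [::] s i)`_j.

Definition suz_theta (x : F) : F := x ^+ (2 ^ n.+1).
Local Notation theta := suz_theta.

Definition suz_u (a b : F) : 'M[F]_4 := mx4
  [:: [:: 1; 0; 0; 0];
      [:: a; 1; 0; 0];
      [:: a * theta a + b; theta a; 1; 0];
      [:: a ^+ 2 * theta a + a * b + theta b; b; a; 1]].

Definition suz_diag (a1 a2 : F) : 'M[F]_4 := mx4
  [:: [:: a1; 0; 0; 0];
      [:: 0; a2; 0; 0];
      [:: 0; 0; a2^-1; 0];
      [:: 0; 0; 0; a1^-1]].

Definition suz_anti : 'M[F]_4 := mx4
  [:: [:: 0; 0; 0; 1];
      [:: 0; 0; 1; 0];
      [:: 0; 1; 0; 0];
      [:: 1; 0; 0; 0]].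

Definition suz_gens : {set {'GL_4[F]}} :=
  [set A : {'GL_4[F]} |
     [|| [exists a : F, exists b : F, GLval A == suz_u a b],
         [exists a1 : F, exists a2 : F, exists kappa : F,
            [&& kappa != 0, theta a1 == kappa * theta kappa,
                theta a2 == kappa & GLval A == suz_diag a1 a2]] |
         GLval A == suz_anti]].

(* 2B2(q), for F of order q = 2 ^ (2n + 1) *)
Definition Suzuki : {set {'GL_4[F]}} := <<suz_gens>>%g.
Canonical Suzuki_group := Eval hnf in [group of Suzuki].

End Suzuki.

(* Main.v *)
Require Import Defs.
From HB Require Import structures.
From mathcomp Require Import all_boot all_order all_fingroup all_algebra.
From mathcomp Require Import all_solvable all_field all_character.
From mathcomp Require Import boolp reals complex ring.

Set Implicit Arguments.
Unset Strict Implicit.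
Unset Printing Implicit Defensive.

Import GRing.Theory.
Local Open Scope ring_scope.

(** The proof consists of an obstruction to Hopf orders, valid for all finite
    groups, and of its verification in three families of matrix groups.

    Let X be a Hopf order, and call an element of CG integral if it belongs to
    the span of X over the ring of all algebraic integers. Integral elements
    form a ring, stable under the operations of the twisted Hopf algebra, and
    integrality has two sources.

    - For s in G, the functional F_s that maps y to the sum over g of the
      coefficients y(s^g) takes algebraic integers as values on integral
      elements: F_s(y) is the trace of the operator x |-> y x s^-1, whose
      eigenvalues are algebraic integers ([class_sum_integral]). On a group
      element, F_s is #|C(s)| or 0, depending on whether it is conjugate to s.

    - If M and its conjugate by t meet trivially, then the double coset M t M
      spans a subcoalgebra with basis the elements e_phi t e_psi
      ([comult_coset_elt], [coset_elt_free]). It is dual to the twisted group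
      algebra of the non-degenerate cocycle w(phi, phi') / w(psi, psi'), hence
      it is a matrix coalgebra, with irreducible character #|M| e_1 t e_1. This
      character is integral ([matrix_coalgebra_character]).

    Assume that u t is not conjugate to t for u != 1 in M. Contracting the
    coproduct of this character with F_t gives #|C(t)| z_t, where z_t is the
    mean of the conjugates of t under M ([lcontract_coset_character]). For two
    such elements t and t', applying F_(t t') to the product of these integral
    elements gives the algebraic integer
    #|C(t)| #|C(t')| #|C(t t')| N / #|M|, where N is the number of v in M for
    which t t'^v is conjugate to t t'. This is absurd when M is a p-group, the
    three centralizers have order prime to p, and N < #|M|; this configuration
    is [twist_obstruction], and the conclusion [twisted_no_hopf_order].

    The configuration is found in the three families with traces of matrices,
    which separate enough conjugacy classes. Since M is not cyclic at any prime
    divisor l of its order, some nontrivial l-element above M fixes a nonzero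
    vector when l does not divide the order of the kernel
    ([central_type_fixes_row]); this determines which primes occur.

    - In SL3(p), M consists of lower unitriangular matrices up to conjugacy, and
      t = t' is chosen with irreducible characteristic polynomial
      ([sl3_twist_obstruction]).
    - In the Suzuki group, M is a 2-group; up to conjugacy it consists of
      matrices u(0, b), and t = t' is the product of the permutation matrix and
      u(0, 1). Elements with nonzero trace have a centralizer of odd order
      ([suzuki_twist_obstruction]).
    - In PSL2(q), either M is a p-group, and t and t' have traces other than 2
      and -2, or p is odd and M is a four-group, and t = t' is a transvection
      ([psl2_twist_obstruction]). *)

(** * Algebraic integers and traces *)

Definition algint_of (C : fieldType) : {pred C} :=
  [pred x : C | `[< integralOver (intr : int -> C) x >]].

Section AlgebraicIntegers.
Variable C : closedFieldType.
Local Notation Z_C := (@algint_of C).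

Fact algint_of_subring : subring_closed Z_C.
Proof.
split=> [|x y|x y]; rewrite !inE.
- by apply/asboolP; exact: integral1.
- by move=> /asboolP Ix /asboolP Iy; apply/asboolP; exact: integral_sub.
by move=> /asboolP Ix /asboolP Iy; apply/asboolP; exact: integral_mul.
Qed.

HB.instance Definition _ :=
  GRing.isSubringClosed.Build C Z_C algint_of_subring.

Lemma algint_root (P : {poly C}) x :
  P \is monic -> P \is a polyOver Z_C -> root P x -> x \in Z_C.
Proof.
move=> mP /polyOverP ZP Px; rewrite inE; apply/asboolP.
apply: integral_root_monic mP Px _; apply/integral_poly=> i.
by have := ZP i; rewrite inE => /asboolP.
Qed.

Lemma algint_sqrt x : x ^+ 2 \in Z_C -> x \in Z_C.
Proof.
move=> Zx2; apply: (@algint_root ('X^2 - (x ^+ 2)%:P)).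
- exact: monicXnsubC.
- by rewrite rpredB ?rpredX ?polyOverX ?polyOverC.
by rewrite rootE !hornerE subrr.
Qed.

Hypothesis C0 : [pchar C] =i pred0.

Lemma natrC_eq0 n : (n%:R == 0 :> C) = (n == 0)%N.
Proof. exact: (pcharf0P C).1. Qed.

Lemma natrC_inj : injective (fun n => n%:R : C).
Proof.
suff le m n : m%:R = n%:R :> C -> (m <= n)%N.
  by move=> m n e; apply/eqP; rewrite eqn_leq !le.
move=> e; case: (leqP m n) => // lt_nm; have := natrC_eq0 (m - n).
by rewrite natrB ?(ltnW lt_nm) // e subrr eqxx subn_eq0 leqNgt lt_nm.
Qed.

(** A monic polynomial of degree d with integer coefficients takes at 1/p a value
    N / p^d with N congruent to 1 mod p. *)
Lemma algint_inv_prime p : prime p -> (p%:R : C)^-1 \notin Z_C.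
Proof.
move=> pr_p; apply/negP; rewrite inE => /asboolP[P mP].
have pC0 : (p%:R : C) != 0 by rewrite natrC_eq0 -lt0n prime_gt0.
have injz : injective (intr : int -> C).
  move=> x y /eqP; rewrite -subr_eq0 -rmorphB /= => z0; apply/eqP.
  rewrite -subr_eq0; case: (x - y) z0 => n; first by rewrite -pmulrn natrC_eq0.
  by rewrite NegzE rmorphN /= -pmulrn oppr_eq0 natrC_eq0.
rewrite rootE horner_poly.
set d := (size P).-1; have sP : size P = d.+1.
  by rewrite prednK // lt0n size_poly_eq0 monic_neq0.
rewrite sP => /eqP/(congr1 ( *%R (p%:R ^+ d))).
rewrite mulr0 mulr_sumr big_ord_recr /=.
have /eqP lP := mP; rewrite lead_coefE sP /= in lP.
rewrite lP mul1r exprVn divff ?expf_neq0 // => E.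
have : \sum_(i < d) P`_i * p%:Z ^+ (d - i) + 1 = 0.
  apply: injz; rewrite rmorph0 rmorphD rmorph_sum rmorph1 /= -[RHS]E; congr (_ + _).
  apply: eq_bigr => i _; rewrite rmorphM rmorphXn /= -pmulrn mulrCA; congr (_ * _).
  by rewrite exprVn expfB // -ltnS ltnW.
move/(congr1 (fun z => (p%:Z %| z)%Z)); rewrite dvdz0 rpredDl.
  by rewrite dvdzE /= dvdn1 => /eqP p1; rewrite p1 in pr_p.
apply: rpred_sum => i _.
by rewrite dvdz_mull // -(subnSK (ltn_ord i)) exprS dvdz_mulr.
Qed.

Lemma algint_nat_div p (N k : nat) :
  prime p -> coprime p N -> (0 < k)%N ->
  (N%:R / k%:R : C) \in Z_C -> ~~ (p %| k)%N.
Proof.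
move=> pr_p co k_gt0 ZNk; apply/negP=> /dvdnP[l Dk].
have pC0 : (p%:R : C) != 0 by rewrite natrC_eq0 -lt0n prime_gt0.
have lC0 : (l%:R : C) != 0.
  by rewrite natrC_eq0; apply: contraTneq k_gt0 => l0; rewrite Dk l0.
have N0 : (0 < N)%N.
  by case: (N) co => //; rewrite /coprime gcdn0 => /eqP p1; rewrite p1 in pr_p.
have ZNp : (N%:R / p%:R : C) \in Z_C.
  have -> : N%:R / p%:R = l%:R * (N%:R / k%:R) :> C.
    by rewrite Dk natrM invfM mulrCA mulVKf.
  by rewrite rpredM ?rpred_nat.
case/negP: (algint_inv_prime pr_p).
have [u v uv _] := egcdnP p N0.
have -> : (p%:R : C)^-1 = u%:R * (N%:R / p%:R) - v%:R.
  rewrite mulrA -natrM uv gcdnC (eqP co) natrD mulrDl natrM.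
  by rewrite mulfK // mul1r addrAC subrr add0r.
by apply: rpredB; rewrite ?rpred_nat //; apply: rpredM; rewrite ?rpred_nat.
Qed.

Lemma algint_char_poly n (c : 'M[C]_n) :
  (forall i j, c i j \in Z_C) -> char_poly c \is a polyOver Z_C.
Proof.
move=> Zc; rewrite /char_poly /determinant; apply: rpred_sum => s _.
apply: rpredM; first by rewrite rpredX ?rpredN ?rpred1.
apply: rpred_prod => i _; rewrite !mxE rpredB ?polyOverC ?Zc //.
by rewrite rpredMn ?polyOverX.
Qed.

Lemma trace_eigen n (t : 'M[C]_n) :
  (forall a, eigenvalue t a -> a \in Z_C) -> \tr t \in Z_C.
Proof.
case: n t => [|n] t Zt; first by rewrite /mxtrace big_ord0 rpred0.
have [s Ds] := closed_field_poly_normal (char_poly t).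
rewrite (monicP (char_poly_monic t)) scale1r in Ds.
have sz : size s = n.+1.
  by have := size_char_poly t; rewrite Ds size_prod_XsubC => -[].
have : - \tr t = - \sum_(a <- s) a.
  by rewrite -(char_poly_trace t isT) Ds -coefPn_prod_XsubC ?sz.
move/oppr_inj->.
rewrite big_seq rpred_sum // => a sa.
by apply: Zt; rewrite eigenvalue_root_char Ds root_prod_XsubC.
Qed.

(** Cayley-Hamilton for c, transported by lc to the eigenvector lc y of T. *)
Lemma eigen_char_poly (V : lmodType C) (T : {linear V -> V}) n (c : 'M[C]_n)
    (lc : {linear 'rV[C]_n -> V}) y a :
    (forall z, T (lc z) = lc (z *m c)) -> T (lc y) = a *: lc y -> lc y != 0 ->
  root (char_poly c) a.
Proof.
case: n c lc y => [|n] c lc y Tlc Ty nzy.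
  by rewrite (thinmx0 y) linear0 eqxx in nzy.
suff hP P : lc (y *m horner_mx c P) = P.[a] *: lc y.
  have := hP (char_poly c); rewrite Cayley_Hamilton mulmx0 linear0.
  by move/esym/eqP; rewrite scaler_eq0 (negPf nzy) orbF.
elim/poly_ind: P => [|P b IHP]; first by rewrite rmorph0 mulmx0 linear0 horner0 scale0r.
rewrite rmorphD rmorphM /= horner_mx_X horner_mx_C hornerMXaddC.
rewrite mulmxDr mul_mx_scalar linearD linearZ /= mulmxA -Tlc IHP linearZ /=.
by rewrite Ty scalerA scalerDl.
Qed.

(** A generating family v expresses T by an integral matrix c, whose
    characteristic polynomial annihilates T; so the eigenvalues of T, in
    particular those on the span of d, are algebraic integers. *)
Lemma trace_integral (V : lmodType C) (T : {linear V -> V}) (I A : finType)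
    (v : I -> V) (c : I -> I -> C) (d : A -> V) (t : A -> A -> C) :
    (forall i, T (v i) = \sum_k c i k *: v k) ->
    (forall i k, c i k \in Z_C) ->
    (forall a, exists x : I -> C, d a = \sum_i x i *: v i) ->
    (forall x : A -> C, \sum_a x a *: d a = 0 -> forall a, x a = 0) ->
    (forall a, T (d a) = \sum_b t a b *: d b) ->
  \sum_a t a a \in Z_C.
Proof.
move=> Tv Zc span free Td.
pose c' : 'M[C]_#|I| := \matrix_(i, k) c (enum_val i) (enum_val k).
pose t' : 'M[C]_#|A| := \matrix_(i, k) t (enum_val i) (enum_val k).
have trt' : \sum_a t a a = \tr t'.
  rewrite /mxtrace (reindex_onto enum_val enum_rank) => [|i _]; last exact: enum_rankK.
  by apply: eq_big => [i|i _]; rewrite ?enum_valK ?eqxx // mxE.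
pose lcf (y : 'rV[C]_#|I|) : V := \sum_i y 0 i *: v (enum_val i).
have lcP : linear lcf.
  move=> a y z; rewrite /lcf scaler_sumr -big_split; apply: eq_bigr => i _ /=.
  by rewrite !mxE scalerDl scalerA.
pose lcL := GRing.isLinear.Build _ _ _ _ lcf lcP.
pose lc : {linear 'rV[C]_#|I| -> V} := HB.pack lcf lcL.
have Tlc y : T (lc y) = lc (y *m c').
  rewrite /= /lcf linear_sum /=.
  under [RHS]eq_bigr do rewrite mxE scaler_suml.
  rewrite [RHS]exchange_big; apply: eq_bigr => i _ /=.
  rewrite linearZ /= Tv scaler_sumr.
  rewrite (reindex_onto enum_val enum_rank) => [|k _]; last exact: enum_rankK.
  by apply: eq_big => [k|k _]; rewrite ?enum_valK ?eqxx // mxE scalerA.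
have spanlc (x : A -> C) : exists y, \sum_a x a *: d a = lc y.
  elim/big_rec: _ => [|a h' _ [y ->]]; first by exists 0; rewrite linear0.
  have [z ->] := span a; exists (x a *: (\row_i z (enum_val i)) + y).
  rewrite linearD linearZ; congr (_ *: _ + _); rewrite /= /lcf.
  rewrite (reindex_onto enum_val enum_rank) => [|k _]; last exact: enum_rankK.
  by apply: eq_big => [k|k _]; rewrite ?enum_valK ?eqxx // mxE.
rewrite trt'; apply: trace_eigen => a /eigenvalueP[x tx nzx].
pose h := \sum_b x 0 (enum_rank b) *: d b.
have Th : T h = a *: h.
  rewrite linear_sum scaler_sumr /=.
  under eq_bigr do rewrite linearZ /= Td scaler_sumr.
  rewrite exchange_big; apply: eq_bigr => b _ /=.
  under eq_bigr do rewrite scalerA.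
  rewrite -scaler_suml scalerA; congr (_ *: _).
  transitivity ((x *m t') 0 (enum_rank b)); last by rewrite tx mxE.
  rewrite mxE [RHS](reindex_onto enum_rank enum_val) => [|k _]; last exact: enum_valK.
  by apply: eq_big => [k|k _]; rewrite ?enum_rankK ?eqxx // mxE !enum_rankK.
have nzh : h != 0.
  apply: contraNneq nzx => /free x0; apply/eqP/rowP=> i.
  by rewrite mxE -(enum_valK i) x0.
have [y Dh] := spanlc (fun b => x 0 (enum_rank b)); rewrite -/h in Dh.
rewrite Dh in Th nzh.
apply: (@algint_root (char_poly c')); first exact: char_poly_monic.
  by apply: algint_char_poly => i k; rewrite mxE.
exact: eigen_char_poly Tlc Th nzh.
Qed.

End AlgebraicIntegers.

(** * Group algebras and their tensor squares *)

Section GroupAlgebraTheory.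
Variables (F : fieldType) (gT : finGroupType).
Implicit Types (x y : galg F gT) (g h : gT).

Lemma galgZE a x g : (a *: x) g = a * x g :> F.
Proof. by rewrite ffunE. Qed.

Lemma galg_sumE (I : Type) (r : seq I) (P : pred I) (f : I -> galg F gT) g :
  (\sum_(i <- r | P i) f i) g = \sum_(i <- r | P i) f i g :> F.
Proof. by rewrite (sum_ffunE r P f g). Qed.

Lemma gelE g h : gel F g h = (h == g)%:R :> F. Proof. by rewrite ffunE. Qed.

Lemma galg_basis x : x = \sum_g (x g : F) *: gel F g.
Proof.
apply/ffunP=> h; rewrite galg_sumE (bigD1 h) //= big1 => [|g /negPf gh].
  by rewrite galgZE gelE eqxx mulr1 addr0.
by rewrite galgZE gelE eq_sym gh mulr0.
Qed.

Lemma galg_mulgelE x g h : (x * gel F g) h = x (h * g^-1)%g :> F.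
Proof.
rewrite galg_mulE (bigD1 (h * g^-1)%g) //= big1 => [|k nk].
  by rewrite gelE invMg invgK mulgKV eqxx mulr1 addr0.
rewrite gelE; case: eqP => [e|]; last by rewrite mulr0.
by case/eqP: nk; rewrite -e invMg invgK mulKVg.
Qed.

Lemma galg_gelmulE x g h : (gel F g * x) h = x (g^-1 * h)%g :> F.
Proof.
rewrite galg_mulE (bigD1 g) //= big1 => [|k /negPf nk].
  by rewrite gelE eqxx mul1r addr0.
by rewrite gelE nk mul0r.
Qed.

Lemma tens_gel g h : tens (gel F g) (gel F h) = gel F (g, h).
Proof. by apply/ffunP=> -[k l]; rewrite !ffunE /= -natrM mulnb. Qed.

Lemma tensDl x x' y : tens (x + x') y = tens x y + tens x' y.
Proof. by apply/ffunP=> u; rewrite !ffunE mulrDl. Qed.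
Lemma tensDr x y y' : tens x (y + y') = tens x y + tens x y'.
Proof. by apply/ffunP=> u; rewrite !ffunE mulrDr. Qed.
Lemma tensZl a x y : tens (a *: x) y = a *: tens x y.
Proof. by apply/ffunP=> u; rewrite !ffunE scalerAl. Qed.
Lemma tensZr a x y : tens x (a *: y) = a *: tens x y.
Proof. by apply/ffunP=> u; rewrite !ffunE scalerAr. Qed.
Lemma tens0l y : tens 0 y = 0.
Proof. by apply/ffunP=> u; rewrite !ffunE mul0r. Qed.
Lemma tens0r x : tens x 0 = 0.
Proof. by apply/ffunP=> u; rewrite !ffunE mulr0. Qed.

Lemma tens_suml (I : Type) (r : seq I) (P : pred I) (f : I -> galg F gT) y :
  tens (\sum_(i <- r | P i) f i) y = \sum_(i <- r | P i) tens (f i) y.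
Proof. by elim/big_rec2: _ => [|i a b _ <-]; rewrite ?tens0l ?tensDl. Qed.
Lemma tens_sumr (I : Type) (r : seq I) (P : pred I) (f : I -> galg F gT) x :
  tens x (\sum_(i <- r | P i) f i) = \sum_(i <- r | P i) tens x (f i).
Proof. by elim/big_rec2: _ => [|i a b _ <-]; rewrite ?tens0r ?tensDr. Qed.

Lemma tensM x x' y y' : tens x y * tens x' y' = tens (x * x') (y * y').
Proof.
apply/ffunP=> -[g h]; rewrite galg_mulE ffunE !galg_mulE /= mulr_suml.
under [RHS]eq_bigr do rewrite mulr_sumr.
by rewrite pair_bigA /=; apply: eq_bigr => -[k l] _; rewrite !ffunE /= mulrACA.
Qed.

Lemma galg_comult_gel g : galg_comult (gel F g) = tens (gel F g) (gel F g).
Proof.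
rewrite /galg_comult (bigD1 g) //= big1 => [|h /negPf hg].
  by rewrite gelE eqxx scale1r addr0.
by rewrite gelE hg scale0r.
Qed.

Fact galg_comult_linear : linear (@galg_comult F gT).
Proof.
move=> a x y; rewrite /galg_comult scaler_sumr -big_split; apply: eq_bigr => g _ /=.
by rewrite scalerA -scalerDl !ffunE.
Qed.
HB.instance Definition _ := GRing.isLinear.Build F (galg F gT)
  (galg F (gT * gT)%type) _ (@galg_comult F gT) galg_comult_linear.

Lemma galg_comultM x y : galg_comult (x * y) = galg_comult x * galg_comult y.
Proof.
rewrite [x]galg_basis [y]galg_basis mulr_suml !linear_sum mulr_suml /=.
apply: eq_bigr => g _; rewrite mulr_sumr !linear_sum mulr_sumr /=.
apply: eq_bigr => h _; rewrite -scalerAl -scalerAr !linearZ /= -scalerAl -scalerAr.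
by rewrite -gelM !galg_comult_gel tensM -gelM.
Qed.

(** The contractions (xi (x) id)(w) and (id (x) xi)(w). *)
Definition lcontract (xi : galg F gT -> F) (w : galg F (gT * gT)%type) : galg F gT :=
  \sum_(u : gT * gT) (w u * xi (gel F u.1) : F) *: gel F u.2.
Definition rcontract (xi : galg F gT -> F) (w : galg F (gT * gT)%type) : galg F gT :=
  \sum_(u : gT * gT) (w u * xi (gel F u.2) : F) *: gel F u.1.

Fact lcontract_linear xi : linear (lcontract xi).
Proof.
move=> a w w'; rewrite /lcontract scaler_sumr -big_split; apply: eq_bigr => u _ /=.
by rewrite scalerA -scalerDl !ffunE mulrDl mulrA.
Qed.
HB.instance Definition _ xi := GRing.isLinear.Build F
  (galg F (gT * gT)%type) (galg F gT) _ (lcontract xi) (lcontract_linear xi).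

Fact rcontract_linear xi : linear (rcontract xi).
Proof.
move=> a w w'; rewrite /rcontract scaler_sumr -big_split; apply: eq_bigr => u _ /=.
by rewrite scalerA -scalerDl !ffunE mulrDl mulrA.
Qed.
HB.instance Definition _ xi := GRing.isLinear.Build F
  (galg F (gT * gT)%type) (galg F gT) _ (rcontract xi) (rcontract_linear xi).

Lemma lcontract_tens (xi : {linear galg F gT -> F^o}) x y :
  lcontract xi (tens x y) = (xi x : F) *: y.
Proof.
transitivity (\sum_k \sum_l (tens x y (k, l) * xi (gel F k) : F) *: gel F l).
  by rewrite pair_bigA; apply: eq_bigr => -[].
rewrite exchange_big {2}[y]galg_basis scaler_sumr; apply: eq_bigr => l _ /=.
rewrite -scaler_suml scalerA; congr (_ *: _); rewrite {2}[x]galg_basis.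
rewrite linear_sum mulr_suml; apply: eq_bigr => k _ /=.
by rewrite linearZ !ffunE /= mulrAC.
Qed.

Lemma rcontract_tens (xi : {linear galg F gT -> F^o}) x y :
  rcontract xi (tens x y) = (xi y : F) *: x.
Proof.
transitivity (\sum_k \sum_l (tens x y (k, l) * xi (gel F l) : F) *: gel F k).
  by rewrite pair_bigA; apply: eq_bigr => -[].
rewrite {2}[x]galg_basis scaler_sumr; apply: eq_bigr => k _ /=.
rewrite -scaler_suml scalerA; congr (_ *: _); rewrite {2}[y]galg_basis.
rewrite linear_sum mulr_suml; apply: eq_bigr => l _ /=.
rewrite linearZ !ffunE /=. by rewrite -mulrA mulrC.
Qed.

(** The trace of the operator x |-> y x s^-1 on the group algebra. *)
Definition class_sum (s : gT) (y : galg F gT) : F := \sum_(g : gT) (y (s ^ g)%g : F).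

Fact class_sum_linear s : linear (class_sum s : galg F gT -> F^o).
Proof.
move=> a x y; rewrite /class_sum scaler_sumr -big_split; apply: eq_bigr => g _ /=.
by rewrite !ffunE.
Qed.
HB.instance Definition _ s := GRing.isLinear.Build F (galg F gT) F^o _
  (class_sum s : galg F gT -> F^o) (class_sum_linear s).

Lemma class_sum_gel s g : class_sum s (gel F g) =
  if g \in (s ^: [set: gT])%g then #|'C[s]%g|%:R else 0.
Proof.
rewrite /class_sum; under eq_bigr do rewrite gelE.
transitivity (#|[pred k | s ^ k == g]%g|%:R : F).
  rewrite -sum1_card natr_sum [RHS]big_mkcond /=; apply: eq_bigr => k _.
  by rewrite inE; case: eqP.
case: imsetP => [[k _ ->]|ng].
  congr _%:R; rewrite -(card_rcoset _ k); apply: eq_card => h.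
  rewrite !inE mem_rcoset cent1E -(inj_eq (conjg_inj k^-1%g)) -!conjgM mulgV conjg1.
  by rewrite -(inj_eq (mulgI (h * k^-1)%g)) -conjgC.
by rewrite eq_card0 // => h; rewrite inE; apply/eqP=> e; case: ng; exists h.
Qed.

End GroupAlgebraTheory.

(** * Characters of M and the idempotents of its group algebra *)

Section Characters.
Variables (C : closedFieldType) (gT : finGroupType) (M : {group gT}).
Local Notation lchar := (@lchar C gT M).
Implicit Types phi psi chi : lchar.

(** The coordinates of an algebra isomorphism from K[M] onto a power of K are
    characters of M. *)
Lemma split_galg_separates (K : fieldType) (iotaK : {rmorphism K -> C}) m :
  split_galg K M -> m \in M -> (forall phi, phi m = 1) -> m = 1%g.
Proof.
case=> f [/bij_inj inj_f _ f1 fM] Mm triv.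
pose s v := subg M v.
have sM u v : u \in M -> v \in M -> s (u * v)%g = (s u * s v)%g.
  by move=> Mu Mv; apply: val_inj; rewrite /= !subgK ?groupM.
pose h i : {ffun gT -> C} :=
  [ffun v => if v \in M then iotaK (f (gel K (s v)) i) else 0].
have lh i : is_lchar M (h i).
  apply/and3P; split.
  - rewrite ffunE group1 (_ : s 1%g = 1%g) -?galg_oneE ?f1 ?ffunE ?rmorph1 //.
    by apply: val_inj; rewrite /= subgK.
  - apply/forall_inP=> u Mu; apply/forall_inP=> v Mv.
    by rewrite !ffunE groupM // Mu Mv sM // gelM fM ffunE rmorphM.
  by apply/forall_inP=> u /negPf nMu; rewrite ffunE nMu.
have : gel K (s m) = gel K (1%g : [subg M]).
  apply: inj_f; apply/ffunP=> i; rewrite -galg_oneE f1 ffunE.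
  apply: (fmorph_inj iotaK); rewrite rmorph1.
  by have := triv (LChar (lh i)); rewrite /= ffunE Mm.
move/ffunP/(_ (s m)); rewrite !gelE eqxx => /esym/eqP.
have [e1 _|_] := eqVneq (s m) 1%g; last by rewrite eq_sym oner_eq0.
by move/(congr1 val): e1; rewrite /= subgK.
Qed.

Lemma lcharMl phi psi v : (phi * psi)%g v = phi v * psi v.
Proof. by rewrite /= ffunE. Qed.

Lemma lchar1l v : v \in M -> (1%g : lchar) v = 1.
Proof. by move=> Mv; rewrite /= ffunE Mv. Qed.

Lemma lcharVr phi v : v \in M -> phi v^-1%g = (phi v)^-1.
Proof.
move=> Mv; apply: (mulfI (lchar_neq0 phi Mv)).
by rewrite -lcharM ?groupV // mulgV lchar1 divff ?lchar_neq0.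
Qed.

Lemma lcharVl phi v : phi^-1%g v = (phi v)^-1.
Proof. by rewrite /= ffunE. Qed.

Lemma lcharP phi psi : (forall v, v \in M -> phi v = psi v) -> phi = psi.
Proof.
move=> e; apply/val_inj/ffunP=> v.
by have [/e//|nMv] := boolP (v \in M); rewrite /= !lchar_out.
Qed.

Lemma lchar_commute phi psi : (phi * psi = psi * phi)%g.
Proof. by apply: lcharP => v _; rewrite !lcharMl mulrC. Qed.

Lemma sum_lchar_elt phi : \sum_(v in M) phi v = if phi == 1%g then #|M|%:R else 0.
Proof.
case: eqP => [->|n1].
  by under eq_bigr => v Mv do rewrite lchar1l //; rewrite sumr_const.
have [u Mu nu] : exists2 u, u \in M & phi u != 1.
  have [/exists_inP[u Mu nu]|] := boolP [exists u in M, phi u != 1]; first by exists u.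
  rewrite negb_exists_in => /forall_inP t; case: n1; apply: lcharP => v Mv.
  by rewrite lchar1l //; apply/eqP; rewrite -[_ == _]negbK t.
have : phi u * \sum_(v in M) phi v = \sum_(v in M) phi v.
  rewrite mulr_sumr [RHS](reindex_inj (mulgI u)) /=.
  by apply: eq_big => v; rewrite ?groupMl // => Mv; rewrite lcharM.
move/eqP; rewrite -subr_eq0 -[X in _ - X]mul1r -mulrBl mulf_eq0 subr_eq0 (negPf nu).
by move/eqP.
Qed.

Hypothesis C0 : [pchar C] =i pred0.
Hypothesis sep : forall m, m \in M -> (forall phi, phi m = 1) -> m = 1%g.

Lemma sum_elt_lchar0 m : m \in M -> m != 1%g -> \sum_(phi : lchar) phi m = 0.
Proof.
move=> Mm n1; have [psi npsi] : exists psi : lchar, psi m != 1.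
  have [/existsP[psi]|] := boolP [exists psi : lchar, psi m != 1]; first by exists psi.
  rewrite negb_exists => /forallP t; case/eqP: n1; apply: sep => // phi.
  by apply/eqP; rewrite -[_ == _]negbK t.
have : psi m * \sum_(phi : lchar) phi m = \sum_(phi : lchar) phi m.
  rewrite mulr_sumr [RHS](reindex_inj (mulgI psi)) /=.
  by apply: eq_bigr => phi _; rewrite -lcharMl.
move/eqP; rewrite -subr_eq0 -[X in _ - X]mul1r -mulrBl mulf_eq0 subr_eq0 (negPf npsi).
by move/eqP.
Qed.

Lemma card_lchar : #|{: lchar}| = #|M|.
Proof.
have : \sum_(v in M) \sum_(phi : lchar) phi v = \sum_(phi : lchar) \sum_(v in M) phi v.
  by rewrite exchange_big.
rewrite (bigD1 1%g) //= [X in _ + X]big1 => [|v /andP[Mv n1]]; last exact: sum_elt_lchar0.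
rewrite addr0 [RHS](bigD1 1%g) // [X in _ = _ + X]big1 => [|phi n1]; last first.
  by rewrite sum_lchar_elt (negPf n1).
rewrite sum_lchar_elt eqxx addr0; under eq_bigr do rewrite lchar1.
by rewrite sumr_const; move/(natrC_inj C0).
Qed.

Lemma sum_elt_lchar m : m \in M ->
  \sum_(phi : lchar) phi m = if m == 1%g then #|M|%:R else 0.
Proof.
move=> Mm; case: eqP => [->|/eqP n1]; last exact: sum_elt_lchar0.
by under eq_bigr do rewrite lchar1; rewrite sumr_const card_lchar.
Qed.

Local Notation e := (@char_idem C gT M).
Local Arguments char_idem : simpl never.

Lemma cardM_neq0 : #|M|%:R != 0 :> C.
Proof. by rewrite natrC_eq0 // -lt0n cardG_gt0. Qed.

Lemma char_idemE phi g : e phi g = #|M|%:R^-1 * phi g^-1%g :> C.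
Proof.
rewrite /char_idem galgZE galg_sumE; congr (_ * _).
have [Mg|nMg] := boolP (g \in M).
  rewrite (bigD1 g) //= big1 => [|v /andP[_ /negPf vg]].
    by rewrite galgZE gelE eqxx mulr1 addr0.
  by rewrite galgZE gelE eq_sym vg mulr0.
rewrite lchar_out ?groupV // big1 // => v Mv.
by rewrite galgZE gelE; case: eqP nMg => [->|]; rewrite ?Mv ?mulr0.
Qed.

Lemma gel_char_idem phi v : v \in M -> gel C v * e phi = phi v *: e phi.
Proof.
move=> Mv; apply/ffunP=> g; rewrite galg_gelmulE (galgZE (phi v)) !char_idemE invMg invgK.
have [Mg|nMg] := boolP (g \in M); first by rewrite lcharM ?groupV // mulrA [RHS]mulrC.
by rewrite (@lchar_out _ _ _ phi g^-1%g) ?(@lchar_out _ _ _ phi (g^-1 * v)%g) ?groupMr ?groupV // !mulr0.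
Qed.

Lemma char_idemM phi psi : e phi * e psi = if phi == psi then e phi else 0.
Proof.
rewrite {1}/char_idem -scalerAl mulr_suml.
under eq_bigr => v Mv.
  rewrite -scalerAl gel_char_idem // scalerA lcharVr // -lcharVl -lcharMl; over.
rewrite -scaler_suml sum_lchar_elt scalerA -eq_mulVg1.
case: eqP => [->|_]; first by rewrite mulVf ?cardM_neq0 ?scale1r.
by rewrite mulr0 scale0r.
Qed.

Lemma gel_sum_char_idem v : v \in M -> gel C v = \sum_(phi : lchar) phi v *: e phi.
Proof.
move=> Mv; apply/ffunP=> g; rewrite galg_sumE gelE.
under eq_bigr => phi _ do rewrite (galgZE (phi v)) char_idemE mulrCA.
rewrite -mulr_sumr; have [Mg|nMg] := boolP (g \in M).
  under eq_bigr do rewrite -lcharM ?groupV //.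
  rewrite sum_elt_lchar ?groupM ?groupV // -eq_mulgV1 (eq_sym v).
  by have [_|_] := eqVneq g v; rewrite ?mulr0 // mulVf // cardM_neq0.
rewrite big1 ?mulr0 => [|phi _]; last by rewrite (@lchar_out _ _ _ phi g^-1%g) ?groupV ?mulr0.
by case: eqP nMg => // ->; rewrite Mv.
Qed.

Lemma sum_char_idem : \sum_(phi : lchar) e phi = 1.
Proof.
rewrite galg_oneE gel_sum_char_idem //.
by apply: eq_bigr => phi _; rewrite lchar1 scale1r.
Qed.

Lemma comult_char_idem phi :
  galg_comult (e phi) = \sum_(psi : lchar) tens (e psi) (e (psi^-1 * phi)%g).
Proof.
have -> : galg_comult (e phi) = #|M|%:R^-1 *: \sum_(v in M) \sum_(psi : lchar)
    \sum_(chi : lchar) (phi v^-1%g * (psi v * chi v)) *: tens (e psi) (e chi).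
  rewrite /char_idem linearZ linear_sum /=; congr (_ *: _).
  apply: eq_bigr => v Mv; rewrite linearZ /= galg_comult_gel -/(e _).
  rewrite {1}(gel_sum_char_idem Mv) tens_suml scaler_sumr; apply: eq_bigr => psi _.
  rewrite {1}(gel_sum_char_idem Mv) tens_sumr scaler_sumr; apply: eq_bigr => chi _.
  by rewrite tensZl tensZr !scalerA mulrA.
rewrite exchange_big scaler_sumr; apply: eq_bigr => psi _.
have [c Dc Ec] : exists2 c : lchar, (psi^-1 * phi)%g = c &
    forall v, c v = (psi v)^-1 * phi v.
  by exists (psi^-1 * phi)%g => // v; rewrite lcharMl lcharVl.
rewrite Dc exchange_big (bigD1 c) //= [X in _ + X]big1 ?addr0 => [|chi nchi].
  rewrite -scaler_suml scalerA (eq_bigr (fun=> 1)) => [|v Mv].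
    by rewrite sumr_const mulVf ?scale1r ?cardM_neq0.
  rewrite Ec mulVKf ?lchar_neq0 // lcharVr //.
  by rewrite mulVf ?lchar_neq0.
rewrite -scaler_suml.
under eq_bigr => v Mv do rewrite lcharVr // -lcharVl -!lcharMl.
rewrite sum_lchar_elt; case: eqP => [E|_]; last by rewrite scale0r.
by case/eqP: nchi; rewrite -Dc; move/eqP: E; rewrite -eq_mulVg1 => /eqP->; rewrite mulKg.
Qed.

End Characters.

(** * Non-degenerate cocycles, and dual bases of Hopf orders *)

Section Cocycle.
Variables (C : fieldType) (A : finGroupType) (w : A -> A -> C).
Hypothesis commA : forall a b : A, (a * b = b * a)%g.
Hypotheses (cocycle_w : cocycle2 w) (norm_w : cocycle_normalized w).
Hypothesis (nondeg_w : cocycle_nondegenerate w).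

Let w_neq0 a b : w a b != 0. Proof. by case: cocycle_w. Qed.

Lemma cocycle_pairingM a b c :
  w a (b * c)%g / w (b * c)%g a = (w a b / w b a) * (w a c / w c a).
Proof.
have [_ cw] := cocycle_w.
have e1 := cw a b c; have e2 := cw b c a; have e3 := cw b a c.
rewrite (commA b a) (commA a c) in e3.
have E1 : w a (b * c)%g = w a b * w (a * b)%g c / w b c.
  by rewrite e1 mulrC mulKf.
have E2 : w (b * c)%g a = w c a * w b (c * a)%g / w b c.
  by rewrite -e2 mulrC mulKf.
have E3 : w (a * b)%g c = w a c * w b (c * a)%g / w b a.
  by rewrite -e3 mulrC mulKf.
rewrite E1 E2 E3; field.
by rewrite !w_neq0.
Qed.

(** Conjugation by the basis element u_d of the twisted group algebra of A
    multiplies u_g by the value at (d, g) of the alternating pairing of w. *)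
Lemma sum_cocycle_conj d :
  \sum_g w d g * w (d * g)%g d^-1%g = if d == 1%g then #|A|%:R else 0.
Proof.
have [_ cw] := cocycle_w.
have E g : w d g * w (d * g)%g d^-1%g = w d d^-1%g * (w d g / w g d).
  have := cw g d d^-1%g; rewrite mulgV (norm_w g).1 mulr1 (commA g d) => <-.
  by field; rewrite w_neq0.
case: eqP => [->|/eqP nd].
  rewrite (eq_bigr (fun=> 1)) ?sumr_const // => g _.
  by rewrite invg1 mul1g (norm_w _).1 (norm_w _).2 mulr1.
under eq_bigr do rewrite E; rewrite -mulr_sumr.
have [h nh] : exists h, w d h / w h d != 1.
  have [/existsP //|] := boolP [exists h, w d h / w h d != 1].
  rewrite negb_exists => /forallP t; case/eqP: nd; apply: nondeg_w => b.
  by apply/eqP; rewrite -[_ == _]negbK t.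
suff /eqP : (w d h / w h d) * \sum_g w d g / w g d = \sum_g w d g / w g d.
  rewrite -subr_eq0 -[X in _ - X]mul1r -mulrBl mulf_eq0 subr_eq0 (negPf nh).
  by move/eqP->; rewrite mulr0.
rewrite mulr_sumr [RHS](reindex_inj (mulgI h)) /=.
by apply: eq_bigr => g _; rewrite cocycle_pairingM.
Qed.

End Cocycle.

Section HopfOrderElements.
Variables (C : closedFieldType) (gT : finGroupType).
Local Notation CG := (galg C gT).
Local Notation Co := ((C : fieldType)^o).
Local Notation Z_C := (@algint_of C).
Variables (R : comNzRingType) (iota : {rmorphism R -> C}) (X : lmodType R).
Variables (j : {linear X -> CG | iota \; *:%R}) (H : hopf_structure C gT).
Hypothesis iotaZ : forall r, iota r \in Z_C.
Hypothesis ordX : hopf_order H j.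

(** A projective module is a retract of a free one, and the coordinates of the
    retraction extend linearly to CG, the tensor product of X and C. *)
Lemma hopf_order_dual_basis : exists (n : nat) (x : 'I_n -> X)
    (f : 'I_n -> {linear CG -> Co}),
  (forall i y, exists r, f i (j y) = iota r) /\
  (forall h, h = \sum_i (f i h : C) *: j (x i)).
Proof.
have [n [x genx]] := ho_fin_generated ordX.
pose s (u : 'rV[R]_n) : X := \sum_i u 0 i *: x i.
have s_lin : linear s.
  move=> a u v; rewrite /s scaler_sumr -big_split; apply: eq_bigr => i _ /=.
  by rewrite !mxE scalerDl scalerA.
pose sL := GRing.isLinear.Build _ _ _ _ s s_lin.
pose S : {linear 'rV[R]_n -> X} := HB.pack s sL.
have surjS v : exists u, S u = v.
  have [c ->] := genx v; exists (\row_i c i).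
  by rewrite /= /s; apply: eq_bigr => i _; rewrite mxE.
have [k kK] := ho_projective ordX (idfun : {linear X -> X}) surjS.
have [balj univ] := ho_base_change ordX.
have jZ r y : j (r *: y) = iota r *: j y by rewrite linearZ.
have exf i : exists f : {additive CG -> Co},
    forall y a, f (a *: j y) = a * iota (k y 0 i).
  have [|f [fP _]] := univ Co (fun y a => a * iota (k y 0 i)); last by exists f.
  split=> [y z a|y a b|r y a].
  - by rewrite linearD mxE rmorphD mulrDr.
  - by rewrite mulrDl.
  - by rewrite linearZ mxE rmorphM mulrCA mulrA.
have span h : exists c : 'I_n -> C, h = \sum_i c i *: j (x i).
  pose b := [tuple j (x i) | i < n].
  have nthb (i : 'I_n) : b`_i = j (x i) by rewrite -tnth_nth tnth_mktuple.
  have jW y : j y \in <<b>>%VS.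
    have [c ->] := genx y; rewrite linear_sum rpred_sum // => i _.
    by rewrite jZ rpredZ // -nthb memv_span // mem_nth ?size_tuple.
  have [|f [_ uf]] := univ CG (fun y a => a *: j y) _; first exact: balj.
  have: h \in <<b>>%VS.
    have pid y a : projv <<b>>%VS (a *: j y) = a *: j y by rewrite projv_id ?rpredZ.
    have e1 := uf (projv <<b>>%VS) pid h; have e2 := uf idfun (fun y a => erefl) h.
    by rewrite /= in e2; rewrite e2 -e1 memv_proj.
  move/coord_span=> Dh; exists (fun i => coord b i h).
  by rewrite {1}Dh; apply: eq_bigr => i _; rewrite nthb.
have exfL i : exists f : {linear CG -> Co},
    forall y a, f (a *: j y) = a * iota (k y 0 i).
  have [f fP] := exf i; suff f_lin : linear f.
    pose fL := GRing.isLinear.Build _ _ _ _ (f : CG -> Co) f_lin.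
    pose f' : {linear CG -> Co} := HB.pack (f : CG -> Co) fL.
    by exists f'.
  move=> a u v; rewrite raddfD; congr (_ + _); have [c ->] := span u.
  rewrite scaler_sumr !raddf_sum; apply: eq_bigr => l _ /=.
  by rewrite scalerA !fP -mulrA.
pose f i := projT1 (cid (exfL i)).
have fP i y a : f i (a *: j y) = a * iota (k y 0 i) by rewrite /f; case: cid.
exists n, x, f; split=> [i y|h].
  by exists (k y 0 i); rewrite -[j y]scale1r fP mul1r.
have [c ->] := span h; under [RHS]eq_bigr do rewrite linear_sum scaler_suml.
rewrite exchange_big; apply: eq_bigr => l _ /=.
have : x l = s (k (x l)) by have := kK (x l).
rewrite /s => {1}->; rewrite linear_sum scaler_sumr; apply: eq_bigr => i _.
by rewrite jZ scalerA fP.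
Qed.

End HopfOrderElements.

(** * Integral elements *)

Section IntegralElements.
Variables (C : closedFieldType) (gT : finGroupType).
Local Notation CG := (galg C gT).
Local Notation Co := ((C : fieldType)^o).
Local Notation Z_C := (@algint_of C).
Variables (R : comNzRingType) (iota : {rmorphism R -> C}) (X : lmodType R).
Variables (j : {linear X -> CG | iota \; *:%R}) (H : hopf_structure C gT).
Hypothesis iotaZ : forall r, iota r \in Z_C.
Hypothesis ordX : hopf_order H j.
Variable Delta : {linear CG -> galg C (gT * gT)%type}.
Hypothesis DeltaE : comult H =1 Delta.
Variables (n : nat) (x : 'I_n -> X) (f : 'I_n -> {linear CG -> Co}).
Hypothesis fj : forall i y, exists r, f i (j y) = iota r.
Hypothesis fB : forall h, h = \sum_i (f i h : C) *: j (x i).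

(** The elements of the span of X over the ring of all algebraic integers. *)
Definition order_integral (h : CG) := forall i, (f i h : C) \in Z_C.

Lemma fjZ i y : (f i (j y) : C) \in Z_C.
Proof. by have [r ->] := fj i y. Qed.

Lemma order_integral_sum (I : finType) (a : I -> C) (h : I -> CG) :
  (forall i, a i \in Z_C) -> (forall i, order_integral (h i)) ->
  order_integral (\sum_i a i *: h i).
Proof.
move=> Za Zh k; rewrite linear_sum rpred_sum // => i _.
by rewrite linearZ rpredM // Zh.
Qed.

Lemma order_integralM h h' :
  order_integral h -> order_integral h' -> order_integral (h * h').
Proof.
move=> Zh Zh'; rewrite (fB h) (fB h') mulr_suml.
under eq_bigr do rewrite -scalerAl; apply: order_integral_sum => // i.
rewrite mulr_sumr; under eq_bigr do rewrite -scalerAr.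
apply: order_integral_sum => // k l.
by have [z <-] := ho_mul ordX (x i) (x k); apply: fjZ.
Qed.

Lemma order_integral_lcontract (xi : {linear CG -> Co}) h :
  (forall y, (xi (j y) : C) \in Z_C) -> order_integral h ->
  order_integral (lcontract xi (Delta h)).
Proof.
move=> Zxi Zh; rewrite (fB h) (linear_sum Delta) (linear_sum (lcontract xi)).
under eq_bigr do rewrite (linearZ_LR Delta) (linearZ_LR (lcontract xi)) /=.
apply: order_integral_sum => // i.
have [s] := ho_comult ordX (x i); rewrite DeltaE => ->.
rewrite (linear_sum (lcontract xi)) => k; rewrite linear_sum rpred_sum // => u _ /=.
by rewrite lcontract_tens linearZ rpredM // fjZ.
Qed.

(** The operator y |-> h y s^-1 maps each j (x i) g to a combination of such
    elements with algebraic integers as coefficients. *)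
Lemma class_sum_integral s h : order_integral h -> class_sum s h \in Z_C.
Proof.
move=> Zh; pose T (y : CG) : CG := h * y * gel C s^-1.
have T_lin : linear T.
  by move=> a u v; rewrite /T mulrDr mulrDl -scalerAr -scalerAl.
pose TL := GRing.isLinear.Build _ _ _ _ T T_lin.
pose T' : {linear CG -> CG} := HB.pack T TL.
pose v (ig : 'I_n * gT) := j (x ig.1) * gel C ig.2.
pose c (ig lk : 'I_n * gT) : C :=
  f lk.1 (h * j (x ig.1)) * (lk.2 == ig.2 * s^-1)%g%:R.
have Zj y : order_integral (j y) by move=> i; apply: fjZ.
have -> : class_sum s h = \sum_g (T (gel C g) g : C).
  rewrite /class_sum (reindex_inj invg_inj); apply: eq_bigr => g _.
  by rewrite /T !galg_mulgelE conjgE !invgK mulgA.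
apply: (@trace_integral _ _ T' _ _ v c (@gel C gT) (fun g k => T (gel C g) k)).
- move=> [i g]; rewrite /= /T /v /c /= mulrA {1}(fB (h * j (x i))).
  rewrite -mulrA -gelM mulr_suml.
  transitivity (\sum_l \sum_k ((f l (h * j (x i)) : C) * (k == g * s^-1)%g%:R)
      *: (j (x l) * gel C k)).
    apply: eq_bigr => l _; rewrite (bigD1 (g * s^-1)%g) //= big1 => [|k /negPf->].
      by rewrite eqxx mulr1 addr0 scalerAl.
    by rewrite mulr0 scale0r.
  by rewrite pair_bigA.
- move=> ig lk; rewrite /c rpredM ?rpred_nat //.
  exact: order_integralM.
- move=> g; exists (fun ig => (f ig.1 1 : C) * (ig.2 == g)%:R).
  rewrite -[LHS]mul1r {1}(fB 1) mulr_suml /v.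
  transitivity (\sum_l \sum_k ((f l 1 : C) * (k == g)%:R) *: (j (x l) * gel C k)).
    apply: eq_bigr => l _; rewrite (bigD1 g) //= big1 => [|k /negPf->].
      by rewrite eqxx mulr1 addr0 scalerAl.
    by rewrite mulr0 scale0r.
  by rewrite pair_bigA.
- move=> a a0 g; move/ffunP/(_ g): a0.
  rewrite galg_sumE (bigD1 g) //= big1 => [|k /negPf gk].
    by rewrite galgZE gelE eqxx mulr1 addr0 ffunE.
  by rewrite galgZE gelE eq_sym gk mulr0.
- by move=> g; apply: galg_basis.
Qed.

Lemma order_rcontract i y : exists z, rcontract (f i) (Delta (j y)) = j z.
Proof.
have [s] := ho_comult ordX y; rewrite DeltaE => ->.
elim: s => [|u s [z IHs]]; first by exists 0; rewrite big_nil (linear0 j) linear0.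
have [r er] := fj i u.2; exists (r *: u.1 + z).
by rewrite big_cons (linearD (rcontract (f i))) /= IHs rcontract_tens er linearD linearZ.
Qed.

Lemma order_lcontract i y : exists z, lcontract (f i) (Delta (j y)) = j z.
Proof.
have [s] := ho_comult ordX y; rewrite DeltaE => ->.
elim: s => [|u s [z IHs]]; first by exists 0; rewrite big_nil (linear0 j) linear0.
have [r er] := fj i u.1; exists (r *: u.2 + z).
by rewrite big_cons (linearD (lcontract (f i))) /= IHs lcontract_tens er linearD linearZ.
Qed.

(** A subcoalgebra dual to a twisted group algebra of A is a matrix coalgebra
    of degree the square root N of #|A|, and N d 1 is its irreducible
    character. The trace of h |-> xi (h_1) h_2 xi (h_3) on it is the square of
    the value of xi at this character, which avoids both the choice of a simple
    comodule and the square root. *)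
Lemma matrix_coalgebra_character (A : finGroupType) (w : A -> A -> C)
    (d : A -> CG) (N : nat) :
    (forall a b : A, (a * b = b * a)%g) ->
    cocycle2 w -> cocycle_normalized w -> cocycle_nondegenerate w ->
    (#|A| = N ^ 2)%N ->
    (forall a : A -> C, \sum_c a c *: d c = 0 -> forall c, a c = 0) ->
    (forall c, Delta (d c) =
       \sum_a w a (a^-1 * c)%g *: tens (d a) (d (a^-1 * c)%g)) ->
  order_integral (N%:R *: d 1%g).
Proof.
move=> commA cw nw ndw cardA free Dd i; set xi := f i.
pose T : {linear CG -> CG} :=
  (lcontract xi \o Delta \o (rcontract xi \o Delta) : {linear CG -> CG}).
pose y a : C := xi (d a).
pose t c b : C := \sum_a (w a (a^-1 * c)%g * y (a^-1 * c)%g) *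
   (w (a * b^-1)%g b * y (a * b^-1)%g).
have Zt : \sum_c t c c \in Z_C.
  apply: (@trace_integral _ _ T _ _ (fun k => j (x k))
      (fun k l => f l (T (j (x k)))) d) => //.
  - by move=> k l; rewrite /=; have [z ->] := order_rcontract i (x k);
      have [z' ->] := order_lcontract i z; apply: fjZ.
  - by move=> c; exists (fun k => f k (d c)); apply: fB.
  - move=> c; rewrite [LHS]/= Dd (linear_sum (rcontract xi)).
    rewrite (linear_sum Delta) (linear_sum (lcontract xi)).
    under eq_bigr => a _.
      rewrite (linearZ_LR (rcontract xi)) /= rcontract_tens scalerA.
      rewrite (linearZ_LR Delta) Dd (linearZ_LR (lcontract xi)).
      rewrite (linear_sum (lcontract xi)) /=; over.
    under [RHS]eq_bigr do rewrite scaler_suml.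
    rewrite [RHS]exchange_big /=; apply: eq_bigr => a _.
    rewrite scaler_sumr [RHS](reindex_inj (inj_comp (mulIg a) invg_inj)) /=.
    apply: eq_bigr => e _.
    rewrite (linearZ_LR (lcontract xi)) /= lcontract_tens !scalerA; congr (_ *: _).
      by rewrite invMg invgK !mulgA mulgV mul1g /y; ring.
have : \sum_c t c c = (N%:R * y 1%g) ^+ 2.
  rewrite /t.
  under eq_bigr => c _ do rewrite (reindex_inj (mulIg c)).
  rewrite exchange_big (bigD1 1%g) //= [X in _ + X]big1 ?addr0 => [|a na].
    transitivity (\sum_c w 1%g c * w (1 * c)%g 1^-1%g * (y 1%g ^+ 2)).
      apply: eq_bigr => c _; rewrite mul1g mulVg mulgV invg1.
      by ring.
    by rewrite -mulr_suml sum_cocycle_conj // eqxx cardA natrX exprMn.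
  transitivity (\sum_c w a c * w (a * c)%g a^-1%g * (y a^-1%g * y a)).
    apply: eq_bigr => c _; rewrite invMg (commA c^-1%g) mulgKV mulgK.
    by ring.
  by rewrite -mulr_suml sum_cocycle_conj // (negPf na) mul0r.
move=> E; rewrite linearZ; apply: algint_sqrt.
by rewrite -E.
Qed.

End IntegralElements.

(** * The double coset of M as a coalgebra *)

Section TwistComult.
Variables (F : fieldType) (gT : finGroupType) (Omega : galg F (gT * gT)%type).
Definition twist_comult (h : galg F gT) := Omega * galg_comult h * Omega^-1.
Fact twist_comult_linear : linear twist_comult.
Proof.
move=> a x y.
by rewrite /twist_comult linearP mulrDr mulrDl -scalerAr -scalerAl.
Qed.
HB.instance Definition _ := GRing.isLinear.Build F (galg F gT)
  (galg F (gT * gT)%type) _ twist_comult twist_comult_linear.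
End TwistComult.

Section TwistedDoubleCoset.
Variables (C : closedFieldType) (gT : finGroupType) (M : {group gT}).
Local Notation CG := (galg C gT).
Local Notation lchar := (@lchar C gT M).
Hypothesis C0 : [pchar C] =i pred0.
Hypothesis sep : forall m, m \in M -> (forall phi : lchar, phi m = 1) -> m = 1%g.
Variable w : lchar -> lchar -> C.
Hypotheses (cocycle_w : cocycle2 w) (norm_w : cocycle_normalized w).
Hypothesis (nondeg_w : cocycle_nondegenerate w).
Local Notation e := (@char_idem C gT M).
Local Arguments char_idem : simpl never.
Local Notation Omega := (twist_Omega w).
Implicit Types (phi psi : lchar).

Let w_neq0 a b : w a b != 0. Proof. by case: cocycle_w. Qed.

Lemma twist_Omega_tens phi psi :
  Omega * tens (e phi) (e psi) = w phi psi *: tens (e phi) (e psi).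
Proof.
rewrite /twist_Omega mulr_suml (bigD1 phi) //= [X in _ + X]big1 ?addr0.
  rewrite mulr_suml (bigD1 psi) //= [X in _ + X]big1 ?addr0.
    by rewrite -scalerAl tensM !char_idemM // !eqxx.
  move=> b nb; rewrite -scalerAl tensM (char_idemM C0 b) (negPf nb).
  by rewrite tens0r scaler0.
move=> a na; rewrite mulr_suml big1 // => b _.
by rewrite -scalerAl tensM (char_idemM C0 a) (negPf na) tens0l scaler0.
Qed.

Lemma tens_twist_Omega phi psi :
  tens (e phi) (e psi) * Omega = w phi psi *: tens (e phi) (e psi).
Proof.
rewrite /twist_Omega mulr_sumr (bigD1 phi) //= [X in _ + X]big1 ?addr0.
  rewrite mulr_sumr (bigD1 psi) //= [X in _ + X]big1 ?addr0.
    by rewrite -scalerAr tensM !char_idemM // !eqxx.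
  move=> b nb; rewrite -scalerAr tensM (char_idemM C0 psi) eq_sym (negPf nb).
  by rewrite tens0r scaler0.
move=> a na; rewrite mulr_sumr big1 // => b _.
by rewrite -scalerAr tensM (char_idemM C0 phi) eq_sym (negPf na) tens0l scaler0.
Qed.

Lemma twist_Omega_unit : Omega \is a GRing.unit.
Proof.
pose O' : galg C (gT * gT)%type :=
  \sum_(phi : lchar) \sum_(psi : lchar) (w phi psi)^-1 *: tens (e phi) (e psi).
have one : \sum_(phi : lchar) \sum_(psi : lchar) tens (e phi) (e psi) = 1.
  under eq_bigr do rewrite -tens_sumr sum_char_idem //.
  by rewrite -tens_suml sum_char_idem // !galg_oneE tens_gel.
apply/unitrP; exists O'; split.
- rewrite /O' mulr_suml -[RHS]one; apply: eq_bigr => phi _.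
  rewrite mulr_suml; apply: eq_bigr => psi _.
  by rewrite -scalerAl tens_twist_Omega scalerA mulVf ?scale1r.
rewrite /O' mulr_sumr -[RHS]one; apply: eq_bigr => phi _.
rewrite mulr_sumr; apply: eq_bigr => psi _.
by rewrite -scalerAr twist_Omega_tens scalerA mulVf ?scale1r.
Qed.

Lemma tens_twist_OmegaV phi psi :
  tens (e phi) (e psi) * Omega^-1 = (w phi psi)^-1 *: tens (e phi) (e psi).
Proof.
apply: (mulIr twist_Omega_unit); rewrite mulrVK ?twist_Omega_unit //.
by rewrite -scalerAl tens_twist_Omega scalerA mulVf ?scale1r.
Qed.

Variable t : gT.

(** A basis of the span of the double coset M t M, if M and its conjugate
    by t meet trivially. *)
Definition coset_elt (a : lchar * lchar) : CG := e a.1 * gel C t * e a.2.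

Definition coset_cocycle (a b : lchar * lchar) : C := w a.1 b.1 / w a.2 b.2.

(** Multiplication by Omega on the left and by its inverse on the right acts on
    the terms e_a t e_b (x) e_a' t e_b' through the scalars w a a' and w b b'. *)
Lemma comult_coset_elt c :
  twist_comult Omega (coset_elt c) =
  \sum_a coset_cocycle a (a^-1 * c)%g *:
    tens (coset_elt a) (coset_elt (a^-1 * c)%g).
Proof.
case: c => phi psi; rewrite /twist_comult /coset_elt /coset_cocycle.
rewrite !galg_comultM galg_comult_gel !(comult_char_idem C0 sep).
move: twist_Omega_tens tens_twist_OmegaV; move: Omega => O OL OR.
transitivity (\sum_(a : lchar) \sum_(b : lchar)
    (w a (a^-1 * phi)%g / w b (b^-1 * psi)%g) *:
    tens (e a * gel C t * e b)
         (e (a^-1 * phi)%g * gel C t * e (b^-1 * psi)%g)).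
  rewrite -!mulrA mulr_suml mulr_sumr; apply: eq_bigr => a _.
  rewrite mulr_suml !mulr_sumr; apply: eq_bigr => b _.
  by rewrite OR -!tensM !mulrA OL -!scalerAl -!scalerAr scalerA.
by rewrite pair_bigA.
Qed.

Lemma coset_cocycleP :
  [/\ cocycle2 coset_cocycle, cocycle_normalized coset_cocycle &
      cocycle_nondegenerate coset_cocycle].
Proof.
have [_ cw] := cocycle_w; split.
- split=> [[a a'] [b b']|[a a'] [b b'] [c c']]; rewrite /coset_cocycle /=.
    by rewrite mulf_neq0 ?invr_eq0.
  by rewrite mulf_div (cw a) (cw a') -mulf_div.
- move=> [a a']; rewrite /coset_cocycle /=.
  by rewrite !(norm_w _).1 !(norm_w _).2 divr1.
move=> [a a'] nd; congr (_, _); apply: nondeg_w => b.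
  have := nd (b, 1%g); rewrite /coset_cocycle /=.
  by rewrite !(norm_w _).1 !(norm_w _).2 !divr1.
have := nd (1%g, b); rewrite /coset_cocycle /=.
rewrite !(norm_w _).1 !(norm_w _).2 !div1r => e1.
by apply/eqP; rewrite -invr_eq1 -e1; apply/eqP; rewrite invfM.
Qed.

(** The elements u t v are pairwise distinct, and the coefficients of e_a t e_b
    on them are, up to a factor, the values of a character of M x M. *)
Lemma coset_elt_free (a : lchar * lchar -> C) :
    (forall u v, u \in M -> v \in M -> (u * t = t * v)%g -> v = 1%g) ->
  \sum_c a c *: coset_elt c = 0 -> forall c, a c = 0.
Proof.
move=> gen a0 c.
have val u v u' v' : u \in M -> v \in M -> u' \in M -> v' \in M ->
    ((u * t * v == u' * t * v') = ((u == u') && (v == v')))%g.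
  move=> Mu Mv Mu' Mv'; apply/eqP/andP=> [E|[/eqP-> /eqP->]//].
  have E' : (u'^-1 * u * t = t * (v' * v^-1))%g.
    by apply: (mulIg v); rewrite mulgA mulgKV -(mulgA u'^-1%g) -mulgA E !mulgA mulVg mul1g.
  have /eqP := gen _ _ (groupM (groupVr Mu') Mu) (groupM Mv' (groupVr Mv)) E'.
  rewrite -eq_mulgV1 => /eqP Ev; rewrite Ev eqxx; split=> //.
  by rewrite -Ev in E; move/mulIg/mulIg: E => ->.
have cf u v c' : u \in M -> v \in M -> coset_elt c' (u * t * v)%g =
    (#|M|%:R^-1 ^+ 2) * (c'.1 u^-1%g * c'.2 v^-1%g) :> C.
  move=> Mu Mv; rewrite /coset_elt {1}/char_idem -scalerAl mulr_suml.
  rewrite -scalerAl galgZE mulr_suml galg_sumE (bigD1 u) //= big1 => [|u' /andP[Mu' nu]].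
    rewrite addr0 -mulrA -scalerAl galgZE galg_gelmulE galg_gelmulE.
    rewrite -(mulgA u) !mulKg (char_idemE c'.2).
    by ring.
  rewrite -mulrA -scalerAl galgZE !galg_gelmulE char_idemE.
  rewrite (@lchar_out _ _ _ c'.2) ?mulr0 // groupV; apply/negP=> Mv'.
  have := val u v u' (t^-1 * (u'^-1 * (u * t * v)))%g Mu Mv Mu' Mv'.
  by rewrite -(mulgA u') !mulKVg eqxx eq_sym (negPf nu).
have z u v : u \in M -> v \in M -> \sum_c' a c' * (c'.1 u^-1%g * c'.2 v^-1%g) = 0.
  move=> Mu Mv; move/ffunP/(_ (u * t * v)%g): a0.
  rewrite galg_sumE; under eq_bigr do rewrite galgZE cf // mulrCA.
  rewrite -mulr_sumr => /eqP; rewrite ffunE mulf_eq0 expf_eq0 /= invr_eq0.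
  by rewrite (negPf (cardM_neq0 M C0)) => /eqP.
have : \sum_(u in M) \sum_(v in M) (c.1 u * c.2 v) *
    \sum_c' a c' * (c'.1 u^-1%g * c'.2 v^-1%g) = 0.
  by rewrite big1 // => u Mu; rewrite big1 // => v Mv; rewrite z // mulr0.
under eq_bigr do under eq_bigr do rewrite mulr_sumr.
under eq_bigr do rewrite exchange_big.
rewrite exchange_big (bigD1 c) //= [X in _ + X]big1 ?addr0.
  rewrite (eq_bigr (fun=> a c * #|M|%:R)) => [|u Mu].
    rewrite sumr_const -(mulr_natr (a c * _)) => /eqP; rewrite !mulf_eq0.
    by rewrite (negPf (cardM_neq0 M C0)) !orbF => /eqP.
  rewrite (eq_bigr (fun=> a c)) ?sumr_const ?mulr_natr // => v Mv.
  rewrite !lcharVr // mulrCA mulrACA !divff ?lchar_neq0 //.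
  by rewrite mulr1 mulr1.
move=> d nd.
transitivity (a d * ((\sum_(u in M) (c.1 * d.1^-1)%g u) * (\sum_(v in M) (c.2 * d.2^-1)%g v))).
  rewrite mulr_suml mulr_sumr; apply: eq_bigr => u Mu.
  rewrite mulr_sumr mulr_sumr; apply: eq_bigr => v Mv.
  by rewrite !lcharMl !lcharVl !lcharVr // mulrCA mulrACA.
rewrite !sum_lchar_elt // -!eq_mulgV1.
case: eqP => [e1|_]; last by rewrite mul0r mulr0.
case: eqP => [e2|_]; last by rewrite !mulr0.
by case/eqP: nd; case: (c) (d) e1 e2 => [? ?] [? ?] /= -> ->.
Qed.

End TwistedDoubleCoset.

(** * The obstruction *)

Section ClassSums.
Variables (F : fieldType) (gT : finGroupType).

Lemma class_sumJ (s g u : gT) :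
  class_sum s (gel F (g ^ u)%g) = class_sum s (gel F g).
Proof.
rewrite !class_sum_gel; congr (if _ then _ else _).
apply/imsetP/imsetP=> [[k _ e]|[k _ ->]].
  by exists (k * u^-1)%g; rewrite ?inE // conjgM -e conjgK.
by exists (k * u)%g; rewrite ?inE // conjgM.
Qed.

Lemma class_sumC (s : gT) (x y : galg F gT) :
  class_sum s (x * y) = class_sum s (y * x).
Proof.
pose L : {linear galg F gT -> F^o} := class_sum s : galg F gT -> F^o.
rewrite (galg_basis x) (galg_basis y) mulr_suml mulr_sumr.
rewrite [LHS](linear_sum L) [RHS](linear_sum L); apply: eq_bigr => g _.
rewrite mulr_sumr mulr_suml [LHS](linear_sum L) [RHS](linear_sum L).
apply: eq_bigr => h _; rewrite -!scalerAl -!scalerAr !scalerA mulrC.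
have E : class_sum s (gel F g * gel F h) = class_sum s (gel F h * gel F g).
  by rewrite -!gelM -(class_sumJ s (g * h)%g g) conjgE -mulgA mulKg.
by rewrite [LHS](linearZ_LR L) [RHS](linearZ_LR L) /= E.
Qed.

End ClassSums.

(** A Hopf order would make an algebraic integer of
    #|C(t)| #|C(t')| #|C(t t')| N / #|M|, where N counts the v in M with
    t t'^v conjugate to t t'. The first two conditions make the numerator prime
    to p apart from N, the last one gives N < #|M|, and the others bring the
    number about. *)
Definition twist_obstruction (gT : finGroupType) (M : {group gT}) : Prop :=
  exists (p : nat) (t t' a : gT),
  [/\ prime p /\ (p.-group M)%g,
      [/\ p^'.-group 'C[t], p^'.-group 'C[t'] & p^'.-group 'C[t * t']]%g,
      (forall u, u \in M -> (u * t)%g \in (t ^: [set: gT])%g -> u = 1%g),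
      (forall u, u \in M -> (u * t')%g \in (t' ^: [set: gT])%g -> u = 1%g) &
      a \in M /\ (t * t' ^ a \notin (t * t') ^: [set: gT])%g].

Section NoHopfOrder.
Variables (C : closedFieldType) (gT : finGroupType) (M : {group gT}).
Local Notation CG := (galg C gT).
Local Notation lchar := (@lchar C gT M).
Local Notation Z_C := (@algint_of C).
Hypothesis C0 : [pchar C] =i pred0.
Hypothesis sep : forall m, m \in M -> (forall phi : lchar, phi m = 1) -> m = 1%g.
Local Notation e := (@char_idem C gT M).
Local Arguments char_idem : simpl never.
Implicit Types (phi psi : lchar) (t : gT).

Definition mean_conj t : CG := \sum_(phi : lchar) coset_elt t (phi, phi).

Lemma mean_conjE t : mean_conj t = #|M|%:R^-1 *: \sum_(v in M) gel C (t ^ v)%g.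
Proof.
rewrite (reindex_inj invg_inj) /=.
transitivity (\sum_(phi : lchar) #|M|%:R^-1 *:
    \sum_(v in M) gel C (v * t * v^-1)%g * e phi).
  apply: eq_bigr => phi _; rewrite /coset_elt /= {1}/char_idem -!scalerAl.
  rewrite !mulr_suml; congr (_ *: _); apply: eq_bigr => v Mv.
  rewrite -!scalerAl !gelM -!mulrA (gel_char_idem _ (groupVr Mv)).
  by rewrite -!scalerAr.
rewrite -scaler_sumr exchange_big; congr (_ *: _).
apply: eq_big => [v|v Mv]; first by rewrite groupV.
by rewrite -mulr_sumr sum_char_idem // mulr1 conjgE invgK mulgA.
Qed.

Variable w : lchar -> lchar -> C.
Hypotheses (cocycle_w : cocycle2 w) (norm_w : cocycle_normalized w).
Hypothesis (nondeg_w : cocycle_nondegenerate w).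

(** Class sums are traces, so e_a t e_b may be replaced by e_b e_a t; among the
    terms v t of e_a t, only t itself is conjugate to t. *)
Lemma class_sum_coset_elt t (c : lchar * lchar) :
    (forall u, u \in M -> (u * t)%g \in (t ^: [set: gT])%g -> u = 1%g) ->
  class_sum t (coset_elt t c) =
    if c.1 == c.2 then #|'C[t]%g|%:R / #|M|%:R else 0.
Proof.
move=> isol; pose L : {linear CG -> (C : fieldType)^o} := class_sum t : CG -> _.
rewrite /coset_elt class_sumC mulrA char_idemM // eq_sym.
case: eqP => _; last by rewrite mul0r [LHS](linear0 L).
rewrite /char_idem -scalerAl mulr_suml [LHS](linearZ_LR L) [X in _ *: X](linear_sum L).
rewrite (bigD1 1%g) //= [X in _ + X]big1 ?addr0 => [|v /andP[Mv n1]].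
  rewrite invg1 lchar1 scale1r -gelM mul1g class_sum_gel class_refl.
  by rewrite [LHS]mulrC.
rewrite -scalerAl [LHS](linearZ_LR L) /= -gelM class_sum_gel.
case: ifP => [/(isol _ Mv) v1|_]; first by rewrite v1 eqxx in n1.
by rewrite scaler0.
Qed.

(** In the coproduct of the character, the contraction keeps the terms with
    first factor e_a t e_a, whose cocycle value is 1. *)
Lemma lcontract_coset_character t :
    (forall u, u \in M -> (u * t)%g \in (t ^: [set: gT])%g -> u = 1%g) ->
  lcontract (class_sum t) (twist_comult (twist_Omega w)
      (#|M|%:R *: coset_elt t (1%g : lchar * lchar)))
  = #|'C[t]%g|%:R *: mean_conj t.
Proof.
move=> isol; pose L : {linear CG -> (C : fieldType)^o} := class_sum t : CG -> _.
rewrite (linearZ_LR (twist_comult (twist_Omega w))) (linearZ_LR (lcontract _)) /=.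
rewrite comult_coset_elt // (linear_sum (lcontract (class_sum t))) /=.
transitivity (#|M|%:R *: \sum_(a : lchar) \sum_(b : lchar)
  (if b == a then #|'C[t]%g|%:R / #|M|%:R else 0) *:
     coset_elt t (a^-1, b^-1)%g).
  congr (_ *: _); rewrite [RHS]pair_bigA; apply: eq_bigr => -[a b] _.
  rewrite mulg1 (linearZ_LR (lcontract _)) /= (lcontract_tens L) /= class_sum_coset_elt //=.
  rewrite scalerA eq_sym; case: eqP => [->|_]; last by rewrite mulr0.
  rewrite /coset_cocycle /= divff ?mul1r //.
  by case: cocycle_w => ->.
have -> : mean_conj t = \sum_(a : lchar) coset_elt t (a^-1, a^-1)%g.
  by rewrite /mean_conj (reindex_inj invg_inj).
rewrite !scaler_sumr; apply: eq_bigr => a _.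
rewrite (bigD1 a) //= big1 => [|b /negPf->]; last by rewrite scale0r.
by rewrite eqxx addr0 scalerA mulrCA divff ?mulr1 ?cardM_neq0.
Qed.

Lemma class_sum_mean_conjM r t t' :
  class_sum r (mean_conj t * mean_conj t') =
  #|'C[r]%g|%:R * (#|[set v in M | t * t' ^ v \in r ^: [set: gT]]%g|%:R / #|M|%:R).
Proof.
pose L : {linear CG -> (C : fieldType)^o} := class_sum r : CG -> _.
rewrite !mean_conjE -scalerAl -scalerAr scalerA [LHS](linearZ_LR L) mulr_suml.
rewrite [X in _ *: X](linear_sum L).
under eq_bigr => u Mu.
  rewrite mulr_sumr (linear_sum L) /= (reindex_inj (mulIg u)) /=.
  under eq_bigr => v _.
    rewrite -gelM conjgM -conjMg class_sumJ; over.
  under eq_bigl do rewrite groupMr //; over.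
rewrite sumr_const.
have -> : \sum_(v in M) class_sum r (gel C (t * t' ^ v)%g) =
    #|'C[r]%g|%:R * #|[set v in M | t * t' ^ v \in r ^: [set: gT]]%g|%:R.
  rewrite (bigID (fun v => t * t' ^ v \in r ^: [set: gT])%g) /=.
  rewrite [X in _ + X]big1 ?addr0 => [|v /andP[_ nv]]; last first.
    by rewrite class_sum_gel (negPf nv).
  rewrite (eq_bigr (fun=> #|'C[r]%g|%:R)) => [|v /andP[_ rv]]; last first.
    by rewrite class_sum_gel rv.
  by rewrite -big_set /= sumr_const mulr_natr.
have nM := cardM_neq0 M C0.
rewrite -[X in _ *: X]mulr_natr; change (_ *: _) with (#|M|%:R^-1 / #|M|%:R *
  (#|'C[r]%g|%:R * #|[set v in M | t * t' ^ v \in r ^: [set: gT]]%g|%:R * #|M|%:R) : C).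
by field.
Qed.

(** The p-part of N is a proper divisor of the power #|M| of p. *)
Lemma p_part_quotient_not_integral p (c N : nat) : prime p -> (p.-group M)%g ->
  coprime p c -> (0 < N < #|M|)%N -> (c%:R * (N%:R / #|M|%:R) : C) \notin Z_C.
Proof.
move=> pr_p /p_natP[k Mk] co_c /andP[N0 NM]; apply/negP.
have /p_natP[b Nb] : p.-nat (N`_p)%N by apply: part_pnat.
have p0 : p%:R != 0 :> C by rewrite natrC_eq0 // -lt0n prime_gt0.
have bk : (b < k)%N.
  rewrite -(ltn_exp2l _ _ (prime_gt1 pr_p)) -Mk -Nb.
  by apply: leq_ltn_trans NM; rewrite dvdn_leq ?dvdn_part.
have -> : c%:R * (N%:R / #|M|%:R) = (c * N`_p^')%:R / (p ^ (k - b))%:R :> C.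
  rewrite -{1}(partnC p N0) Nb Mk -{1}(subnKC (ltnW bk)) expnD !natrM.
  have pb : (p ^ b)%:R != 0 :> C by rewrite natrX expf_neq0.
  have pkb : (p ^ (k - b))%:R != 0 :> C by rewrite natrX expf_neq0.
  by field; rewrite pkb.
have co : coprime p (c * N`_p^').
  by rewrite coprimeMr co_c (@pnat_coprime p) ?part_pnat // pnat_id.
have k0 : (0 < p ^ (k - b))%N by rewrite expn_gt0 prime_gt0.
move=> /(algint_nat_div C0 pr_p co k0); case/negP.
by rewrite -(subnSK bk) expnS dvdn_mulr.
Qed.

Section HopfOrder.
Variables (R : comNzRingType) (iota : {rmorphism R -> C}) (X : lmodType R).
Variable j : {linear X -> CG | iota \; *:%R}.
Hypothesis iotaZ : forall r, iota r \in Z_C.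

Theorem twisted_no_hopf_order :
  twist_obstruction M -> ~ hopf_order (twisted (twist_Omega w)) j.
Proof.
case=> p [t [t' [a [[pr_p pM] [p't p't' p'r] isol isol' [Ma na]]]]] ordX.
have [n [x [f [fj fB]]]] := hopf_order_dual_basis ordX.
pose Delta := twist_comult (twist_Omega w) : {linear CG -> _}.
have DE : comult (twisted (twist_Omega w)) =1 Delta by [].
have integral_mean s : (p^'.-group 'C[s])%g ->
    (forall u, u \in M -> (u * s)%g \in (s ^: [set: gT])%g -> u = 1%g) ->
    order_integral f (#|'C[s]%g|%:R *: mean_conj s).
  move=> p's isols; rewrite -lcontract_coset_character //.
  have [cw nw ndw] := coset_cocycleP cocycle_w norm_w nondeg_w.
  apply: (order_integral_lcontract iotaZ ordX DE fj fB
           (xi := class_sum s : CG -> (C : fieldType)^o)) => [y|].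
    by apply: (class_sum_integral iotaZ ordX fj fB) => i; apply: (fjZ iotaZ fj).
  apply: (matrix_coalgebra_character iotaZ ordX DE fj fB _ cw nw ndw).
  - by move=> [c c'] [d d']; congr (_, _); apply: lchar_commute.
  - by rewrite card_prod !card_lchar.
  - move=> b; apply: coset_elt_free => // u v Mu Mv E.
    have Euv : (v^-1 * u)%g = 1%g.
      apply: isols; rewrite ?groupM ?groupV // -mulgA E.
      by apply/imsetP; exists v; rewrite ?inE.
    have Cv : v \in 'C[s]%g.
      move/eqP: Euv; rewrite -eq_mulVg1 => /eqP Dv; apply/cent1P.
      by rewrite /commute -E Dv.
    have : v \in M :&: 'C[s]%g by rewrite in_setI Mv Cv.
    by rewrite (coprime_TIg (pnat_coprime pM p's)) => /set1P.
  - exact: comult_coset_elt.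
have /(class_sum_integral iotaZ ordX fj fB (t * t')%g) :=
  order_integralM iotaZ ordX fj fB (integral_mean t p't isol) (integral_mean t' p't' isol').
rewrite -scalerAl -scalerAr scalerA.
pose L : {linear CG -> (C : fieldType)^o} := class_sum (t * t')%g : CG -> _.
rewrite (linearZ_LR L) /= class_sum_mean_conjM => Zq.
set N := #|[set v in M | _]%g| in Zq.
have co s : (p^'.-group 'C[s])%g -> coprime p #|'C[s]%g|.
  by move=> p's; rewrite (@pnat_coprime p) // pnat_id.
have cc : coprime p (#|'C[t]%g| * #|'C[t']%g| * #|'C[t * t']%g|).
  by rewrite !coprimeMr !co.
have N_lt : (0 < N < #|M|)%N.
  rewrite /N; apply/andP; split.
    by apply/card_gt0P; exists 1%g; rewrite inE group1 conjg1 class_refl.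
  apply: proper_card; apply/properP; split.
    by apply/subsetP=> v; rewrite inE => /andP[].
  by exists a; rewrite // inE Ma.
have /negP[] := p_part_quotient_not_integral pr_p pM cc N_lt.
by rewrite !natrM -mulrA.
Qed.
End HopfOrder.

End NoHopfOrder.

Lemma twist_obstruction_no_hopf_order (R : realType) (gT : finGroupType) (M : {group gT})
    (K : fieldExtType rat) (iotaK : {rmorphism K -> R[i]})
    (K_split : split_galg K M)
    (omega : lchar R[i] M -> lchar R[i] M -> K)
    (omega_cocycle : cocycle2 omega) (omega_normalized : cocycle_normalized omega)
    (omega_nondegenerate : cocycle_nondegenerate omega)
    (L : fieldExtType rat) (iotaL : {rmorphism L -> R[i]})
    (X : lmodType (number_ring L))
    (j : {linear X -> galg R[i] gT | number_ring_embedding iotaL \; *:%R}) :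
  twist_obstruction M ->
  ~ hopf_order
      (twisted (twist_Omega (fun phi psi => iotaK (omega phi psi)))) j.
Proof.
have [w0 cw] := omega_cocycle.
move=> obs; apply: twisted_no_hopf_order => //.
- exact: Num.Theory.pchar_num.
- by move=> m Mm; apply: (split_galg_separates iotaK K_split).
- split=> [a b|a b c]; first by rewrite fmorph_eq0.
  by rewrite -!rmorphM cw.
- by move=> a; rewrite !(omega_normalized a).1 !(omega_normalized a).2 rmorph1.
- move=> a nd; apply: omega_nondegenerate => b.
  by apply: (fmorph_inj iotaK); rewrite rmorphM fmorphV rmorph1 nd.
case=> r Zr; have := Zr; rewrite {1}inE => /asboolP Ir; rewrite inE; apply/asboolP.
have := integral_rmorph iotaL Ir.
case=> P mP Pr; exists P => //; rewrite /= in Pr *.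
by rewrite (eq_map_poly (g := intr)) in Pr => // z; rewrite /= rmorph_int.
Qed.

(** * Groups of central type, and subgroups of matrix groups *)

Section CentralType.
Variables (gT : finGroupType) (M : {group gT}).
Hypothesis ctM : central_type M.

Lemma central_type_square : exists k, #|M| = (k * k)%N.
Proof.
have [eT [E isoM]] := ctM; exists #|E|.
by rewrite (card_isog isoM) cardsX.
Qed.

Lemma central_type_prime_square p : prime p -> (p %| #|M|)%N -> (p * p <= #|M|)%N.
Proof.
move=> pr_p; have M0 := cardG_gt0 M; have [k Mk] := central_type_square.
move: M0; rewrite Mk muln_gt0 andbb (Euclid_dvdM _ _ pr_p) orbb => k0 pk.
have pk' := dvdn_leq k0 pk; exact: leq_mul.
Qed.

Lemma central_type_order2 p : prime p -> (p %| #|M|)%N -> exists x y,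
  [/\ x \in M, y \in M, #[x]%g = p, #[y]%g = p & y \notin <[x]>%g].
Proof.
move=> pr_p pM; have [eT [E /isog_symr/isogP[f injf fE]]] := ctM.
have pE : (p %| #|E|)%N.
  by move: pM; rewrite -fE card_injm // cardsX Euclid_dvdM // orbb.
have [e Ee oe] := Cauchy pr_p pE.
have pr1 n : ((e, 1%g) ^+ n = (e ^+ n, 1) :> eT * eT)%g.
  by elim: n => // n IHn; rewrite !expgS IHn; congr (_, _); rewrite mulg1.
have d1 : (e, 1%g) \in setX E E by rewrite inE /= Ee group1.
have d2 : (1%g, e) \in setX E E by rewrite inE /= Ee group1.
exists (f (e, 1%g)), (f (1%g, e)); split.
- by rewrite -fE mem_morphim.
- by rewrite -fE mem_morphim.
- rewrite order_injm //; apply/eqP; rewrite eqn_dvd order_dvdn pr1 -{1}oe expg_order eqxx.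
  have := expg_order (e, 1%g : eT); rewrite pr1 => -[e1].
  by rewrite -oe order_dvdn e1 eqxx.
- rewrite order_injm //; have pr2 n : ((1%g, e) ^+ n = (1, e ^+ n) :> eT * eT)%g.
    by elim: n => // n IHn; rewrite !expgS IHn; congr (_, _); rewrite mulg1.
  apply/eqP; rewrite eqn_dvd order_dvdn pr2 -{1}oe expg_order eqxx.
  have := expg_order (1%g : eT, e); rewrite pr2 => -[e1].
  by rewrite -oe order_dvdn e1 eqxx.
apply/negP=> /cycleP[n]; rewrite -morphX // => /(injmP injf).
rewrite pr1 => /(_ d2); rewrite inE /= groupX // group1 => /(_ isT)[_ e1].
by move: pr_p; rewrite -oe e1 order1.
Qed.

(** The elements (e, 1) and (1, e) of E x E have distinct squares when e ^ 2 != 1. *)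
Lemma central_type_squares x : x \in M -> (x * x != 1)%g -> exists y z,
  [/\ y \in M, z \in M, y * y != 1, z * z != 1 & y * y != z * z]%g.
Proof.
have [eT [E /isog_symr/isogP[f injf fE]]] := ctM.
rewrite -fE => /morphimP[[a b] Dab _ ->{x}].
have [Ea Eb] : a \in E /\ b \in E by move: Dab; rewrite inE => /andP[].
rewrite -morphM // => n1.
have [e Ee ne] : exists2 e, e \in E & (e * e != 1)%g.
  have [a1|] := eqVneq (a * a)%g 1%g; last by exists a.
  exists b => //; apply: contraNneq n1 => b1.
  by rewrite (_ : (_ * _)%g = 1%g) ?morph1 //; congr (_, _).
have d1 : (e, 1%g) \in setX E E by rewrite inE /= Ee group1.
have d2 : (1%g, e) \in setX E E by rewrite inE /= Ee group1.
exists (f (e, 1%g)), (f (1%g, e)); rewrite -!morphM //; split.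
- by rewrite mem_morphim.
- by rewrite mem_morphim.
- by rewrite morph_injm_eq1 ?groupM //; apply: contraNneq ne => -[->].
- by rewrite morph_injm_eq1 ?groupM //; apply: contraNneq ne => -[_ ->].
rewrite (inj_in_eq (injmP injf)) ?groupM //.
by apply: contraNneq ne => -[-> _]; rewrite mulg1.
Qed.

End CentralType.

Section Conjugation.
Variable gT : finGroupType.

Lemma mem_classJ (y g h : gT) :
  ((g ^ y \in (h ^ y) ^: [set: gT]) = (g \in h ^: [set: gT]))%g.
Proof.
apply/imsetP/imsetP=> [[k _ e]|[k _ ->]].
  exists (k ^ y^-1)%g; rewrite ?inE //.
  by apply: (conjg_inj y); rewrite conjJg conjgKV.
by exists (k ^ y)%g; rewrite ?inE // conjJg.
Qed.

Lemma twist_obstructionJ (M : {group gT}) y :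
  twist_obstruction (M :^ y)%G -> twist_obstruction M.
Proof.
case=> p [t [t' [a [[pr_p pM] [p1 p2 p3] i1 i2 [Ma na]]]]].
exists p, (t ^ y^-1)%g, (t' ^ y^-1)%g, (a ^ y^-1)%g.
have cJ s : (p^'.-group 'C[s])%g -> (p^'.-group 'C[s ^ y^-1])%g.
  by rewrite -conjg_set1 normJ pgroupJ.
have iJ s : (forall u, u \in (M :^ y)%G -> (u * s)%g \in (s ^: [set: gT])%g -> u = 1%g) ->
    forall u, u \in M -> (u * s ^ y^-1)%g \in ((s ^ y^-1) ^: [set: gT])%g -> u = 1%g.
  move=> isol u Mu; rewrite -{1}(conjgK y u) -conjMg mem_classJ => /isol.
  by rewrite memJ_conjg => /(_ Mu) u1; rewrite -(conjgK y u) u1 conj1g.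
split.
- by split=> //; move: pM; rewrite /= pgroupJ.
- by rewrite -conjMg; split; apply: cJ.
- exact: iJ.
- exact: iJ.
split; first by rewrite -mem_conjg.
by rewrite -conjJg -!conjMg mem_classJ.
Qed.

End Conjugation.

Section Morphism.
Variables (hT gT : finGroupType) (H : {group hT}) (f : {morphism H >-> gT}).
Hypothesis surj_f : (f @* H)%g = [set: gT].

Lemma morph_surj y : exists2 g, g \in H & f g = y.
Proof.
have : y \in (f @* H)%g by rewrite surj_f inE.
by case/morphimP=> g Hg _ ->; exists g.
Qed.

Lemma morph_class A B : A \in H -> B \in H ->
  f B \in (f A ^: [set: gT])%g -> exists g z,
  [/\ g \in H, z \in ('ker f)%g & B = (A ^ g * z)%g].
Proof.
move=> HA HB /imsetP[y _]; have [g Hg <-] := morph_surj y => e.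
exists g, ((A ^ g)^-1 * B)%g; split; rewrite ?mulKVg //.
apply/kerP; first by rewrite groupM ?groupV ?groupJ.
by rewrite morphM ?morphV ?morphJ ?groupV ?groupJ // e mulVg.
Qed.

(** The order of a centralizer is tested on l-elements upstairs. *)
Lemma morph_cent1_pgroup l A : prime l -> A \in H ->
    (forall g, g \in H -> (l.-elt g)%g -> (g * A * g^-1 * A^-1)%g \in ('ker f)%g ->
       f g = 1%g) ->
  (l^'.-group 'C[f A])%g.
Proof.
move=> pr_l HA cent; rewrite /pgroup p'natE //; apply/negP=> /(Cauchy pr_l)[x Cx ox].
have [g Hg fg] := morph_surj x.
have ex : f (g.`_l)%g = x by rewrite morph_constt // fg constt_p_elt // /p_elt ox pnat_id.
have Hgl : (g.`_l)%g \in H by rewrite groupX.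
have x1 : f (g.`_l)%g = 1%g.
  apply: cent => //; first exact: p_elt_constt.
  apply/kerP; first by rewrite !groupM ?groupV.
  rewrite !morphM ?morphV ?groupM ?groupV // ex.
  by move/cent1P: Cx => ->; rewrite mulgK mulgV.
by move: pr_l; rewrite -ox -ex x1 order1.
Qed.

Lemma morph_pgroup_lift (l : nat) (M : {group gT}) : (l.-group M)%g ->
  exists P : {group hT}, [/\ P \subset H, (l.-group P)%g & f @* P = M]%g.
Proof.
move=> lM; have [P sylP] := Sylow_exists l (f @*^-1 M)%G.
have sPH : P \subset H by rewrite (subset_trans (pHall_sub sylP)) ?subsetIl.
exists P; split=> //; first exact: pHall_pgroup sylP.
have := morphim_pSylow f sPH sylP; rewrite /= morphpreK ?surj_f ?subsetT //.
by move=> sylfP; apply: pHall_id sylfP lM.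
Qed.

End Morphism.

Section LinearGroups.
Variables (F : finFieldType) (n : nat).
Local Notation GL := {'GL_n.+1[F]}.

Lemma pgroup_fixes_row (p : nat) (P : {group GL}) : p \in [pchar F] -> (p.-group P)%g ->
  exists2 v : 'rV[F]_n.+1, v != 0 & forall g, g \in P -> v *m GLval g = v.
Proof.
move=> chF pP; have nz := rfix_pgroup_pchar chF (GLrepr F n) (ltn0Sn n) pP (subsetT _).
exists (nz_row (rfix_mx (GLrepr F n) P)); first by rewrite nz_row_eq0.
by move=> g Pg; have /rfix_mxP := nz_row_sub (rfix_mx (GLrepr F n) P); apply.
Qed.

(** A faithful irreducible representation of an abelian group has a cyclic
    image, so a non-cyclic group acts on an irreducible submodule with a
    nontrivial kernel. *)
Lemma noncyclic_fixes_row (A : {group GL}) : abelian A -> ~~ cyclic A ->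
  exists g, [/\ g \in A, g != 1%g &
    exists2 v : 'rV[F]_n.+1, v != 0 & v *m GLval g = v].
Proof.
move=> abA ncA; pose rA := subg_repr (GLrepr F n) (subsetT A).
have nz1 : (1%:M : 'M[F]_n.+1) != 0 by rewrite -mxrank_eq0 mxrank1.
apply: contrapT => nofix; suff: false by [].
apply: (mxsimple_exists (mxmodule1 rA) nz1) => -[U simU _].
have modU := mxsimple_module simU; have nzU : U != 0 by case: simU.
case/negP: ncA; apply: (@mx_faithful_irr_abelian_cyclic _ _ _ _ (submod_repr modU)) => //.
  rewrite /mx_faithful rker_submod; apply/subsetP=> g /setIdP[Ag /eqP Ug].
  apply/set1P/eqP; apply: contraT => n1; case: nofix; exists g; split=> //.
  exists (nz_row U); first by rewrite nz_row_eq0.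
  by have /submxP[D ->] := nz_row_sub U; rewrite -mulmxA Ug.
exact/submod_mx_irr.
Qed.

End LinearGroups.

Section Transfer.
Variables (F : finFieldType) (n : nat).
Local Notation GL := {'GL_n.+1[F]}.

Lemma pgroup_fixes_col (p : nat) (P : {group GL}) : p \in [pchar F] -> (p.-group P)%g ->
  exists2 v : 'cV[F]_n.+1, v != 0 & forall g, g \in P -> GLval g *m v = v.
Proof.
move=> chF pP; pose r (g : GL) := (GLval g^-1%g)^T.
have r_repr : mx_repr 'GL_n.+1[F] r.
  split=> [|g h _ _]; first by rewrite /r invg1 trmx1.
  by rewrite /r invMg -trmx_mul.
pose rG := MxRepresentation r_repr.
have nz := rfix_pgroup_pchar chF rG (ltn0Sn n) pP (subsetT _).
exists (nz_row (rfix_mx rG P))^T; first by rewrite -trmx0 (inj_eq trmx_inj) nz_row_eq0.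
move=> g Pg; have /rfix_mxP/(_ g^-1%g) := nz_row_sub (rfix_mx rG P).
rewrite groupV /= /r invgK => /(_ Pg) /(congr1 trmx).
by rewrite trmx_mul trmxK.
Qed.

Lemma pgroup_conj_Sylow (p : nat) (H P : {group GL}) x0 : x0 \in H -> (p.-elt x0)%g ->
    (P \subset H)%g -> (p.-group P)%g ->
  exists (Q : {group GL}) (h : GL),
    [/\ (p.-group Q)%g, x0 \in Q, h \in H, Q \subset H & (P :^ h \subset Q)%g].
Proof.
move=> Hx0 px0 sPH pP; have sx0 : (<[x0]> \subset H)%g by rewrite cycle_subG.
have [Q sylQ sx0Q] := Sylow_superset sx0 px0.
have [h Hh sPQ] := Sylow_Jsub sylQ sPH pP.
exists Q, h; split=> //; rewrite -?cycle_subG //.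
- exact: pHall_pgroup sylQ.
- exact: pHall_sub sylQ.
Qed.

(** A p-group fixes some nonzero vector, which is fixed by x0 in particular. *)
Lemma pgroup_fixes_only_row (p : nat) (Q : {group GL}) x0 e0 : p \in [pchar F] ->
    (p.-group Q)%g -> x0 \in Q ->
    (forall v : 'rV[F]_n.+1, v *m GLval x0 = v -> exists c, v = c *: e0) ->
  forall g, g \in Q -> e0 *m GLval g = e0.
Proof.
move=> chF pQ Qx0 only g Qg; have [v nzv fixv] := pgroup_fixes_row chF pQ.
have [c Dv] := only v (fixv _ Qx0).
have c0 : c != 0 by apply: contraNneq nzv => c0; rewrite Dv c0 scale0r.
apply: (scalerI c0); rewrite scalemxAl -Dv; exact: fixv.
Qed.

Lemma pgroup_fixes_only_col (p : nat) (Q : {group GL}) x0 e0 : p \in [pchar F] ->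
    (p.-group Q)%g -> x0 \in Q ->
    (forall v : 'cV[F]_n.+1, GLval x0 *m v = v -> exists c, v = c *: e0) ->
  forall g, g \in Q -> GLval g *m e0 = e0.
Proof.
move=> chF pQ Qx0 only g Qg; have [v nzv fixv] := pgroup_fixes_col chF pQ.
have [c Dv] := only v (fixv _ Qx0).
have c0 : c != 0 by apply: contraNneq nzv => c0; rewrite Dv c0 scale0r.
apply: (scalerI c0); rewrite scalemxAr -Dv; exact: fixv.
Qed.

End Transfer.

(** As the kernel is an l'-group, a subgroup of M of type (l, l) lifts to an
    isomorphic group of matrices, to which noncyclic_fixes_row applies. *)
Lemma central_type_fixes_row (F : finFieldType) (n : nat) (gT : finGroupType)
    (H : {group {'GL_n.+1[F]}}) (f : {morphism H >-> gT}) (M : {group gT}) (l : nat) :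
    (f @* H)%g = [set: gT] -> (l^'.-group ('ker f))%g -> prime l ->
    abelian M -> central_type M -> (l %| #|M|)%N ->
  exists g, [/\ g \in H, (l.-elt g)%g, g != 1%g &
    exists2 v : 'rV[F]_n.+1, v != 0 & v *m GLval g = v].
Proof.
move=> surj_f l'ker pr_l abM ctM lM.
have [x [y [Mx My ox oy nyx]]] := central_type_order2 ctM pr_l lM.
pose D := (<[x]> <*> <[y]>)%G.
have sDM : D \subset M by rewrite join_subG !cycle_subG Mx.
have abD : abelian D := abelianS sDM abM.
have lD : (l.-group D)%g.
  rewrite /= norm_joinEr; last by rewrite cents_norm // (subset_trans _ (subset_trans abM _)) ?cycle_subG // centS // cycle_subG.
  by rewrite pgroupM /pgroup -!/(order _) ox oy pnat_id.
have ncD : ~~ cyclic D.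
  apply/negP=> cycD; case/negP: nyx; rewrite -cycle_subG.
  have sx : (<[x]> \subset D)%g by rewrite joing_subl.
  have sy : (<[y]> \subset D)%g by rewrite joing_subr.
  have := eq_subG_cyclic cycD sy sx; rewrite /= -!/(order _) ox oy eqxx.
  by move/eqP->.
have [P [sPH lP fP]] := morph_pgroup_lift surj_f lD.
have injP : ('injm (restrm sPH f))%g.
  by rewrite ker_restrm setIC coprime_TIg // coprime_sym (pnat_coprime lP l'ker).
have fP' : (restrm sPH f @* P)%g = D by rewrite morphim_restrm setIid.
have abP : abelian P by rewrite -(injm_abelian injP) // fP'.
have ncP : ~~ cyclic P.
  by apply: contra ncD => cP; rewrite -fP' morphim_cyclic.
have [g [Pg n1 fixg]] := noncyclic_fixes_row abP ncP.
by exists g; split=> //; [apply: (subsetP sPH) | apply: mem_p_elt lP Pg].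
Qed.

Section GLval.
Variables (F : finFieldType) (n : nat).
Implicit Types g h : {'GL_n.+1[F]}.

Lemma GLval_inj : injective (@GLval n.+1 F).
Proof. exact: val_inj. Qed.
Lemma GLvalM g h : GLval (g * h)%g = GLval g *m GLval h. Proof. by []. Qed.
Lemma GLval1 : GLval (1%g : {'GL_n.+1[F]}) = 1%:M. Proof. by []. Qed.

End GLval.

Lemma central_typeJ (gT : finGroupType) (M : {group gT}) y :
  central_type M -> central_type (M :^ y)%G.
Proof.
case=> eT [E isoM]; exists eT, E.
by apply: isog_trans isoM; rewrite isog_sym conj_isog.
Qed.

Lemma injm_class_tr (F : finFieldType) n (gT : finGroupType)
    (H : {group {'GL_n.+1[F]}}) (f : {morphism H >-> gT}) A B :
    (f @* H)%g = [set: gT] -> ('injm f)%g -> A \in H -> B \in H ->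
    f B \in (f A ^: [set: gT])%g ->
  \tr (GLval B) = \tr (GLval A) /\ \tr (GLval B^-1%g) = \tr (GLval A^-1%g).
Proof.
move=> surj_f inj_f HA HB; have trJ (C g : {'GL_n.+1[F]}) :
    \tr (GLval (C ^ g)%g) = \tr (GLval C).
  by rewrite conjgE !GLvalM mxtrace_mulC -mulmxA -GLvalM mulgV GLval1 mulmx1.
case/(morph_class surj_f HA HB) => g [z [Hg /(subsetP inj_f)/set1P-> ->]].
by rewrite mulg1 -conjVg !trJ.
Qed.

(** * Suzuki groups *)

Notation ord4 k := (@Ordinal 4 k isT).

Lemma sum4 (V : nmodType) (E : 'I_4 -> V) :
  \sum_i E i = E (ord4 0) + E (ord4 1) + E (ord4 2) + E (ord4 3).
Proof.
rewrite !big_ord_recr big_ord0 /= add0r; congr (_ + _ + _ + _);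
by congr E; apply: val_inj.
Qed.

Lemma forall4 (P : 'I_4 -> Prop) :
  P (ord4 0) -> P (ord4 1) -> P (ord4 2) -> P (ord4 3) -> forall i, P i.
Proof.
move=> P0 P1 P2 P3 [[|[|[|[|i]]]] lti] //.
- by rewrite (_ : Ordinal lti = (ord4 0)) //; apply: val_inj.
- by rewrite (_ : Ordinal lti = (ord4 1)) //; apply: val_inj.
- by rewrite (_ : Ordinal lti = (ord4 2)) //; apply: val_inj.
by rewrite (_ : Ordinal lti = (ord4 3)) //; apply: val_inj.
Qed.

Section CharPoly4.
Variable R : comNzRingType.
Implicit Types (a : nat -> nat -> R) (x : R).
Definition fmx4 a : 'M[R]_4 := \matrix_(i, j) a (val i) (val j).
Definition pm2 a i j := a i i * a j j - a i j * a j i.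
Definition pm3 a i j k :=
  a i i * (a j j * a k k - a j k * a k j) -
  a i j * (a j i * a k k - a j k * a k i) +
  a i k * (a j i * a k j - a j j * a k i).
Definition csum1 a := a 0 0 + a 1 1 + a 2 2 + a 3 3.
Definition csum2 a := pm2 a 0 1 + pm2 a 0 2 + pm2 a 0 3 + pm2 a 1 2 + pm2 a 1 3 + pm2 a 2 3.
Definition csum3 a := pm3 a 0 1 2 + pm3 a 0 1 3 + pm3 a 0 2 3 + pm3 a 1 2 3.

Lemma det3E (A : 'M[R]_3) (a : nat -> nat -> R) :
   (forall i j, A i j = a (val i) (val j)) -> \det A = pm3 a 0 1 2.
Proof.
move=> E; rewrite (expand_det_row _ ord0) !big_ord_recl big_ord0 /cofactor.
rewrite !(expand_det_row _ ord0) !big_ord_recl !big_ord0 /cofactor !det_mx11 !mxE !E /= /bump /= /pm3.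
ring.
Qed.

Lemma det4_charE a x : \det (x%:M - fmx4 a) =
  x ^+ 4 - csum1 a * x ^+ 3 + csum2 a * x ^+ 2 - csum3 a * x + \det (fmx4 a).
Proof.
rewrite !(expand_det_row _ ord0) !big_ord_recl !big_ord0 /cofactor.
pose b i j := (i == j)%N%:R * x - a i j.
have E (j : 'I_4) : \det (row' ord0 (col' j (x%:M - fmx4 a))) =
   pm3 (fun i l => b i.+1 (bump j l)) 0 1 2.
  apply: det3E => i l; rewrite !mxE /= /b; congr (_ - _).
  by rewrite -mulr_natl -val_eqE /= mulr_natl mulr_natl.
have E' (j : 'I_4) : \det (row' ord0 (col' j (fmx4 a))) =
   pm3 (fun i l => a i.+1 (bump j l)) 0 1 2.
  by apply: det3E => i l; rewrite !mxE.
rewrite !E // !E' !mxE /= /pm3 /b /csum1 /csum2 /csum3 /pm2 /pm3 /bump /=.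
ring.
Qed.

Lemma tr_adj4 a : \tr (\adj (fmx4 a)) = csum3 a.
Proof.
rewrite /mxtrace !big_ord_recl big_ord0 !mxE /cofactor.
have E (j : 'I_4) : \det (row' j (col' j (fmx4 a))) =
   pm3 (fun i l => a (bump j i) (bump j l)) 0 1 2.
  by apply: det3E => i l; rewrite !mxE.
rewrite !E /= /pm3 /csum3 /pm3 /bump /=; ring.
Qed.
End CharPoly4.

Section SuzukiForms.
Variables (F : finFieldType) (n : nat).
Hypothesis cardF : #|F| = (2 ^ n.*2.+1)%N.
Local Notation theta := (@suz_theta F n).

Lemma char2F : 2%N \in [pchar F].
Proof. exact: card_finPcharP cardF _. Qed.

Lemma two0 : 2%:R = 0 :> F.
Proof. exact: pcharf0 char2F. Qed.

Lemma eq_mod2 (k x y : F) : x = y + 2%:R * k -> x = y.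
Proof. by rewrite two0 mul0r addr0. Qed.

Lemma eq_mod2B (c k B x y : F) : B = 0 -> x = y + c * B + 2%:R * k -> x = y.
Proof. by move=> ->; rewrite mulr0 addr0; apply: eq_mod2. Qed.

Lemma theta0 : theta 0 = 0. Proof. by rewrite /suz_theta expr0n expn_eq0. Qed.
Lemma theta1 : theta 1 = 1. Proof. exact: expr1n. Qed.
Lemma thetaM : {morph theta : x y / x * y}.
Proof. by move=> x y; rewrite /suz_theta exprMn. Qed.
Lemma thetaD : {morph theta : x y / x + y}.
Proof.
move=> x y; rewrite /suz_theta exprDn_pchar //.
by rewrite pnatX pnatE ?char2F.
Qed.
Lemma theta_eq0 x : (theta x == 0) = (x == 0).
Proof. by rewrite /suz_theta expf_eq0 expn_gt0. Qed.
Lemma theta_inj : injective theta.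
Proof.
move=> x y e; apply/eqP; rewrite -subr_eq0 -theta_eq0.
have -> : x - y = x + y by apply: (@eq_mod2 (- y)); ring.
by rewrite thetaD e; apply/eqP/(@eq_mod2 (theta y)); ring.
Qed.

Lemma thetaK x : theta (theta x) = x ^+ 2.
Proof.
rewrite /suz_theta -exprM -expnD.
have -> : (2 ^ (n.+1 + n.+1) = 2 ^ n.*2.+1 * 2)%N by rewrite -expnSr addnn doubleS.
by rewrite exprM -cardF expf_card.
Qed.

(** A fixed point satisfies x = theta (theta x) = x ^ 2. *)
Lemma theta_fixed x : theta x = x -> x = 0 \/ x = 1.
Proof.
move=> e; have := thetaK x; rewrite !e expr2 => /eqP.
rewrite -subr_eq0 -[X in X - _]mulr1 -mulrBr mulf_eq0 subr_eq0.
by case/orP=> /eqP; [left | right].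
Qed.

Lemma theta_mulmx m k l (A : 'M[F]_(m, k)) (B : 'M_(k, l)) :
  map_mx theta (A *m B) = map_mx theta A *m map_mx theta B.
Proof.
apply/matrixP=> i j; rewrite !mxE (big_morph _ thetaD theta0).
by apply: eq_bigr => t _; rewrite thetaM !mxE.
Qed.

Definition symp (v w : 'rV[F]_4) : F :=
  v 0 (ord4 0) * w 0 (ord4 3) + v 0 (ord4 1) * w 0 (ord4 2) +
  v 0 (ord4 2) * w 0 (ord4 1) + v 0 (ord4 3) * w 0 (ord4 0).

Definition minor2 (v w : 'rV[F]_4) i j : F := v 0 i * w 0 j - v 0 j * w 0 i.

(** The image of v /\ w in the 4-dimensional subquotient of the exterior
    square of F^4. *)
Definition wedge (v w : 'rV[F]_4) : 'rV[F]_4 :=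
  \row_j [:: minor2 v w (ord4 0) (ord4 1); minor2 v w (ord4 0) (ord4 2);
             minor2 v w (ord4 1) (ord4 3); minor2 v w (ord4 2) (ord4 3)]`_j.

(** The equations of the Suzuki group in Sp_4: the exceptional isogeny of Sp_4,
    which is the action on the subquotient of the exterior square, agrees with
    the field automorphism theta. *)
Definition suz_equations (g : 'M[F]_4) : Prop :=
  (forall v w, symp (v *m g) (w *m g) = symp v w) /\
  (forall v w, symp v w = 0 ->
     wedge (v *m g) (w *m g) = wedge v w *m map_mx theta g).

Lemma suz_equationsM g h :
  suz_equations g -> suz_equations h -> suz_equations (g *m h).
Proof.
move=> [sg wg] [sh wh]; split=> [v w|v w vw]; rewrite !mulmxA; first by rewrite sh sg.
by rewrite wh ?sg // wg // theta_mulmx mulmxA.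
Qed.

Lemma suz_equations1 : suz_equations 1%:M.
Proof.
split=> [v w|v w _]; rewrite !mulmx1 //.
have -> : map_mx theta 1%:M = 1%:M :> 'M_4.
  by apply/matrixP=> i j; rewrite !mxE; case: (i == j); rewrite ?theta1 ?theta0.
by rewrite mulmx1.
Qed.

Lemma suz_equations_u a b : suz_equations (suz_u n a b).
Proof.
have E (v : 'rV[F]_4) : v *m suz_u n a b = \row_j
   [:: v 0 (ord4 0) + v 0 (ord4 1) * a + v 0 (ord4 2) * (a * theta a + b) +
         v 0 (ord4 3) * (a ^+ 2 * theta a + a * b + theta b);
       v 0 (ord4 1) + v 0 (ord4 2) * theta a + v 0 (ord4 3) * b;
       v 0 (ord4 2) + v 0 (ord4 3) * a; v 0 (ord4 3)]`_j.
  apply/rowP; apply: forall4; rewrite !mxE sum4 !mxE /=; ring.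
have Et : map_mx theta (suz_u n a b) = mx4
  [:: [:: 1; 0; 0; 0];
      [:: theta a; 1; 0; 0];
      [:: theta a * a ^+ 2 + theta b; a ^+ 2; 1; 0];
      [:: theta a ^+ 2 * a ^+ 2 + theta a * theta b + b ^+ 2;
          theta b; theta a; 1]].
  apply/matrixP; apply: forall4; apply: forall4;
    by rewrite !mxE /= ?theta0 ?theta1 // ?expr2 ?thetaD ?thetaM ?thetaD ?thetaM ?thetaK.
split=> v w.
  rewrite !E /symp !mxE /=.
  move: (v 0 (ord4 0)) (v 0 (ord4 1)) (v 0 (ord4 2)) (v 0 (ord4 3))
    (w 0 (ord4 0)) (w 0 (ord4 1)) (w 0 (ord4 2)) (w 0 (ord4 3))
    => v0 v1 v2 v3 w0 w1 w2 w3.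
  move: (theta a) (theta b) => ta tb.
  apply: (@eq_mod2 (a*v1*w3 + a*ta*v2*w3 + b*v2*w3 + a^+2*ta*v3*w3
    + 2%:R*a*b*v3*w3 + tb*v3*w3 + ta*v2*w2 + b*v3*w2 + a*v3*w1 + a*ta*v3*w2)).
  by ring.
rewrite !E Et /symp => B0; apply/rowP.
apply: forall4; rewrite !mxE sum4 !mxE /= /minor2 !mxE /=; move: B0;
  move: (v 0 (ord4 0)) (v 0 (ord4 1)) (v 0 (ord4 2)) (v 0 (ord4 3))
    (w 0 (ord4 0)) (w 0 (ord4 1)) (w 0 (ord4 2)) (w 0 (ord4 3))
    => v0 v1 v2 v3 w0 w1 w2 w3; move: (theta a) (theta b) => ta tb B0.
- apply: (@eq_mod2B b (a^+2*ta*v3*w1 + a^+2*ta^+2*v3*w2 + tb*v3*w1 + ta*tb*v3*w2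
    - b*v1*w2 - a^+2*ta*v1*w3 - tb*v1*w3 - a^+2*ta^+2*v2*w3 - ta*tb*v2*w3
    - b*v3*w0) _ _ _ B0).
  by ring.
- apply: (@eq_mod2B a (tb*v3*w2 - a*v2*w1 - tb*v2*w3 - a*v3*w0) _ _ _ B0).
  by ring.
- by ring.
by ring.
Qed.

Lemma suz_equations_anti : suz_equations (suz_anti F).
Proof.
have E (v : 'rV[F]_4) : v *m suz_anti F = \row_j
   [:: v 0 (ord4 3); v 0 (ord4 2); v 0 (ord4 1); v 0 (ord4 0)]`_j.
  by apply/rowP; apply: forall4; rewrite !mxE sum4 !mxE /=; ring.
have Et : map_mx theta (suz_anti F) = suz_anti F.
  by apply/matrixP; apply: forall4; apply: forall4;
    rewrite !mxE /= ?theta0 ?theta1.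
split=> v w; first by rewrite !E /symp !mxE /=; ring.
move=> _; rewrite Et !E; apply/rowP.
apply: forall4; rewrite !mxE /= /minor2 !mxE /=;
  move: (v 0 (ord4 0)) (v 0 (ord4 1)) (v 0 (ord4 2)) (v 0 (ord4 3))
    (w 0 (ord4 0)) (w 0 (ord4 1)) (w 0 (ord4 2)) (w 0 (ord4 3))
    => v0 v1 v2 v3 w0 w1 w2 w3.
- by apply: (@eq_mod2 (v3 * w2 - v2 * w3)); ring.
- by apply: (@eq_mod2 (v3 * w1 - v1 * w3)); ring.
- by apply: (@eq_mod2 (v2 * w0 - v0 * w2)); ring.
by apply: (@eq_mod2 (v1 * w0 - v0 * w1)); ring.
Qed.

Lemma suz_equations_diag a1 a2 k : k != 0 ->
  theta a1 = k * theta k -> theta a2 = k -> suz_equations (suz_diag a1 a2).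
Proof.
move=> k0 e1 e2; have a20 : a2 != 0 by rewrite -theta_eq0 e2.
have a10 : a1 != 0 by rewrite -theta_eq0 e1 mulf_neq0 // theta_eq0.
have thV x : theta x^-1 = (theta x)^-1 by rewrite /suz_theta exprVn.
have d1 : theta a1 = a1 * a2.
  by apply: theta_inj; rewrite thetaM e1 thetaM thetaK e2; ring.
have d2 : theta a2 = a1 / a2.
  by apply: theta_inj; rewrite thetaM thV e1 e2; field.
have E (v : 'rV[F]_4) : v *m suz_diag a1 a2 = \row_j
   [:: v 0 (ord4 0) * a1; v 0 (ord4 1) * a2;
       v 0 (ord4 2) / a2; v 0 (ord4 3) / a1]`_j.
  by apply/rowP; apply: forall4; rewrite !mxE sum4 !mxE /=; ring.
split=> [v w|v w _]; rewrite !E; first by rewrite /symp !mxE /=; field; rewrite ?a10 ?a20.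
apply/rowP; apply: forall4; rewrite !mxE sum4 !mxE /= /minor2 !mxE /=;
  rewrite theta0 ?thV ?d1 ?d2; field; by rewrite ?a10 ?a20.
Qed.

Local Notation e k := (delta_mx 0 (ord4 k) : 'rV[F]_4).

Lemma suz_minors (g : 'M[F]_4) i k r : suz_equations g ->
    symp (delta_mx 0 i) (delta_mx 0 k) = 0 ->
    wedge (delta_mx 0 i) (delta_mx 0 k) = delta_mx 0 r ->
  [/\ theta (g r (ord4 0)) = g i (ord4 0) * g k (ord4 1) - g i (ord4 1) * g k (ord4 0),
      theta (g r (ord4 1)) = g i (ord4 0) * g k (ord4 2) - g i (ord4 2) * g k (ord4 0),
      theta (g r (ord4 2)) = g i (ord4 1) * g k (ord4 3) - g i (ord4 3) * g k (ord4 1) &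
      theta (g r (ord4 3)) = g i (ord4 2) * g k (ord4 3) - g i (ord4 3) * g k (ord4 2)].
Proof.
move=> [_ wg] s0 wr; have := wg _ _ s0; rewrite wr -!rowE => /rowP E.
have E' j : theta (g r j) = wedge (row i g) (row k g) 0 j by rewrite E !mxE.
by rewrite !E' !mxE /= /minor2 !mxE.
Qed.

Lemma symp_delta i k : symp (delta_mx 0 i) (delta_mx 0 k) = (i + k == 3)%N%:R :> F.
Proof.
rewrite /symp !mxE !eqxx /=.
by move: i k; apply: forall4; apply: forall4; rewrite /=; ring.
Qed.

Lemma wedge_delta01 : wedge (e 0) (e 1) = e 0.
Proof. by apply/rowP; apply: forall4; rewrite !mxE /= /minor2 !mxE /=; ring. Qed.
Lemma wedge_delta02 : wedge (e 0) (e 2) = e 1.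
Proof. by apply/rowP; apply: forall4; rewrite !mxE /= /minor2 !mxE /=; ring. Qed.
Lemma wedge_delta13 : wedge (e 1) (e 3) = e 2.
Proof. by apply/rowP; apply: forall4; rewrite !mxE /= /minor2 !mxE /=; ring. Qed.
Lemma wedge_delta23 : wedge (e 2) (e 3) = e 3.
Proof. by apply/rowP; apply: forall4; rewrite !mxE /= /minor2 !mxE /=; ring. Qed.

Lemma suz_symp_rows (g : 'M[F]_4) i k : suz_equations g ->
  symp (row i g) (row k g) = (i + k == 3)%N%:R.
Proof. by case=> sg _; rewrite !rowE sg symp_delta. Qed.

(** The minors of the first row with the others, and the symplectic products,
    give the other rows in terms of two entries. *)
Lemma suz_fixed_e0 (g : 'M[F]_4) : suz_equations g -> e 0 *m g = e 0 ->
  g = suz_u n (g (ord4 1) (ord4 0)) (g (ord4 3) (ord4 1)).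
Proof.
move=> eg; rewrite -rowE => /rowP r0.
have g0 j : g (ord4 0) j = (j == ord4 0)%:R.
  by have := r0 j; rewrite !mxE eqxx.
have S i k := suz_symp_rows i k eg.
have s01 := S (ord4 0) (ord4 1); have s02 := S (ord4 0) (ord4 2).
have s03 := S (ord4 0) (ord4 3); have s12 := S (ord4 1) (ord4 2).
have s13 := S (ord4 1) (ord4 3); have s23 := S (ord4 2) (ord4 3).
have [A0 A1 _ _] := suz_minors eg (symp_delta (ord4 0) (ord4 1)) wedge_delta01.
have [B0 _ _ _] := suz_minors eg (symp_delta (ord4 0) (ord4 2)) wedge_delta02.
have [_ D1 _ _] := suz_minors eg (symp_delta (ord4 2) (ord4 3)) wedge_delta23.
rewrite /symp !mxE !g0 /= in s01 s02 s03 s12 s13 s23 A0 A1 B0 D1.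
have g13 : g (ord4 1) (ord4 3) = 0 by apply: etrans s01; ring.
have g23 : g (ord4 2) (ord4 3) = 0 by apply: etrans s02; ring.
have g33 : g (ord4 3) (ord4 3) = 1 by apply: etrans s03; ring.
have g11 : g (ord4 1) (ord4 1) = 1 by rewrite -theta1 A0; ring.
have g12 : g (ord4 1) (ord4 2) = 0 by rewrite -theta0 A1; ring.
have g21 : g (ord4 2) (ord4 1) = theta (g (ord4 1) (ord4 0)) by rewrite B0; ring.
rewrite g13 g23 g33 g11 g12 g21 in s12 s13 s23 D1.
have g22 : g (ord4 2) (ord4 2) = 1 by apply: etrans s12; ring.
have g32 : g (ord4 3) (ord4 2) = g (ord4 1) (ord4 0).
  apply: (@eq_mod2B 1 (- g (ord4 1) (ord4 0)) _ _ _ s13); ring.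
rewrite g22 g32 in s23 D1.
have g20 : g (ord4 2) (ord4 0) = g (ord4 1) (ord4 0) * theta (g (ord4 1) (ord4 0))
     + g (ord4 3) (ord4 1).
  apply: (@eq_mod2B 1 (- (g (ord4 1) (ord4 0) * theta (g (ord4 1) (ord4 0))
     + g (ord4 3) (ord4 1))) _ _ _ s23); ring.
have g30 : g (ord4 3) (ord4 0) = g (ord4 1) (ord4 0) ^+ 2 * theta (g (ord4 1) (ord4 0))
     + g (ord4 1) (ord4 0) * g (ord4 3) (ord4 1) + theta (g (ord4 3) (ord4 1)).
  rewrite D1 g20; apply: (@eq_mod2 (g (ord4 3) (ord4 0)
     - g (ord4 1) (ord4 0) ^+ 2 * theta (g (ord4 1) (ord4 0))
     - g (ord4 1) (ord4 0) * g (ord4 3) (ord4 1))); ring.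
apply/matrixP; by apply: forall4; apply: forall4; rewrite [RHS]mxE /= ?g0.
Qed.

Local Notation J := (suz_anti F).

Lemma antiK : J *m J = 1%:M.
Proof.
by apply/matrixP; apply: forall4; apply: forall4; rewrite !mxE sum4 !mxE /=; ring.
Qed.

Lemma suz_mulJ (g : 'M[F]_4) : suz_equations g -> g *m (J *m g^T *m J) = 1%:M.
Proof.
move=> eg; suff -> : g *m (J *m g^T *m J) = (g *m J *m g^T) *m J.
  suff -> : g *m J *m g^T = J by exact: antiK.
  apply/matrixP=> i k.
  transitivity (symp (row i g) (row k g)); first by rewrite !mxE sum4 !mxE !sum4 !mxE /= /symp !mxE; ring.
  rewrite suz_symp_rows //; move: i k.
  by apply: forall4; apply: forall4; rewrite mxE.
by rewrite !mulmxA.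
Qed.

Lemma suz_mulJr (g : 'M[F]_4) : suz_equations g -> g^T *m J *m g = J.
Proof.
move=> /suz_mulJ/mulmx1C E.
have -> : g^T *m J *m g = J *m (J *m g^T *m J *m g).
  by rewrite !mulmxA antiK mul1mx.
by rewrite E mulmx1.
Qed.

Lemma suz_det (g : 'M[F]_4) : suz_equations g -> \det g = 1.
Proof.
move=> /suz_mulJ/(congr1 determinant); rewrite !det_mulmx det_tr det1 => E.
have /(congr1 determinant) := antiK; rewrite det_mulmx det1 => EJ.
have E2 : \det g * \det g = 1 by rewrite -[RHS]E -[LHS]mulr1 -[X in _ * X]EJ; ring.
apply/eqP; rewrite -subr_eq0 -sqrf_eq0; apply/eqP.
by apply: (@eq_mod2B 1 (1 - \det g) (\det g * \det g - 1)); [rewrite E2 subrr | ring].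
Qed.

Definition entries4 (g : 'M[F]_4) (i k : nat) : F :=
  let o (i : nat) := match i with 0 => ord4 0 | 1 => ord4 1 | 2 => ord4 2 | _ => ord4 3 end
  in g (o i) (o k).

Lemma fmx4_entries g : fmx4 (entries4 g) = g.
Proof. by apply/matrixP; apply: forall4; apply: forall4; rewrite mxE. Qed.

Lemma suz_csum1 g : csum1 (entries4 g) = \tr g.
Proof. by rewrite /mxtrace sum4. Qed.

(** The inverse of g, hence its adjugate, is J g^T J. *)
Lemma suz_csum3 g : suz_equations g -> csum3 (entries4 g) = \tr g.
Proof.
move=> eg; rewrite -tr_adj4 fmx4_entries.
have -> : \adj g = J *m g^T *m J.
  have E : g *m \adj g = 1%:M by rewrite mul_mx_adj suz_det.
  by rewrite -[LHS]mul1mx -(mulmx1C (suz_mulJ eg)) -(mulmxA _ g) E mulmx1.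
by rewrite mxtrace_mulC mulmxA antiK mul1mx mxtrace_tr.
Qed.

(** The diagonal entries of theta(g) are four principal minors of g; the other
    two cancel in characteristic 2, as g and its transpose preserve the form. *)
Lemma suz_csum2 g : suz_equations g -> csum2 (entries4 g) = theta (\tr g).
Proof.
move=> eg; have [A _ _ _] := suz_minors eg (symp_delta (ord4 0) (ord4 1)) wedge_delta01.
have [_ B _ _] := suz_minors eg (symp_delta (ord4 0) (ord4 2)) wedge_delta02.
have [_ _ D _] := suz_minors eg (symp_delta (ord4 1) (ord4 3)) wedge_delta13.
have [_ _ _ E] := suz_minors eg (symp_delta (ord4 2) (ord4 3)) wedge_delta23.
have s12 := suz_symp_rows (ord4 1) (ord4 2) eg.
have /matrixP/(_ (ord4 0) (ord4 3)) c03 := suz_mulJr eg.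
rewrite /symp !mxE /= in s12; rewrite !mxE sum4 !mxE !sum4 !mxE /= in c03.
rewrite /mxtrace sum4 !thetaD A B D E /csum2 /pm2 /entries4 /=.
have z : g (ord4 1) (ord4 0) * g (ord4 2) (ord4 3)
   + g (ord4 1) (ord4 1) * g (ord4 2) (ord4 2)
   + g (ord4 1) (ord4 2) * g (ord4 2) (ord4 1)
   + g (ord4 1) (ord4 3) * g (ord4 2) (ord4 0) -
   (g (ord4 0) (ord4 0) * g (ord4 3) (ord4 3)
   + g (ord4 1) (ord4 0) * g (ord4 2) (ord4 3)
   + g (ord4 2) (ord4 0) * g (ord4 1) (ord4 3)
   + g (ord4 3) (ord4 0) * g (ord4 0) (ord4 3)) = 0.
  apply/eqP; rewrite subr_eq0; apply/eqP; rewrite s12 -[LHS]c03; ring.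
apply: (@eq_mod2B 1 (g (ord4 0) (ord4 0) * g (ord4 3) (ord4 3)
  - g (ord4 1) (ord4 2) * g (ord4 2) (ord4 1)) _ _ _ z); ring.
Qed.

(** The characteristic polynomial X^4 + T X^3 + theta(T) X^2 + T X + 1 takes the
    value theta(T) at 1, so an eigenvalue 1 forces T = 0 and g ^ 4 = 1. *)
Lemma suz_fixed_row g (v : 'rV[F]_4) : suz_equations g -> v != 0 -> v *m g = v ->
  g *m g *m (g *m g) = 1%:M.
Proof.
move=> eg nzv vg.
have d0 : \det (1%:M - g) = 0.
  by apply/eqP/det0P; exists v; rewrite // mulmxBr mulmx1 vg subrr.
have T0 : \tr g = 0.
  apply/eqP; rewrite -theta_eq0 -suz_csum2 //; apply/eqP.
  rewrite -(fmx4_entries g) det4_charE fmx4_entries suz_csum1 suz_csum3 // suz_det // in d0.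
  by apply: (@eq_mod2B 1 (\tr g - 1) _ _ _ d0); ring.
have := Cayley_Hamilton g.
have -> : char_poly g = 'X^4 + 1.
  rewrite /char_poly /char_poly_mx.
  have -> : map_mx (@polyC F) g = fmx4 (fun i k => (entries4 g i k)%:P).
    by rewrite -{1}(fmx4_entries g); apply/matrixP=> i k; rewrite !mxE.
  rewrite det4_charE.
  have -> : csum1 (fun i k => (entries4 g i k)%:P) = 0.
    by rewrite /csum1 -!polyCD -/(csum1 (entries4 g)) suz_csum1 T0.
  have -> : csum2 (fun i k => (entries4 g i k)%:P) = 0.
    transitivity (csum2 (entries4 g))%:P; last by rewrite suz_csum2 // T0 theta0.
    by rewrite /csum2 /pm2 !(rmorphB, rmorphD, rmorphM).
  have -> : csum3 (fun i k => (entries4 g i k)%:P) = 0.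
    transitivity (csum3 (entries4 g))%:P; last by rewrite suz_csum3 // T0.
    by rewrite /csum3 /pm3 !(rmorphB, rmorphD, rmorphM).
  have -> : fmx4 (fun i k => (entries4 g i k)%:P) = map_mx polyC g.
    by rewrite -{2}(fmx4_entries g); apply/matrixP=> i k; rewrite !mxE.
  by rewrite det_map_mx suz_det // !mul0r subr0 addr0 subr0.
rewrite rmorphD rmorphXn rmorph1 /= horner_mx_X !exprS expr0 mulr1 => E.
have -> : g *m g *m (g *m g) = g * (g * (g * g)) by rewrite -!mulmxA.
apply/eqP; rewrite -subr_eq0 -[X in _ == X]E -subr_eq0 opprD addrACA subrr add0r.
apply/eqP/matrixP=> i k; rewrite !mxE.
by apply: (@eq_mod2 (- (i == k)%:R)); ring.
Qed.

End SuzukiForms.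

Section SuzukiGroup.
Variables (F : finFieldType) (n : nat).
Hypothesis cardF : #|F| = (2 ^ n.*2.+1)%N.
Local Notation theta := (@suz_theta F n).
Local Notation e k := (delta_mx 0 (ord4 k) : 'rV[F]_4).
Local Notation H := (Suzuki_group F n).

Lemma suz_uM a b c d :
  suz_u n a b *m suz_u n c d = suz_u n (a + c) (b + d + a * theta c) :> 'M[F]_4.
Proof.
apply/matrixP; apply: forall4; apply: forall4; rewrite !mxE sum4 !mxE /=;
  rewrite ?(thetaD cardF) ?(thetaM _ a) ?(thetaK cardF); try by ring.
- by apply: (eq_mod2 cardF (k := - (a * theta c))); ring.
by apply: (eq_mod2 cardF (k := - (a ^+ 2 * theta c + c ^+ 2 * theta a
   + a * c * (theta a + theta c)))); ring.
Qed.

Lemma suz_u00 : suz_u n 0 0 = 1%:M :> 'M[F]_4.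
Proof.
apply/matrixP; apply: forall4; apply: forall4; rewrite !mxE /= ?theta0; by ring.
Qed.

Lemma suz_u_inj0 b : suz_u n 0 b = 1%:M :> 'M[F]_4 -> b = 0.
Proof. by move/matrixP/(_ (ord4 3) (ord4 1)); rewrite !mxE. Qed.

Lemma suz_u_fixed_row (v : 'rV[F]_4) : v *m suz_u n 1 0 = v ->
  exists c, v = c *: e 0.
Proof.
move/rowP=> E; exists (v 0 (ord4 0)); move: (E (ord4 0)) (E (ord4 1)) (E (ord4 2)).
rewrite !mxE !sum4 !mxE /= theta0 theta1 => E0 E1 E2.
have v3 : v 0 (ord4 3) = 0.
  by apply: (addrI (v 0 (ord4 2))); rewrite addr0 -[RHS]E2; ring.
have v2 : v 0 (ord4 2) = 0.
  by apply: (addrI (v 0 (ord4 1))); rewrite addr0 -[RHS]E1 v3; ring.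
have v1 : v 0 (ord4 1) = 0.
  by apply: (addrI (v 0 (ord4 0))); rewrite addr0 -[RHS]E0 v2 v3; ring.
apply/rowP; apply: forall4; rewrite !mxE /= ?v1 ?v2 ?v3; by ring.
Qed.

Lemma suz_centralizer_u (B : 'M[F]_4) b : suz_equations n B -> b != 0 ->
  suz_u n 0 b *m B = B *m suz_u n 0 b -> e 0 *m B = e 0.
Proof.
move=> eB nb /matrixP E.
move: (E (ord4 0) (ord4 0)) (E (ord4 0) (ord4 1)) (E (ord4 1) (ord4 0))
  (E (ord4 1) (ord4 1)) (E (ord4 2) (ord4 0)) (E (ord4 2) (ord4 1)).
rewrite !mxE !sum4 !mxE /= !theta0 => E00 E01 E10 E11 E20 E21.
have [A0 A1 _ _] := suz_minors eB (symp_delta _ (ord4 0) (ord4 1)) (wedge_delta01 _).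
have s12 := suz_symp_rows (ord4 1) (ord4 2) eB; rewrite /symp !mxE /= in s12.
have use (x y u w : F) : x = y -> y - x = u * b - w -> w = 0 -> u = 0.
  move=> -> eu w0; apply: (mulIf nb).
  by rewrite mul0r -[LHS](subrK w) -eu subrr add0r w0.
have b03 := use _ _ (B (ord4 0) (ord4 3)) 0 E01 ltac:(ring) erefl.
have b02 := use _ _ (B (ord4 0) (ord4 2)) (- (B (ord4 0) (ord4 3) * theta b))
   E00 ltac:(ring) ltac:(rewrite b03; ring).
have b13 := use _ _ (B (ord4 1) (ord4 3)) 0 E11 ltac:(ring) erefl.
have b12 := use _ _ (B (ord4 1) (ord4 2)) (- (B (ord4 1) (ord4 3) * theta b))
   E10 ltac:(ring) ltac:(rewrite b13; ring).
have b01 : B (ord4 0) (ord4 1) = 0.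
  by apply/eqP; rewrite -(theta_eq0 n) A1 b12 b02; apply/eqP; ring.
have b23 := use _ _ (B (ord4 2) (ord4 3)) (B (ord4 0) (ord4 1) * b)
   E21 ltac:(ring) ltac:(rewrite b01; ring).
have b22 := use _ _ (B (ord4 2) (ord4 2) - B (ord4 0) (ord4 0))
   (- (B (ord4 2) (ord4 3) * theta b)) E20 ltac:(ring) ltac:(rewrite b23; ring).
have {}b22 : B (ord4 2) (ord4 2) = B (ord4 0) (ord4 0) by apply/eqP; rewrite -subr_eq0 b22.
have b00 : B (ord4 0) (ord4 0) = 1.
  apply: (theta_inj cardF); rewrite theta1 A0 b01 -[RHS]s12 b12 b13 b23 b22; ring.
apply/rowP=> k; rewrite -rowE !mxE /=.
by move: k; apply: forall4; rewrite ?b00 ?b01 ?b02 ?b03.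
Qed.

Lemma suz_trace_u a b : \tr (suz_u n a b : 'M[F]_4) = 0.
Proof.
rewrite /mxtrace sum4 !mxE /=; apply: (eq_mod2 cardF (k := 2%:R)); ring.
Qed.

Lemma suz_trace_anti_u c : \tr (suz_anti F *m suz_u n 0 c) = theta c.
Proof. rewrite /mxtrace sum4 !mxE !sum4 !mxE /= ?theta0; ring. Qed.

Lemma suz_trace_anti_u2 c :
  \tr (suz_anti F *m suz_u n 0 c *m (suz_anti F *m suz_u n 0 c)) = theta c ^+ 2.
Proof.
rewrite /mxtrace sum4 !mxE !sum4 !mxE !sum4 !mxE /= ?theta0.
by apply: (eq_mod2 cardF (k := c ^+ 2 + 2%:R)); ring.
Qed.

Lemma suzuki_equations g : g \in H -> suz_equations n (GLval g).
Proof.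
pose S := [set g : {'GL_4[F]} | `[< suz_equations n (GLval g) >]].
have gS : group_set S.
  apply/group_setP; split=> [|x y]; rewrite !inE; first by apply/asboolP/suz_equations1.
  move=> /asboolP ex /asboolP ey; apply/asboolP.
  exact: (suz_equationsM cardF).
suff /subsetP sHS : H \subset Group gS by move/sHS; rewrite inE => /asboolP.
rewrite gen_subG; apply/subsetP=> x; rewrite !inE => /or3P[].
- by case/existsP=> a /existsP[b /eqP ->]; apply/asboolP/(suz_equations_u cardF).
- case/existsP=> a1 /existsP[a2 /existsP[k /and4P[k0 /eqP e1 /eqP e2 /eqP ->]]].
  exact/asboolP/(suz_equations_diag cardF k0 e1 e2).
by move/eqP->; apply/asboolP/(suz_equations_anti cardF).
Qed.

Definition gl4 (A : 'M[F]_4) : {'GL_4[F]} := insubd (1%g : {'GL_4[F]}) A.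

Lemma gl4E A : suz_equations n A -> GLval (gl4 A) = A.
Proof.
move=> eA; rewrite /gl4 val_insubd.
by have /mulmx1_unit[-> _] := suz_mulJ eA.
Qed.

Lemma gl4_uE a b : GLval (gl4 (suz_u n a b)) = suz_u n a b.
Proof. exact/gl4E/suz_equations_u. Qed.

Lemma gl4_antiE : GLval (gl4 (suz_anti F)) = suz_anti F.
Proof. exact/gl4E/suz_equations_anti. Qed.

Lemma mem_gl4_u a b : gl4 (suz_u n a b) \in H.
Proof.
apply: mem_gen; rewrite inE; apply/orP; left.
by apply/existsP; exists a; apply/existsP; exists b; rewrite gl4_uE.
Qed.

Lemma mem_gl4_anti : gl4 (suz_anti F) \in H.
Proof. by apply: mem_gen; rewrite inE gl4_antiE eqxx !orbT. Qed.

(** The rows fixed by u(1, 0) form a line, which is fixed by every 2-subgroup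
    that contains u(1, 0). *)
Lemma suz_2group_conj (P : {group {'GL_4[F]}}) : P \subset H -> (2.-group P)%g ->
  exists2 h, h \in H & forall g, g \in (P :^ h)%g ->
    exists a b, GLval g = suz_u n a b.
Proof.
move=> sPH P2; pose x0 := gl4 (suz_u n 1 0).
have x04 : (x0 ^+ 4 = 1)%g.
  apply: GLval_inj; rewrite !expgS expg0 mulg1.
  rewrite !GLvalM gl4_uE.
  rewrite !suz_uM -[RHS](suz_u00); congr (suz_u n _ _).
    by apply: (eq_mod2 cardF (k := 2%:R)); ring.
  by apply: (eq_mod2 cardF (k := 3%:R)); rewrite !(thetaD cardF) theta1; ring.
have x02 : (2.-elt x0)%g.
  by rewrite /p_elt (@pnat_dvd _ 4) // order_dvdn x04.
have [Q [h [Q2 Qx0 Hh sQH sPQ]]] := pgroup_conj_Sylow (mem_gl4_u 1 0) x02 sPH P2.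
have fixQ := pgroup_fixes_only_row (char2F cardF) Q2 Qx0 (e0 := e 0).
exists h => // g /(subsetP sPQ) Qg; exists (GLval g (ord4 1) (ord4 0)), (GLval g (ord4 3) (ord4 1)).
apply: (suz_fixed_e0 cardF); first exact: (suzuki_equations (subsetP sQH _ Qg)).
by apply: fixQ => // v; rewrite gl4_uE; apply: suz_u_fixed_row.
Qed.

Variables (gT : finGroupType) (f : {morphism H >-> gT}).
Hypotheses (surj_f : (f @* H)%g = [set: gT]) (inj_f : ('injm f)%g).

(** An involution of the group is conjugate to some u(0, b), and what commutes
    with u(0, b) is some u(a, c), of trace 0. *)
Lemma suz_cent_odd A : A \in H -> \tr (GLval A) != 0 -> ((2%N)^'.-group 'C[f A])%g.
Proof.
move=> HA trA; apply: (morph_cent1_pgroup surj_f) => // g Hg g2.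
move=> /(subsetP inj_f)/set1P cgA.
have {}cgA : commute g A.
  by move/eqP: cgA; rewrite -eq_mulgV1 => /eqP cgA; apply: (mulIg g^-1%g); rewrite cgA mulgK.
apply/eqP; rewrite morph_injm_eq1 //; apply: contraT => n1.
have [|i Gi oi] := @Cauchy _ 2 <[g]>%G isT.
  have [k ok] := p_natP g2; rewrite /= -/(order g) ok.
  case: k ok => [|k] ok; last by rewrite expnS dvdn_mulr.
  by rewrite -order_eq1 ok eqxx in n1.
have Hi : i \in H by apply: (subsetP _ _ Gi); rewrite cycle_subG.
have ciA : commute i A by case/cycleP: Gi => k ->; apply/commute_sym/commuteX/commute_sym.
have i2 : (2.-group <[i]>)%g by rewrite /pgroup -/(order i) oi.
have [|h Hh fixP] := suz_2group_conj _ i2; first by rewrite cycle_subG.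
have [|a [b Eih]] := fixP (i ^ h)%g; first by rewrite memJ_conjg cycle_id.
have ih1 : (i ^ h * i ^ h = 1)%g.
  by have := expg_order i; rewrite oi expgS expg1 -conjMg => ->; rewrite conj1g.
have a0 : a = 0.
  have /(congr1 (fun x : {'GL_4[F]} => GLval x (ord4 3) (ord4 1))) := ih1.
  rewrite GLvalM Eih suz_uM !mxE /=.
  move=> E; have /eqP : a * theta a = 0.
    by apply: (eq_mod2B cardF (c := 1) (k := - b) E); ring.
  by rewrite mulf_eq0 theta_eq0 orbb => /eqP.
have nb : b != 0.
  apply: contraNneq n1 => b0; have : (i ^ h)%g = 1%g.
    by apply: GLval_inj; rewrite Eih a0 b0 suz_u00.
  by move/eqP; rewrite conjg_eq1 -order_eq1 oi.
have eAh := suzuki_equations (groupJ HA Hh).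
have e0Ah : e 0 *m GLval (A ^ h)%g = e 0.
  apply: (suz_centralizer_u eAh nb); rewrite -a0 -Eih.
  rewrite -[LHS]/(GLval (i ^ h * A ^ h)%g) -[RHS]/(GLval (A ^ h * i ^ h)%g).
  by rewrite -!conjMg ciA.
case/eqP: trA; have [|-> _] := injm_class_tr surj_f inj_f (groupJ HA Hh) HA _.
  by apply/imsetP; exists (f h^-1)%g; rewrite ?inE // -morphJ ?groupV ?groupJ // conjgK.
by rewrite (suz_fixed_e0 cardF eAh e0Ah) suz_trace_u.
Qed.

(** In a noncyclic group some l-element fixes a nonzero row, so its order
    divides 4. *)
Lemma suz_central_type_2group (M : {group gT}) :
  abelian M -> central_type M -> (2.-group M)%g.
Proof.
move=> abM ctM; apply/pgroupP=> l pr_l lM; rewrite inE; apply: contraT => l2.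
have l'k : (l^'.-group ('ker f))%g by rewrite (trivgP inj_f) pgroup1.
have [g [Hg lg n1 [v nzv vg]]] := central_type_fixes_row surj_f l'k pr_l abM ctM lM.
have g4 : (g ^+ 4 = 1)%g.
  apply: GLval_inj; have := suz_fixed_row cardF (suzuki_equations Hg) nzv vg.
  by rewrite !expgS expg0 mulg1 -!mulmxA.
have : #[g]%g = 1%N.
  apply: (@pnat_1 l); first exact: lg.
  apply: (@pnat_dvd _ 4); first by rewrite order_dvdn g4.
  by rewrite (@pnatX _ 2 2) pnatE // !inE (eq_sym 2%N l) (negPf l2).
by move/eqP; rewrite order_eq1 (negPf n1).
Qed.

(** Commuting elements u(a, b) and u(c, d) of order 4 have a / c fixed by
    theta, so a = c and their squares u(0, a theta a) agree; in a group E x E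
    that is not elementary abelian some elements of order 4 have distinct
    squares. *)
Lemma suz_central_type_center (M : {group gT}) : abelian M -> central_type M ->
    (forall u, u \in M -> exists g a b, [/\ g \in H, u = f g & GLval g = suz_u n a b]) ->
  forall u, u \in M -> exists g b, [/\ g \in H, u = f g & GLval g = suz_u n 0 b].
Proof.
move=> abM ctM ofu u Mu; have [g [a [b [Hg Du Eg]]]] := ofu u Mu.
have [a0|na] := eqVneq a 0; first by exists g, b; rewrite -a0.
have sqE (g' : {'GL_4[F]}) a' b' : GLval g' = suz_u n a' b' -> GLval (g' * g')%g = suz_u n 0 (a' * theta a').
  move=> E; rewrite GLvalM E suz_uM.
  congr (suz_u n _ _); first by apply: (eq_mod2 cardF (k := a')); ring.
  by apply: (eq_mod2 cardF (k := b')); ring.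
have u2 : (u * u != 1)%g.
  rewrite Du -morphM // morph_injm_eq1 ?groupM //; apply: contraNneq na => g1.
  have := sqE _ _ _ Eg; rewrite g1 => /esym/suz_u_inj0/eqP.
  by rewrite mulf_eq0 theta_eq0 orbb.
have [y [z [My Mz y2 z2 yz]]] := central_type_squares ctM Mu u2.
have [gy [c [d [Hy Dy Ey]]]] := ofu y My; have [gz [c' [d' [Hz Dz Ez]]]] := ofu z Mz.
have nz w (gw : {'GL_4[F]}) k k' : gw \in H -> w = f gw -> GLval gw = suz_u n k k' -> (w * w != 1)%g -> k != 0.
  move=> Hw Dw Ew; apply: contraNneq => k0; rewrite Dw -morphM // morph_injm_eq1 ?groupM //.
  by apply/eqP/GLval_inj; rewrite (sqE _ _ _ Ew) k0 mul0r suz_u00.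
have nc := nz _ _ _ _ Hy Dy Ey y2; have nc' := nz _ _ _ _ Hz Dz Ez z2.
have cyz : (gy * gz = gz * gy)%g.
  apply: (injmP inj_f); rewrite ?groupM // !morphM // -Dy -Dz.
  exact: (centsP abM).
have E : c * theta c' = c' * theta c.
  have /(congr1 (fun x : {'GL_4[F]} => GLval x (ord4 3) (ord4 1))) := cyz.
  rewrite !GLvalM.
  rewrite Ey Ez !suz_uM !mxE /= (addrC d') => /addrI //.
have fixq : theta (c' / c) = c' / c.
  rewrite thetaM (_ : theta c^-1 = (theta c)^-1); last by rewrite /suz_theta exprVn.
  apply: (mulIf nc); rewrite mulfVK // mulrAC; apply: (mulIf (x := theta c)).
    by rewrite theta_eq0.
  by rewrite mulfVK ?theta_eq0 // mulrC E.
case: (theta_fixed cardF fixq) => [/eqP|q1].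
  by rewrite mulf_eq0 invr_eq0 (negPf nc) (negPf nc').
have Ec : c' = c by rewrite -(mulfVK nc c') q1 mul1r.
case/eqP: yz; rewrite Dy Dz -!morphM //; congr (f _); apply: GLval_inj.
by rewrite (sqE _ _ _ Ey) (sqE _ _ _ Ez) Ec.
Qed.

(** With t = t' = J u(0, 1), the traces of t u(0, b) and of its square are
    theta (1 + b) and theta (1 + b) ^ 2. *)
Lemma suz_obstruction_u (M : {group gT}) : M :!=: 1%g -> (2.-group M)%g ->
    (forall u, u \in M -> exists g b, [/\ g \in H, u = f g & GLval g = suz_u n 0 b]) ->
  twist_obstruction M.
Proof.
move=> ntM M2 ofu.
pose s := (gl4 (suz_anti F) * gl4 (suz_u n 0 1%R))%g.
have Hs : s \in H by rewrite groupM ?mem_gl4_anti ?mem_gl4_u.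
have Es : GLval s = suz_anti F *m suz_u n 0 1.
  by rewrite GLvalM gl4_antiE gl4_uE.
have su (g : {'GL_4[F]}) b : GLval g = suz_u n 0 b -> GLval (s * g)%g = suz_anti F *m suz_u n 0 (1 + b).
  move=> Eg; rewrite GLvalM Es Eg -mulmxA suz_uM.
  by congr (_ *m suz_u n _ _); ring.
have gg (g : {'GL_4[F]}) b : GLval g = suz_u n 0 b -> (g * g = 1)%g.
  move=> Eg; apply: GLval_inj; rewrite GLvalM Eg suz_uM.
  rewrite -[RHS]suz_u00; congr (suz_u n _ _); first by ring.
  by apply: (eq_mod2 cardF (k := b)); ring.
have ss : GLval (s * s)%g = GLval s *m GLval s by [].
clearbody s.
have isol u : u \in M -> (u * f s)%g \in (f s ^: [set: gT])%g -> u = 1%g.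
  case/ofu=> g [b [Hg -> Eg]]; rewrite -morphM //.
  case/(injm_class_tr surj_f inj_f Hs (groupM Hg Hs)) => + _.
  rewrite GLvalM mxtrace_mulC.
  rewrite -[X in \tr X]/(GLval (s * g)%g) (su _ _ Eg) Es !suz_trace_anti_u.
  move/(theta_inj cardF)/(canRL (addKr _)); rewrite addNr => b0.
  by rewrite (_ : g = 1%g) ?morph1 //; apply: GLval_inj; rewrite Eg b0 suz_u00.
have [u Mu nu] : exists2 u, u \in M & u != 1%g by apply/trivgPn.
exists 2%N, (f s), (f s), u; split=> //.
- rewrite -morphM //; have tr1 : \tr (GLval s) != 0 by rewrite Es suz_trace_anti_u theta1 oner_eq0.
  split; apply: suz_cent_odd; rewrite ?groupM //.
  by rewrite GLvalM Es suz_trace_anti_u2 theta1 expr1n oner_eq0.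
split=> //; have [g [b [Hg Du Eg]]] := ofu u Mu.
rewrite Du -morphJ // -!morphM ?groupJ //; apply/negP.
case/(injm_class_tr surj_f inj_f (groupM Hs Hs) (groupM Hs (groupJ Hs Hg))) => + _.
have gV : (g^-1 = g)%g by apply: (mulgI g); rewrite mulgV (gg _ _ Eg).
rewrite conjgE gV !mulgA -(mulgA (s * g)%g) (GLvalM (s * g)%g).
rewrite ss Es (su _ _ Eg) !suz_trace_anti_u2 (thetaD cardF) theta1 => /eqP.
rewrite -subr_eq0 => /eqP E.
have /eqP : theta b ^+ 2 = 0.
  by apply: (eq_mod2B cardF (c := 1) (k := - theta b) E); ring.
rewrite expf_eq0 theta_eq0 /= => /eqP b0; case/eqP: nu.
by rewrite Du (_ : g = 1%g) ?morph1 //; apply: GLval_inj; rewrite Eg b0 suz_u00.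
Qed.

Theorem suzuki_twist_obstruction (M : {group gT}) :
  M :!=: 1%g -> abelian M -> central_type M -> twist_obstruction M.
Proof.
move=> ntM abM ctM; have M2 := suz_central_type_2group abM ctM.
have [P [sPH P2 fP]] := morph_pgroup_lift surj_f M2.
have [h Hh ofP] := suz_2group_conj sPH P2.
apply: (@twist_obstructionJ _ _ (f h)).
have DM : (M :^ f h)%g = (f @* (P :^ h))%g by rewrite morphimJ // fP.
apply: suz_obstruction_u.
- by rewrite /= -(conjs1g (f h)) (inj_eq (act_inj 'Js _)).
- by rewrite /= pgroupJ.
apply: suz_central_type_center; [by rewrite /= abelianJ | exact: central_typeJ |].
move=> u; rewrite /= DM => /morphimP[g Hg Pg ->].
by have [a [b Eg]] := ofP g Pg; exists g, a, b.
Qed.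

End SuzukiGroup.

(** * SL3 over a prime field *)

Notation ord3 k := (@Ordinal 3 k isT).

Lemma sum3 (V : nmodType) (E : 'I_3 -> V) :
  \sum_i E i = E (ord3 0) + E (ord3 1) + E (ord3 2).
Proof.
rewrite !big_ord_recr big_ord0 /= add0r; congr (_ + _ + _);
by congr E; apply: val_inj.
Qed.

Lemma forall3 (P : 'I_3 -> Prop) :
  P (ord3 0) -> P (ord3 1) -> P (ord3 2) -> forall i, P i.
Proof.
move=> P0 P1 P2 [[|[|[|i]]] lti] //.
- by rewrite (_ : Ordinal lti = ord3 0) //; apply: val_inj.
- by rewrite (_ : Ordinal lti = ord3 1) //; apply: val_inj.
by rewrite (_ : Ordinal lti = ord3 2) //; apply: val_inj.
Qed.

(** Every nonzero x is a root for a single s, and there are fewer nonzero x than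
    elements of F. *)
Lemma no_root_cubic (F : finFieldType) :
  exists s : F, forall x, x ^+ 3 + s * x - 1 != 0.
Proof.
pose I := [set (1 - x ^+ 3) / x | x in [set~ (0 : F)]].
have [s nIs] : exists s, s \notin I.
  apply/existsP; rewrite -negb_forall; apply/negP=> /forallP all_I.
  have : (#|F| <= #|I|)%N by rewrite -cardsT subset_leq_card //; apply/subsetP=> x _; apply: all_I.
  rewrite leqNgt (leq_ltn_trans (leq_imset_card _ _)) // cardsC1 prednK ?leqnn //.
  by apply/card_gt0P; exists 0.
exists s => x; apply: contra nIs => /eqP e.
have nx : x != 0.
  by apply: contra_eq_neq e => ->; rewrite expr0n mulr0 addr0 sub0r oppr_eq0 oner_eq0.
apply/imsetP; exists x; first by rewrite !inE.
apply: (mulIf nx); rewrite mulfVK //; apply/eqP; rewrite -subr_eq0 -[X in _ == X]e.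
by apply/eqP; ring.
Qed.

Section SL3.
Variables (F : finFieldType) (p : nat).
Hypotheses (pr_p : prime p) (cardF : #|F| = p).
Local Notation H := (SLn_group 3 F).

Lemma charF3 : p \in [pchar F].
Proof. by apply: (@card_finPcharP _ p 1) => //; rewrite expn1. Qed.

Definition mx3 (s : seq (seq F)) : 'M[F]_3 := \matrix_(i, k) (nth [::] s i)`_k.

Definition sl3_u (a b c : F) := mx3 [:: [:: 1; 0; 0]; [:: a; 1; 0]; [:: c; b; 1]].

Lemma sl3_uM a b c a' b' c' :
  sl3_u a b c *m sl3_u a' b' c' = sl3_u (a + a') (b + b') (c + b * a' + c').
Proof. by apply/matrixP; apply: forall3; apply: forall3; rewrite !mxE sum3 !mxE /=; ring. Qed.

Lemma sl3_u1 : sl3_u 0 0 0 = 1%:M.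
Proof. by apply/matrixP; apply: forall3; apply: forall3; rewrite !mxE. Qed.

Lemma sl3_u_inj0 a b c : sl3_u a b c = 1%:M -> [/\ a = 0, b = 0 & c = 0].
Proof.
move=> /matrixP E; move: (E (ord3 1) (ord3 0)) (E (ord3 2) (ord3 1)) (E (ord3 2) (ord3 0)).
by rewrite !mxE /= => -> -> ->.
Qed.

Definition gl3 (A : 'M[F]_3) : {'GL_3[F]} := insubd (1%g : {'GL_3[F]}) A.

Lemma gl3E A B : A *m B = 1%:M -> GLval (gl3 A) = A.
Proof. by move=> /mulmx1_unit[uA _]; rewrite /gl3 val_insubd uA. Qed.

Lemma det3_entries (A : 'M[F]_3) : \det A =
  pm3 (fun i k => let o (i : nat) := match i with 0 => ord3 0 | 1 => ord3 1 | _ => ord3 2 end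
        in A (o i) (o k)) 0 1 2.
Proof. by apply: det3E; apply: forall3; apply: forall3. Qed.

Lemma det_sl3_u a b c : \det (sl3_u a b c) = 1.
Proof. by rewrite det3_entries /pm3 !mxE /=; ring. Qed.

Lemma gl3_uE a b c : GLval (gl3 (sl3_u a b c)) = sl3_u a b c.
Proof.
apply: (@gl3E _ (sl3_u (- a) (- b) (a * b - c))); rewrite sl3_uM -sl3_u1.
by congr sl3_u; ring.
Qed.

Lemma sl3_fixed (g : 'M[F]_3) : \det g = 1 ->
    delta_mx 0 (ord3 0) *m g = delta_mx (0 : 'I_1) (ord3 0) ->
    g *m delta_mx (ord3 2) (0 : 'I_1) = delta_mx (ord3 2) 0 ->
  exists a b c, g = sl3_u a b c.
Proof.
rewrite -rowE -colE => dg /rowP r0 /colP c2.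
move: (r0 (ord3 0)) (r0 (ord3 1)) (r0 (ord3 2)) (c2 (ord3 1)) (c2 (ord3 2)).
rewrite !mxE /= => g00 g01 g02 g12 g22.
exists (g (ord3 1) (ord3 0)), (g (ord3 2) (ord3 1)), (g (ord3 2) (ord3 0)).
have g11 : g (ord3 1) (ord3 1) = 1.
  by rewrite -dg det3_entries /pm3 /= g00 g01 g02 g12 g22; ring.
by apply/matrixP; apply: forall3; apply: forall3; rewrite !mxE.
Qed.

Lemma sl3_p_elt : (p.-elt (gl3 (sl3_u 1%R 1%R 0%R)))%g.
Proof.
have pF : p%:R = 0 :> F by exact: pcharf0 charF3.
set x := gl3 _; have xn k : exists c, GLval (x ^+ k)%g = sl3_u k%:R k%:R c.
  elim: k => [|k [c IHk]]; first by exists 0; rewrite sl3_u1.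
  exists (k%:R + c); rewrite expgS GLvalM IHk gl3_uE sl3_uM mulrS.
  by congr sl3_u; ring.
have yn c k : GLval (gl3 (sl3_u 0 0 c) ^+ k)%g = sl3_u 0 0 (k%:R * c).
  elim: k => [|k IHk]; first by rewrite mul0r sl3_u1.
  by rewrite expgS GLvalM IHk gl3_uE sl3_uM mulrS; congr sl3_u; ring.
have [c Ep] := xn p; rewrite pF in Ep.
have E : (x ^+ p = gl3 (sl3_u 0 0 c))%g by apply: GLval_inj; rewrite Ep gl3_uE.
rewrite /p_elt (@pnat_dvd _ (p * p)) ?pnatM ?pnat_id // order_dvdn expgM E.
by apply/eqP/GLval_inj; rewrite yn pF mul0r sl3_u1.
Qed.

(** A regular unipotent matrix fixes a single line of rows and a single line of
    columns. *)
Lemma sl3_pgroup_conj (P : {group {'GL_3[F]}}) : P \subset H -> (p.-group P)%g ->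
  exists2 h, h \in H & forall g, g \in (P :^ h)%g -> exists a b c, GLval g = sl3_u a b c.
Proof.
move=> sPH pP; pose x := gl3 (sl3_u 1 1 0).
have Hx : x \in H by rewrite inE gl3_uE det_sl3_u.
have [Q [h [pQ Qx Hh sQH sPQ]]] := pgroup_conj_Sylow Hx sl3_p_elt sPH pP.
exists h => // g /(subsetP sPQ) Qg; apply: sl3_fixed.
- by have := subsetP sQH _ Qg; rewrite inE => /eqP.
- apply: (pgroup_fixes_only_row charF3 pQ Qx) => // v.
  rewrite gl3_uE => /rowP E; exists (v 0 (ord3 0)); move: (E (ord3 0)) (E (ord3 1)).
  rewrite !mxE !sum3 !mxE /= => E0 E1.
  have v2 : v 0 (ord3 2) = 0.
    by apply: (addrI (v 0 (ord3 1))); rewrite addr0 -[RHS]E1; ring.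
  have v1 : v 0 (ord3 1) = 0.
    by apply: (addrI (v 0 (ord3 0))); rewrite addr0 -[RHS]E0 v2; ring.
  apply/rowP; apply: forall3; rewrite !mxE /= ?v1 ?v2; by ring.
apply: (pgroup_fixes_only_col charF3 pQ Qx) => // v.
rewrite gl3_uE => /colP E; exists (v (ord3 2) 0); move: (E (ord3 1)) (E (ord3 2)).
rewrite !mxE !sum3 !mxE /= => E1 E2.
have v0 : v (ord3 0) 0 = 0.
  by apply: (addrI (v (ord3 1) 0)); rewrite addr0 -[RHS]E1; ring.
have v1 : v (ord3 1) 0 = 0.
  by apply: (addrI (v (ord3 2) 0)); rewrite addr0 -[RHS]E2 v0; ring.
by apply/colP; apply: forall3; rewrite !mxE /= ?v1 ?v0; ring.
Qed.

(** The kernel and the image of g - 1 are stable under t, and one of them is a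
    line if g fixes some but not all vectors. *)
Lemma sl3_irreducible_cent (g t : 'M[F]_3) (s : F) (v : 'rV[F]_3) :
    (forall x : F, x ^+ 3 + s * x - 1 != 0) -> (t *m t + s%:M) *m t = 1%:M ->
    g *m t = t *m g -> v != 0 -> v *m g = v -> g = 1%:M.
Proof.
move=> noroot t3 cgt nzv vg; apply/eqP; rewrite -subr_eq0; apply: contraT => nzN.
set N := g - 1%:M in nzN.
have cNt : N *m t = t *m N by rewrite /N mulmxBl mulmxBr mul1mx mulmx1 cgt.
have noline (V : 'M[F]_3) : \rank V = 1%N -> (V *m t <= V)%MS -> False.
  move=> rV stV; pose w := nz_row V.
  have nzw : w != 0 by rewrite nz_row_eq0 -mxrank_eq0 rV.
  have sVw : (V <= w)%MS by rewrite -(geq_leqif (mxrank_leqif_sup (nz_row_sub V))) rV rank_rV nzw.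
  have /sub_rVP[x wt] : (w *m t <= w)%MS.
    exact: submx_trans (submxMr _ (nz_row_sub V)) (submx_trans stV sVw).
  have : (x ^+ 3 + s * x - 1) *: w == 0.
    rewrite scalerBl scale1r subr_eq0; apply/eqP.
    rewrite -[RHS]mulmx1 -t3 mulmxA mulmxDr mulmxA wt mul_mx_scalar.
    rewrite -scalemxAl wt scalerA mulmxDl -!scalemxAl wt !scalerA -scalerDl.
    by congr (_ *: _); ring.
  by rewrite scaler_eq0 (negPf nzw) (negPf (noroot x)).
have rN : (0 < \rank N)%N by rewrite lt0n mxrank_eq0.
have rK : (0 < \rank (kermx N))%N.
  rewrite lt0n mxrank_eq0; apply: contraNneq nzv => K0.
  have : (v <= kermx N)%MS by apply/sub_kermxP; rewrite mulmxBr mulmx1 vg subrr.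
  by rewrite K0 submx0.
have [] : \rank N = 1%N \/ \rank (kermx N) = 1%N.
  move: rN rK; rewrite mxrank_ker; have := rank_leq_row N.
  by case: (\rank N) => [|[|[|[|k]]]] //; [left | right].
- by move=> r1; case: (noline _ r1); rewrite cNt submxMl.
move=> r1; case: (noline _ r1); apply/sub_kermxP.
by rewrite -mulmxA -cNt mulmxA mulmx_ker mul0mx.
Qed.

Variables (gT : finGroupType) (f : {morphism H >-> gT}).
Hypotheses (surj_f : (f @* H)%g = [set: gT]) (inj_f : ('injm f)%g).

(** The hypothesis says that the inverse of A is a polynomial in A ^ 2, so A
    and A ^ 2 have the same centralizer. *)
Lemma sl3_cent_p' A s : A \in H ->
    (forall x : F, x ^+ 3 + s * x - 1 != 0) ->
    GLval A^-1%g = GLval A *m GLval A + s%:M ->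
  (p^'.-group 'C[f A])%g /\ (p^'.-group 'C[f A * f A])%g.
Proof.
move=> HA noroot EA.
have t3 : (GLval A *m GLval A + s%:M) *m GLval A = 1%:M.
  by rewrite -EA -GLvalM mulVg.
have cent g : g \in H -> (p.-elt g)%g -> commute g A -> f g = 1%g.
  move=> Hg pg cgA; have pG : (p.-group <[g]>)%g by [].
  have [v nzv fixv] := pgroup_fixes_row charF3 pG.
  have := sl3_irreducible_cent noroot t3 (congr1 GLval cgA) nzv (fixv _ (cycle_id g)).
  by move=> g1; rewrite (_ : g = 1%g) ?morph1 //; apply: GLval_inj.
have ker1 B g : (g * B * g^-1 * B^-1)%g \in ('ker f)%g -> commute g B.
  move/(subsetP inj_f)/set1P/eqP; rewrite -eq_mulgV1 => /eqP E.
  by apply: (mulIg g^-1%g); rewrite E mulgK.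
split.
  by apply: (morph_cent1_pgroup surj_f) => // g Hg pg /ker1; apply: cent.
rewrite -morphM //; apply: (morph_cent1_pgroup surj_f); rewrite ?(groupM HA HA) //.
move=> g Hg pg /ker1 cg2; apply: cent => //.
rewrite -(invgK A); apply/commuteV/GLval_inj; rewrite !GLvalM EA mulmxDl mulmxDr.
congr (_ + _); last by rewrite mul_mx_scalar mul_scalar_mx.
exact: (congr1 GLval cg2).
Qed.

Section Unitriangular.
Variable P : {group {'GL_3[F]}}.
Hypotheses (sPH : P \subset H) (abP : abelian P).
Hypothesis ofP : forall g, g \in P -> exists a b c, GLval g = sl3_u a b c.

(** Commuting unitriangular matrices have proportional vectors (a, b). If both
    a + b and a - b vanish on a nonzero one, then the characteristic is 2 and
    a = b, so that the square of the matrix is not 1. *)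
Lemma sl3_abelian_slope : ~ (p = 2%N /\ exists2 g, g \in P & (g * g != 1)%g) ->
  exists2 y : F, y * y = 1 & forall g a b c, g \in P -> GLval g = sl3_u a b c ->
    a + y * b = 0 -> a = 0 /\ b = 0.
Proof.
move=> not2.
have [/forall_inP triv|] := boolP [forall g in P,
   (GLval g (ord3 1) (ord3 0) == 0) && (GLval g (ord3 2) (ord3 1) == 0)].
  exists 1; rewrite ?mulr1 // => g a b c /triv /andP[] + + E _.
  by rewrite E !mxE /= => /eqP-> /eqP->.
rewrite negb_forall_in => /exists_inP[g0 Pg0]; have [a0 [b0 [c0 E0]]] := ofP Pg0.
rewrite E0 !mxE /= negb_and => nz0.
have prop g a b c : g \in P -> GLval g = sl3_u a b c -> a * b0 = b * a0.
  move=> Pg E; have /(congr1 GLval) := centsP abP _ Pg _ Pg0.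
  rewrite !GLvalM E E0 !sl3_uM => /matrixP/(_ (ord3 2) (ord3 0)).
  rewrite !mxE /= => e1; apply: (addrI (c + c0)); transitivity (c0 + b0 * a + c); first by ring.
  by rewrite -e1; ring.
have [z|nD] := eqVneq (a0 + b0) 0; last first.
  exists 1; rewrite ?mulr1 // => g a b c Pg E; rewrite mul1r => ab.
  have e := prop _ _ _ _ Pg E; have Db : b = - a by apply/eqP; rewrite -addr_eq0 addrC ab.
  suff a1 : a = 0 by rewrite Db a1 oppr0.
  apply: (mulIf nD); rewrite mul0r mulrDr e Db; ring.
have [z'|nB] := eqVneq (a0 - b0) 0; last first.
  exists (- 1); rewrite ?mulrNN ?mulr1 // => g a b c Pg E; rewrite mulN1r => /eqP.
  rewrite subr_eq0 => /eqP ab; have e := prop _ _ _ _ Pg E.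
  suff b1 : b = 0 by rewrite ab b1.
  by apply: (mulIf nB); rewrite mul0r mulrBr -e ab; ring.
have na : a0 != 0.
  have Db : b0 = a0 by apply/eqP; rewrite eq_sym -subr_eq0 z'.
  by move: nz0; rewrite Db orbb.
have p2 : p = 2%N.
  have : 2%:R = 0 :> F.
    apply: (mulIf na); rewrite mul0r; transitivity ((a0 + b0) + (a0 - b0)); first by ring.
    by rewrite z z' addr0.
  move/eqP; rewrite -(dvdn_pcharf charF3) => /dvdn_leq; move/(_ isT).
  by have := prime_gt1 pr_p; case: (p) => [|[|[|k]]].
case: not2; split=> //; exists g0 => //; apply/eqP=> /(congr1 GLval).
rewrite GLvalM E0 sl3_uM GLval1 => /sl3_u_inj0[_ _].
have Db : b0 = a0 by apply/eqP; rewrite eq_sym -subr_eq0 z'.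
have -> : c0 + b0 * a0 + c0 = a0 * a0 + c0 * 2%:R by rewrite Db; ring.
rewrite (pcharf0 (p := 2)) -?{1}p2 ?charF3 // mulr0 addr0 => /eqP.
by rewrite mulf_eq0 orbb (negPf na).
Qed.

(** With t = t' a root of X^3 + s X - 1, the trace of u t determines a + y b and,
    if a = b = 0, the trace of (u t)^-1 determines c. As #|P| > p, the kernel of
    a + y b on P contains a nontrivial matrix, which has a = b = 0 and serves to
    conjugate t'. *)
Lemma sl3_obstruction_u (y : F) : (p < #|P|)%N -> (p.-group P)%g -> y * y = 1 ->
    (forall g a b c, g \in P -> GLval g = sl3_u a b c ->
       a + y * b = 0 -> a = 0 /\ b = 0) ->
  twist_obstruction (f @* P)%G.
Proof.
move=> ltP pP y2 slope.
have ny : y != 0 by apply: contra_eq_neq y2 => ->; rewrite mul0r eq_sym oner_eq0.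
have [s noroot] := no_root_cubic F; pose l := - (y * s).
pose T := mx3 [:: [:: 0; 1; 0]; [:: 0; 0; y]; [:: y; l; 0]].
pose S := mx3 [:: [:: s; 0; y]; [:: 1; 0; 0]; [:: 0; y; 0]].
have yy (k a b : F) : a = b + k * (y * y - 1) -> a = b.
  by rewrite y2 subrr mulr0 addr0.
have TS : T *m S = 1%:M.
  apply/matrixP; apply: forall3; apply: forall3; rewrite !mxE sum3 !mxE /= ?/l;
    try by ring.
  - by apply: (yy 1); ring.
  by apply: (yy 1); ring.
have S2 : S = T *m T + s%:M.
  apply/matrixP; apply: forall3; apply: forall3; rewrite !mxE sum3 !mxE /= ?/l ?mulr1n ?mulr0n;
    try by ring.
  - by apply: (yy (- 1)); ring.
  - by apply: (yy s); ring.
  by apply: (yy s); ring.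
pose t := gl3 T; have Et : GLval t = T by exact: gl3E TS.
have EtV : GLval t^-1%g = S.
  by rewrite -[LHS]mul1mx -(mulmx1C TS) -mulmxA -Et -GLvalM mulgV GLval1 mulmx1.
have Ht : t \in H.
  by rewrite inE Et det3_entries /pm3 /= !mxE /=; apply/eqP/(yy 1); ring.
have trT : \tr T = 0 by rewrite /mxtrace sum3 !mxE /=; ring.
clearbody t; have [pC pC2] : (p^'.-group 'C[f t])%g /\ (p^'.-group 'C[f t * f t])%g.
  by apply: sl3_cent_p' noroot _; rewrite // EtV Et.
have EV (g : {'GL_3[F]}) a b c : GLval g = sl3_u a b c -> GLval g^-1%g = sl3_u (- a) (- b) (a * b - c).
  move=> E; rewrite -[LHS]mulmx1.
  have <- : sl3_u a b c *m sl3_u (- a) (- b) (a * b - c) = 1%:M.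
    by rewrite sl3_uM -sl3_u1; congr sl3_u; ring.
  by rewrite -E mulmxA -GLvalM mulVg GLval1 mul1mx.
have isol u : u \in (f @* P)%g -> (u * f t)%g \in (f t ^: [set: gT])%g -> u = 1%g.
  case/morphimP=> g Hg Pg ->; rewrite -morphM //.
  case/(injm_class_tr surj_f inj_f Ht (groupM Hg Ht)).
  have [a [b [c E]]] := ofP Pg.
  rewrite invMg !GLvalM Et EtV (EV _ _ _ _ E) E trT => tr1 tr2.
  have [a0 b0] : a = 0 /\ b = 0.
    by apply: slope E _ => //; rewrite -[RHS]tr1 /mxtrace !sum3 !mxE !sum3 !mxE /=; ring.
  have c0 : c = 0.
    apply: (mulIf ny); rewrite mul0r; apply: oppr_inj; rewrite oppr0.
    apply: (addrI (\tr S)); rewrite addr0 -[RHS]tr2 a0 b0 /mxtrace !sum3 !mxE !sum3 !mxE /=; ring.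
  by rewrite (_ : g = 1%g) ?morph1 //; apply: GLval_inj; rewrite E a0 b0 c0 sl3_u1.
have [g [c [Pg Eg nc]]] : exists g c, [/\ g \in P, GLval g = sl3_u 0 0 c & c != 0].
  pose k (g : {'GL_3[F]}) := GLval g (ord3 1) (ord3 0) + y * GLval g (ord3 2) (ord3 1).
  have : ~ {in P &, injective k}.
    by move=> /card_in_imset E; have := max_card (mem (k @: P)); rewrite E cardF leqNgt ltP.
  move=> ninj; apply: contrapT => none; apply: ninj => g h Pg Ph kgh.
  have [a [b [c Eg]]] := ofP Pg; have [a' [b' [c' Eh]]] := ofP Ph.
  rewrite /k Eg Eh !mxE /= in kgh.
  have Egh : GLval (g * h^-1)%g = sl3_u (a - a') (b - b') (c + b * - a' + (a' * b' - c')).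
    by rewrite GLvalM Eg (EV _ _ _ _ Eh) sl3_uM.
  have [|a0 b0] := slope _ _ _ _ (groupM Pg (groupVr Ph)) Egh.
    by transitivity ((a + y * b) - (a' + y * b')); [ring | rewrite kgh subrr].
  set d := c + _ + _ in Egh; rewrite a0 b0 in Egh.
  have d0 : d = 0.
    apply/eqP/negPn/negP=> nd; apply: none; exists (g * h^-1)%g, d.
    by split; rewrite ?groupM ?groupV.
  apply/eqP; rewrite eq_mulgV1; apply/eqP/GLval_inj.
  by rewrite Egh d0 sl3_u1.
exists p, (f t), (f t), (f g); split=> //; first by rewrite /= morphim_pgroup.
have Hg := subsetP sPH _ Pg; split; first by rewrite /= mem_morphim.
rewrite -morphJ // -!morphM ?groupJ //; apply/negP.
case/(injm_class_tr surj_f inj_f (groupM Ht Ht) (groupM Ht (groupJ Ht Hg))) => _.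
rewrite conjgE !invMg !GLvalM invgK EtV Eg (EV _ _ _ _ Eg) => E.
have : (c * y) ^+ 2 = 0.
  apply: oppr_inj; rewrite oppr0; apply: (addrI (\tr (S *m S))).
  rewrite addr0 -[RHS]E /mxtrace !sum3 !mxE !sum3 !mxE /= !sum3 !mxE /= !sum3 !mxE /=; ring.
by move/eqP; rewrite expf_eq0 mulf_eq0 /= (negPf nc) (negPf ny).
Qed.
End Unitriangular.

Theorem sl3_twist_obstruction (M : {group gT}) :
  M :!=: 1%g -> abelian M -> central_type M -> (p.-group M)%g -> twist_obstruction M.
Proof.
move=> ntM abM ctM pM; have [P [sPH pP fP]] := morph_pgroup_lift surj_f pM.
have [h Hh ofP] := sl3_pgroup_conj sPH pP.
apply: (@twist_obstructionJ _ _ (f h)).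
have -> : (M :^ f h)%G = (f @* (P :^ h))%G.
  by apply/val_inj; rewrite /= morphimJ // fP.
have sPhH : (P :^ h \subset H)%g by rewrite -(conjGid Hh) conjSg.
have abP : abelian (P :^ h)%G by rewrite /= abelianJ -(injm_abelian inj_f sPH) fP.
have ltP : (p < #|(P :^ h)%G|)%N.
  rewrite cardJg -(card_injm inj_f sPH) fP.
  have pdM : (p %| #|M|)%N by have [] := pgroup_pdiv pM ntM.
  apply: leq_trans (central_type_prime_square ctM pr_p pdM).
  by rewrite -[X in (X < _)%N]muln1 ltn_pmul2l ?prime_gt0 ?prime_gt1.
have ct' : central_type (f @* (P :^ h))%G.
  have := central_typeJ (f h) ctM; congr (central_type _).
  by apply/val_inj; rewrite /= morphimJ // fP.
have [|y y2 slope] := sl3_abelian_slope abP ofP; last first.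
  by apply: sl3_obstruction_u sPhH ofP _ ltP _ y2 slope; rewrite /= pgroupJ.
(* Over the field with two elements, all elements of order 4 have the same
   square, which no group of central type with such elements allows. *)
case=> p2 [g Pg g2]; have two : 2%:R = 0 :> F by rewrite -p2 (pcharf0 charF3).
have [||u [v [Mu Mv u2 v2 uv]]] := central_type_squares ct' (x := f g) _ _.
- by rewrite /= mem_morphim // (subsetP sPhH).
- by rewrite -morphM ?(subsetP sPhH) // morph_injm_eq1 ?groupM ?(subsetP sPhH).
have sq w : w \in (f @* (P :^ h))%g -> (w * w != 1)%g ->
    exists2 k, k \in H & w = f k /\ GLval (k * k)%g = sl3_u 0 0 1.
  case/morphimP=> k Hk Pk ->; rewrite -morphM // morph_injm_eq1 ?groupM // => k2.
  exists k => //; split=> //; have [a [b [c E]]] := ofP k Pk.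
  have Ek : GLval (k * k)%g = sl3_u 0 0 (b * a).
    rewrite GLvalM E sl3_uM; congr sl3_u; last 1 first.
    - by rewrite -[RHS]addr0 -(mul0r c) -two; ring.
    - by rewrite -(mul0r a) -two; ring.
    by rewrite -(mul0r b) -two; ring.
  rewrite Ek; congr sl3_u; have := expf_card (b * a); rewrite cardF p2 expr2 => /eqP.
  rewrite -subr_eq0 -[X in _ - X]mulr1 -mulrBr mulf_eq0 => /orP[/eqP z|].
    by case/eqP: k2; apply: GLval_inj; rewrite Ek z sl3_u1.
  by rewrite subr_eq0 => /eqP.
have [ku Hu [Du Eu]] := sq u Mu u2; have [kv Hv [Dv Ev]] := sq v Mv v2.
case/eqP: uv; rewrite Du Dv -!morphM //; congr (f _).
by apply: GLval_inj; rewrite Eu Ev.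
Qed.

End SL3.

(** * PSL2 *)

Notation ord2 k := (@Ordinal 2 k isT).

Lemma sum2 (V : nmodType) (E : 'I_2 -> V) : \sum_i E i = E (ord2 0) + E (ord2 1).
Proof.
rewrite !big_ord_recr big_ord0 /= add0r; congr (_ + _);
by congr E; apply: val_inj.
Qed.

Lemma forall2 (P : 'I_2 -> Prop) : P (ord2 0) -> P (ord2 1) -> forall i, P i.
Proof.
move=> P0 P1 [[|[|i]] lti] //.
- by rewrite (_ : Ordinal lti = ord2 0) //; apply: val_inj.
by rewrite (_ : Ordinal lti = ord2 1) //; apply: val_inj.
Qed.

Section SL2.
Variable F : finFieldType.
Local Notation H := (SLn_group 2 F).

(** The tactic ring then checks that u = v is k times a known equation, or a
    combination of two such equations. *)
Lemma eq_lin (k x y u v : F) : x = y -> u - v = k * (x - y) -> u = v.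
Proof. by move=> ->; rewrite subrr mulr0 => /eqP; rewrite subr_eq0 => /eqP. Qed.

Lemma eq_lin2 (k l x y x' y' u v : F) : x = y -> x' = y' ->
  u - v = k * (x - y) + l * (x' - y') -> u = v.
Proof. by move=> -> ->; rewrite !subrr !mulr0 addr0 => /eqP; rewrite subr_eq0 => /eqP. Qed.

Lemma sqr_eq1 (x : F) : x * x = 1 -> x = 1 \/ x = -1.
Proof.
move=> x2; have /eqP : (x - 1) * (x + 1) = 0 by apply: (eq_lin (k := 1) x2); ring.
rewrite mulf_eq0 subr_eq0 addr_eq0 => /orP[] /eqP; by [left | right].
Qed.

Definition mx2 (a b c d : F) : 'M[F]_2 :=
  \matrix_(i, k) (nth [::] [:: [:: a; b]; [:: c; d]] i)`_k.

Lemma mx2_eta (A : 'M[F]_2) : A = mx2 (A (ord2 0) (ord2 0)) (A (ord2 0) (ord2 1))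
  (A (ord2 1) (ord2 0)) (A (ord2 1) (ord2 1)).
Proof. by apply/matrixP; apply: forall2; apply: forall2; rewrite mxE. Qed.

Lemma mx2M a b c d a' b' c' d' : mx2 a b c d *m mx2 a' b' c' d' =
  mx2 (a * a' + b * c') (a * b' + b * d') (c * a' + d * c') (c * b' + d * d').
Proof. by apply/matrixP; apply: forall2; apply: forall2; rewrite !mxE sum2 !mxE. Qed.

Lemma mx2_scalar a : a%:M = mx2 a 0 0 a.
Proof. by apply/matrixP; apply: forall2; apply: forall2; rewrite !mxE. Qed.

Lemma mx2Z k a b c d : k *: mx2 a b c d = mx2 (k * a) (k * b) (k * c) (k * d).
Proof. by apply/matrixP; apply: forall2; apply: forall2; rewrite !mxE. Qed.

Lemma mx2_inj a b c d a' b' c' d' : mx2 a b c d = mx2 a' b' c' d' ->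
  [/\ a = a', b = b', c = c' & d = d'].
Proof.
move=> /matrixP E; move: (E (ord2 0) (ord2 0)) (E (ord2 0) (ord2 1))
  (E (ord2 1) (ord2 0)) (E (ord2 1) (ord2 1)).
by rewrite !mxE.
Qed.

Lemma tr_mx2 a b c d : \tr (mx2 a b c d) = a + d.
Proof. by rewrite /mxtrace sum2 !mxE. Qed.

Lemma det_mx2 a b c d : \det (mx2 a b c d) = a * d - b * c.
Proof.
rewrite (expand_det_row _ ord0) !big_ord_recl big_ord0 /cofactor !det_mx11 !mxE /=.
by rewrite expr0 expr1; ring.
Qed.

Definition gl2 (A : 'M[F]_2) : {'GL_2[F]} := insubd (1%g : {'GL_2[F]}) A.

Lemma gl2E A : \det A = 1 -> GLval (gl2 A) = A.
Proof. by move=> dA; rewrite /gl2 val_insubd unitmxE dA unitr1. Qed.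

Lemma mem_gl2 A : \det A = 1 -> gl2 A \in H.
Proof. by move=> dA; rewrite inE gl2E // dA. Qed.

Lemma sl2E g : g \in H -> exists a b c d, GLval g = mx2 a b c d /\ a * d - b * c = 1.
Proof.
rewrite inE [GLval g]mx2_eta det_mx2 => /eqP dg.
by do 4!eexists; split; [reflexivity|].
Qed.

Lemma sl2V (g : {'GL_2[F]}) a b c d : a * d - b * c = 1 -> GLval g = mx2 a b c d ->
  GLval g^-1%g = mx2 d (- b) (- c) a.
Proof.
move=> dg E; rewrite -[LHS]mulmx1.
have <- : mx2 a b c d *m mx2 d (- b) (- c) a = 1%:M.
  by rewrite mx2M mx2_scalar -dg; congr mx2; ring.
by rewrite -E mulmxA -GLvalM mulVg GLval1 mul1mx.
Qed.

Lemma sl2_center z : z \in 'Z(SLn 2 F)%g ->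
  exists2 e : F, e * e = 1 & GLval z = e%:M.
Proof.
case/setIP=> Hz /centP cz; have [a [b [c [d [Ez dz]]]]] := sl2E Hz.
have d1 : \det (mx2 1 1 0 1) = 1 by rewrite det_mx2; ring.
have d2 : \det (mx2 1 0 1 1) = 1 by rewrite det_mx2; ring.
have /(congr1 GLval) := cz _ (mem_gl2 d1); have /(congr1 GLval) := cz _ (mem_gl2 d2).
rewrite !GLvalM !gl2E // Ez !mx2M => /mx2_inj[e1 e2 e3 e4] /mx2_inj[e5 e6 e7 e8].
have b0 : b = 0 by apply: (eq_lin (k := 1) e1); ring.
have c0 : c = 0 by apply: (eq_lin (k := - 1) e5); ring.
have ad : a = d by apply: (eq_lin (k := 1) e6); ring.
rewrite b0 c0 -ad in Ez dz *; exists a; last by rewrite mx2_scalar.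
by apply: (eq_lin (k := 1) dz); ring.
Qed.

Lemma mem_sl2_center z e : z \in H -> GLval z = e%:M -> z \in 'Z(SLn 2 F)%g.
Proof.
move=> Hz Ez; apply/setIP; split=> //; apply/centP=> g _.
by apply: GLval_inj; rewrite !GLvalM Ez mul_mx_scalar mul_scalar_mx.
Qed.

(** What commutes with a nontrivial unipotent matrix acts by the same scalar on
    its fixed line and on the quotient, so its discriminant tr^2 - 4 vanishes. *)
Lemma sl2_unipotent_comm g A : g \in H -> A \in H -> commute g A -> g != 1%g ->
  (exists2 v : 'rV[F]_2, v != 0 & v *m GLval g = v) -> \tr (GLval A) ^+ 2 = 4%:R.
Proof.
move=> Hg HA cgA n1 [v nzv vg].
have [g1 [g2 [g3 [g4 [Eg dg]]]]] := sl2E Hg; have [a [b [c [d [EA dA]]]]] := sl2E HA.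
have dN : \det (GLval g - 1%:M) = 0.
  by apply/eqP/det0P; exists v; rewrite // mulmxBr mulmx1 vg subrr.
have {}dN : (g1 - 1) * (g4 - 1) - g2 * g3 = 0.
  rewrite -[RHS]dN Eg mx2_scalar (_ : _ - _ = mx2 (g1 - 1) g2 g3 (g4 - 1)) ?det_mx2 //.
  by apply/matrixP; apply: forall2; apply: forall2; rewrite !mxE /= ?subr0.
have tg : g4 - 1 = - (g1 - 1) by apply: (eq_lin2 (k := 1) (l := - 1) dg dN); ring.
have n2 : (g1 - 1) ^+ 2 = - (g2 * g3).
  by apply: (eq_lin2 (k := - 1) (l := g1 - 1) dN tg); ring.
have /(congr1 GLval) := cgA.
rewrite !GLvalM Eg EA !mx2M => /mx2_inj[e1 e2 e3 e4].
have c1 : g2 * c = b * g3 by apply: (eq_lin (k := 1) e1); ring.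
have c2 : g2 * (d - a) = - (2%:R * (g1 - 1) * b).
  by apply: (eq_lin2 (k := 1) (l := b) e2 tg); ring.
have c3 : g3 * (d - a) = - (2%:R * (g1 - 1) * c).
  by apply: (eq_lin2 (k := - 1) (l := c) e3 tg); ring.
rewrite tr_mx2; apply/eqP; rewrite -subr_eq0.
have -> : (a + d) ^+ 2 - 4%:R = (d - a) ^+ 2 + 4%:R * (b * c).
  by apply: (eq_lin (k := 4%:R) dA); ring.
set D := _ + _.
have Dg2 : g2 ^+ 2 * D = 0.
  transitivity ((g2 * (d - a)) ^+ 2 + 4%:R * (g2 * b) * (g2 * c)); first by rewrite /D; ring.
  by rewrite c2 c1; apply: (eq_lin (k := 4%:R * b ^+ 2) n2); ring.
have Dg3 : g3 ^+ 2 * D = 0.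
  transitivity ((g3 * (d - a)) ^+ 2 + 4%:R * (b * g3) * (g3 * c)); first by rewrite /D; ring.
  by rewrite c3 -c1; apply: (eq_lin (k := 4%:R * c ^+ 2) n2); ring.
move/eqP: Dg2; rewrite mulf_eq0 expf_eq0 /= => /orP[/eqP g20|//].
move/eqP: Dg3; rewrite mulf_eq0 expf_eq0 /= => /orP[/eqP g30|//].
move/eqP: n2; rewrite g20 mul0r oppr0 expf_eq0 /= subr_eq0 => /eqP g11.
case/eqP: n1; apply: GLval_inj; rewrite Eg g20 g30 g11 GLval1 mx2_scalar.
by congr mx2; move/eqP: tg; rewrite g11 subrr oppr0 subr_eq0 => /eqP.
Qed.

Section Projective.
Variables (p : nat) (gT : finGroupType) (f : {morphism H >-> gT}).
Hypotheses (charF : p \in [pchar F]) (surj_f : (f @* H)%g = [set: gT]).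
Hypothesis ker_f : ('ker f = 'Z(SLn 2 F))%g.

Lemma psl2_ker z : z \in ('ker f)%g -> exists2 e : F, e * e = 1 & GLval z = e%:M.
Proof. by rewrite ker_f => /sl2_center. Qed.

Lemma psl2_scalar z e : z \in H -> GLval z = e%:M -> f z = 1%g.
Proof. by move=> Hz Ez; apply/(kerP f Hz); rewrite ker_f; apply: mem_sl2_center Ez. Qed.

Lemma psl2_class A B : A \in H -> B \in H -> f B \in (f A ^: [set: gT])%g ->
  exists g e, [/\ g \in H, e = 1 \/ e = -1 & GLval B = e *: GLval (A ^ g)%g].
Proof.
move=> HA HB /(morph_class surj_f HA HB)[g [z [Hg /psl2_ker[e /sqr_eq1 e2 Ez] ->]]].
by exists g, e; rewrite GLvalM Ez mul_mx_scalar.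
Qed.

Lemma psl2_class_tr A B : A \in H -> B \in H -> f B \in (f A ^: [set: gT])%g ->
  \tr (GLval B) = \tr (GLval A) \/ \tr (GLval B) = - \tr (GLval A).
Proof.
move=> HA HB /(psl2_class HA HB)[g [e [Hg e2 ->]]]; rewrite mxtraceZ.
have -> : \tr (GLval (A ^ g)%g) = \tr (GLval A).
  by rewrite conjgE !GLvalM mxtrace_mulC -mulmxA -GLvalM mulgV GLval1 mulmx1.
by case: e2 => ->; rewrite ?mul1r ?mulN1r; [left | right].
Qed.

Lemma psl2_comm g A : g \in H -> A \in H ->
    (g * A * g^-1 * A^-1)%g \in ('ker f)%g ->
  exists2 e, e = 1 \/ e = -1 & GLval (g * A)%g = e *: GLval (A * g)%g.
Proof.
move=> Hg HA /psl2_ker[e /sqr_eq1 e2 Ez]; exists e => //.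
have -> : (g * A = (g * A * g^-1 * A^-1) * (A * g))%g by rewrite mulgA !mulgKV.
by rewrite GLvalM Ez mul_scalar_mx.
Qed.

(** If g A = - A g for an element g of odd order p^k, then g, a power of
    g ^ 2, commutes with A after all. *)
Lemma psl2_cent_p' A : A \in H -> \tr (GLval A) ^+ 2 != 4%:R ->
  (p^'.-group 'C[f A])%g.
Proof.
have pr_p : prime p := pcharf_prime charF.
move=> HA trA; apply: (morph_cent1_pgroup surj_f) => // g Hg pg /(psl2_comm Hg HA).
case=> e e1 E; apply/eqP; apply: contraT => nfg.
have n1 : g != 1%g by apply: contraNneq nfg => ->; rewrite morph1.
have cgA : commute g A.
  have [e_eq1|ne] := eqVneq e 1.
    by apply: GLval_inj; rewrite E e_eq1 scale1r.
  have eN : e = -1 by case: e1 ne => // ->; rewrite eqxx.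
  have c2 : commute (g ^+ 2)%g A.
    apply: GLval_inj; rewrite expgS expg1 -mulgA GLvalM E eN scaleN1r mulmxN.
    by rewrite -GLvalM mulgA GLvalM E eN scaleN1r mulNmx opprK -GLvalM mulgA.
  have odd_p : odd p.
    apply: contraNT ne; rewrite eN => /(prime_oddPn pr_p) p2.
    by rewrite -subr_eq0 -opprD oppr_eq0 -[1 + 1]/(2%:R) -p2 (pcharf0 charF).
  have [k ok] := p_natP pg.
  have -> : g = ((g ^+ 2) ^+ (#[g]%g.+1./2))%g.
    rewrite -expgM mul2n (_ : (#[g]%g.+1./2.*2 = #[g]%g.+1)%N).
      by rewrite expgSr expg_order mul1g.
    by rewrite -[RHS]odd_double_half /= ok oddX odd_p orbT.
  exact/commute_sym/commuteX/commute_sym.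
case/eqP: trA; apply: (sl2_unipotent_comm Hg HA cgA n1).
have pG : (p.-group <[g]>)%g by [].
have [v nzv fixv] := pgroup_fixes_row charF pG.
by exists v => //; apply: fixv; apply: cycle_id.
Qed.

End Projective.
End SL2.

Lemma poly_nonroot (F : finFieldType) (S : {set F}) (q : {poly F}) :
  q != 0 -> (size q <= #|S|)%N -> exists2 x, x \in S & q.[x] != 0.
Proof.
move=> nzq szS; apply: contrapT => none.
have /(max_poly_roots nzq) : all (root q) (enum S).
  apply/allP=> x; rewrite mem_enum => Sx; apply: contrapT => nr; apply: none.
  by exists x => //; apply/negP.
by move/(_ (enum_uniq _)); rewrite -cardE ltnNge szS.
Qed.

Section PSL2.
Variables (F : finFieldType) (p : nat) (gT : finGroupType).
Local Notation H := (SLn_group 2 F).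
Variable f : {morphism H >-> gT}.
Hypotheses (charF : p \in [pchar F]) (surj_f : (f @* H)%g = [set: gT]).
Hypothesis ker_f : ('ker f = 'Z(SLn 2 F))%g.
Local Notation low s := (mx2 1 0 s 1).

Lemma psl2_prime : prime p. Proof. exact: pcharf_prime charF. Qed.
Lemma psl2_char0 : p%:R = 0 :> F. Proof. exact: pcharf0 charF. Qed.

Lemma psl2_odd_nz2 : p != 2 -> 2%:R != 0 :> F.
Proof.
move=> p2; rewrite -(dvdn_pcharf charF); apply: contra p2 => /dvdn_leq.
by move/(_ isT); have := prime_gt1 psl2_prime; case: (p) => [|[|[|k]]].
Qed.

Lemma lowM (s s' : F) : low s *m low s' = low (s + s').
Proof. by rewrite mx2M; congr mx2; ring. Qed.

Lemma det_low (s : F) : \det (low s) = 1.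
Proof. by rewrite det_mx2; ring. Qed.

Lemma low_expn (g : {'GL_2[F]}) (s : F) k :
  GLval g = low s -> GLval (g ^+ k)%g = low (k%:R * s).
Proof.
move=> E; elim: k => [|k IHk]; first by rewrite mul0r GLval1 mx2_scalar.
by rewrite expgS GLvalM E IHk lowM mulrS; congr mx2; ring.
Qed.

Lemma low_p_elt (g : {'GL_2[F]}) s : GLval g = low s -> (p.-elt g)%g.
Proof.
move=> E; rewrite /p_elt (@pnat_dvd _ p) ?pnat_id ?psl2_prime //.
rewrite order_dvdn; apply/eqP/GLval_inj; rewrite (low_expn p E) psl2_char0.
by rewrite mul0r GLval1 mx2_scalar.
Qed.

(** Such a g is 1 + N with N ^ 2 = 0. *)
Lemma sl2_row_fixed_expn (g : {'GL_2[F]}) (v : 'rV[F]_2) :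
  g \in H -> v != 0 -> v *m GLval g = v -> (g ^+ p = 1)%g.
Proof.
move=> Hg nzv vg; have [a [b [c [d [Eg dg]]]]] := sl2E Hg.
have dN : \det (GLval g - 1%:M) = 0.
  by apply/eqP/det0P; exists v; rewrite // mulmxBr mulmx1 vg subrr.
have EN : GLval g - 1%:M = mx2 (a - 1) b c (d - 1).
  by apply/matrixP; apply: forall2; apply: forall2; rewrite Eg !mxE /= ?subr0.
rewrite EN det_mx2 in dN.
have td : d - 1 = - (a - 1) by apply: (eq_lin2 (k := 1) (l := - 1) dg dN); ring.
have NN : (GLval g - 1%:M) *m (GLval g - 1%:M) = 0.
  rewrite EN mx2M td; have e : (a - 1) * (a - 1) + b * c = 0.
    by apply: (eq_lin2 (k := - 1) (l := a - 1) dN td); ring.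
  apply/matrixP; apply: forall2; apply: forall2; rewrite !mxE /=; try by ring.
    exact: e.
  by rewrite -e; ring.
set N := GLval g - 1%:M in NN.
have gN : GLval g = 1%:M + N by rewrite /N addrC subrK.
apply: GLval_inj; rewrite GLval1.
have -> : GLval (g ^+ p)%g = 1%:M + p%:R *: N.
  elim: (p) => [|k IHk]; first by rewrite scale0r addr0.
  rewrite expgS GLvalM IHk gN mulmxDl !mulmxDr !mulmx1 mul1mx -scalemxAr NN.
  by rewrite scaler0 addr0 mulrS scalerDl scale1r -addrA [_ *: N + N]addrC.
by rewrite psl2_char0 scale0r addr0.
Qed.

Lemma psl2_ker_2group : (2.-group ('ker f))%g.
Proof.
apply/pgroupP=> l pr_l /(Cauchy pr_l)[z Kz oz]; rewrite inE /=.
have [e e2 Ez] := psl2_ker ker_f Kz; rewrite -(dvdn_prime2 pr_l) // -oz order_dvdn.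
apply/eqP/GLval_inj; rewrite expgS expg1 GLvalM Ez mul_scalar_mx scale_scalar_mx.
by rewrite e2 GLval1.
Qed.

(** For l odd, the l-element with a fixed row has order p. *)
Lemma psl2_central_type_primes (M : {group gT}) l : abelian M -> central_type M ->
  prime l -> (l %| #|M|)%N -> l = 2%N \/ l = p.
Proof.
move=> abM ctM pr_l lM; have [->|l2] := eqVneq l 2%N; first by left.
right; have l'ker : (l^'.-group ('ker f))%g.
  apply: sub_pgroup psl2_ker_2group => q; rewrite !inE => /eqP->.
  by rewrite eq_sym.
have [g [Hg lg n1 [v nzv vg]]] := central_type_fixes_row surj_f l'ker pr_l abM ctM lM.
have [k ok] := p_natP lg.
have : (#[g]%g %| p)%N by rewrite order_dvdn (sl2_row_fixed_expn Hg nzv vg).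
rewrite ok; case: k ok => [|k] ok; first by rewrite -order_eq1 ok eqxx in n1.
move=> lp; apply/eqP; rewrite -dvdn_prime2 ?psl2_prime //.
by apply: dvdn_trans lp; rewrite expnS dvdn_mulr.
Qed.

Section DefiningCharacteristic.
Variable P : {group {'GL_2[F]}}.
Hypotheses (sPH : P \subset H) (pP : (p.-group P)%g).
Hypothesis ofP : forall g, g \in P -> exists s, GLval g = low s.

Let slope (g : {'GL_2[F]}) := GLval g (ord2 1) (ord2 0).

Lemma low_slope g : g \in P -> GLval g = low (slope g).
Proof. by case/ofP=> s E; rewrite /slope E !mxE. Qed.

Lemma slope_inj : {in P &, injective slope}.
Proof.
by move=> g h Pg Ph e; apply: GLval_inj; rewrite !low_slope // e.
Qed.

Lemma psl2_low_isol A :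
    A \in H -> (forall s, \tr (low s *m GLval A) = \tr (GLval A) \/
      \tr (low s *m GLval A) = - \tr (GLval A) -> s = 0) ->
  forall u, u \in (f @* P)%g -> (u * f A)%g \in (f A ^: [set: gT])%g -> u = 1%g.
Proof.
move=> HA trA u /morphimP[g Hg Pg ->]; rewrite -morphM //.
move/(psl2_class_tr surj_f ker_f HA (groupM Hg HA)).
rewrite GLvalM (low_slope Pg) => /trA s0.
by rewrite (_ : g = 1%g) ?morph1 //; apply: GLval_inj; rewrite low_slope // s0 GLval1 mx2_scalar.
Qed.

Lemma psl2_low_obstruction A B g :
    A \in H -> B \in H -> g \in P ->
    (forall s, \tr (low s *m GLval A) = \tr (GLval A) \/
      \tr (low s *m GLval A) = - \tr (GLval A) -> s = 0) ->
    (forall s, \tr (low s *m GLval B) = \tr (GLval B) \/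
      \tr (low s *m GLval B) = - \tr (GLval B) -> s = 0) ->
    \tr (GLval A) ^+ 2 != 4%:R -> \tr (GLval B) ^+ 2 != 4%:R ->
    \tr (GLval A *m GLval B) ^+ 2 != 4%:R ->
    let c := \tr (GLval A *m (low (- slope g) *m (GLval B *m low (slope g)))) in
    c != \tr (GLval A *m GLval B) -> c != - \tr (GLval A *m GLval B) ->
  twist_obstruction (f @* P)%G.
Proof.
move=> HA HB Pg isA isB tA tB tAB c c1 c2; have Hg := subsetP sPH _ Pg.
have HAB := groupM HA HB.
exists p, (f A), (f B), (f g); split.
- by rewrite psl2_prime /= morphim_pgroup.
- rewrite -morphM //; split; exact: (psl2_cent_p' charF surj_f ker_f).
- exact: psl2_low_isol.
- exact: psl2_low_isol.
split; first by rewrite /= mem_morphim.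
rewrite -morphJ // -!morphM ?groupJ //; apply/negP.
case/(psl2_class_tr surj_f ker_f HAB (groupM HA (groupJ HB Hg))); rewrite conjgE !GLvalM.
  rewrite (sl2V _ (low_slope Pg)); last by ring.
  by rewrite oppr0 (low_slope Pg) => /eqP; rewrite -/c (negPf c1).
rewrite (sl2V _ (low_slope Pg)); last by ring.
by rewrite oppr0 (low_slope Pg) => /eqP; rewrite -/c (negPf c2).
Qed.

(** With t = t' of order 3 and u of slope s, the traces of t, u t, t ^ 2 and
    t t^u are 1, 1 + s, 1 and 1 + s ^ 2. *)
Lemma psl2_low_even : p = 2%N -> P :!=: 1%g -> twist_obstruction (f @* P)%G.
Proof.
move=> p2 ntP; have two : 2%:R = 0 :> F by rewrite -p2 psl2_char0.
have [g Pg n1] : exists2 g, g \in P & g != 1%g by apply/trivgPn.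
have ns : slope g != 0.
  by apply: contraNneq n1 => s0; apply/eqP/GLval_inj; rewrite low_slope // s0 GLval1 mx2_scalar.
have par (k x y : F) : x = y + 2%:R * k -> x = y by rewrite two mul0r addr0.
have dA : \det (mx2 (1 : F) 1 1 0) = 1 by rewrite det_mx2; apply: (par (- 1)); ring.
have HA := mem_gl2 dA.
have isA (s : F) : \tr (low s *m GLval (gl2 (mx2 (1 : F) 1 1 0))) = \tr (GLval (gl2 (mx2 (1 : F) 1 1 0))) \/
    \tr (low s *m GLval (gl2 (mx2 (1 : F) 1 1 0))) = - \tr (GLval (gl2 (mx2 (1 : F) 1 1 0))) -> s = 0.
  rewrite !gl2E // mx2M !tr_mx2 => -[] e; first by apply: (eq_lin (k := 1) e); ring.
  by apply: (par (- 1)); apply: (eq_lin (k := 1) e); ring.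
apply: (psl2_low_obstruction (g := g) HA HA) => //; rewrite !gl2E // ?mx2M !tr_mx2.
- apply/eqP=> e; move/eqP: (oner_neq0 F); apply.
  by apply: (par 2%:R); apply: (eq_lin (k := 1) e); ring.
- apply/eqP=> e; move/eqP: (oner_neq0 F); apply.
  by apply: (par 2%:R); apply: (eq_lin (k := 1) e); ring.
- apply/eqP=> e; move/eqP: (oner_neq0 F); apply.
  by apply: (par (- 2%:R)); apply: (eq_lin (k := 1) e); ring.
- apply: contraNneq ns => e; rewrite -[slope g == 0]orbb -mulf_eq0; apply/eqP.
  by apply: (eq_lin (k := - 1) e); ring.
apply: contraNneq ns => e; rewrite -[slope g == 0]orbb -mulf_eq0; apply/eqP.
by apply: (par 3%:R); apply: (eq_lin (k := - 1) e); ring.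
Qed.

(** With t = [0 1; -1 0] and t' = [0 z; -1/z 0], the traces of u t and u t' are s
    and s z, and those of t t' and t t'^u are -(z + 1/z) and -(z + 1/z) - s^2 z.
    The bound on P leaves room for z outside 0, 1, -1, and for a slope s outside
    0 and the square roots of - 2 (z + 1/z) / z. *)
Lemma psl2_low_odd : odd p -> (p * p <= #|P|)%N -> twist_obstruction (f @* P)%G.
Proof.
move=> odd_p leP; have p3 : (2 < p)%N.
  by have := prime_gt1 psl2_prime; move: odd_p; case: (p) => [|[|[|k]]].
have cardK : #|slope @: P| = #|P| by apply: card_in_imset slope_inj.
have le9 : (9 <= #|slope @: P|)%N by rewrite cardK; apply: leq_trans leP; apply: (@leq_mul 3 3).
have nz2 : 2%:R != 0 :> F by apply: psl2_odd_nz2; apply: contraTneq p3 => ->.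
have leF : (4 <= #|[set: F]|)%N.
  by rewrite (leq_trans _ (subset_leq_card (subsetT (slope @: P)))) // (leq_trans _ le9).
have size3 (d : F) : size (('X^2 - d%:P) * 'X) = 4%N.
  by rewrite size_mulX ?size_XnsubC // -size_poly_eq0 size_XnsubC.
have nz3 (d : F) : ('X^2 - d%:P) * 'X != 0 by rewrite -size_poly_eq0 size3.
have [z _] : exists2 z, z \in [set: F] & (('X^2 - 1%:P) * 'X).[z] != 0.
  by apply: poly_nonroot; rewrite ?size3.
rewrite !hornerE mulf_eq0 negb_or subr_eq0 => /andP[z1 z0].
pose d := - 2%:R * (z + z^-1) / z.
have [_ /imsetP[g Pg ->]] : exists2 s, s \in slope @: P & (('X^2 - d%:P) * 'X).[s] != 0.
  by apply: poly_nonroot; rewrite ?size3 // (leq_trans _ le9).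
rewrite !hornerE mulf_eq0 negb_or subr_eq0 => /andP[sd s0].
have dA : \det (mx2 (0 : F) 1 (-1) 0) = 1 by rewrite det_mx2; ring.
have dB : \det (mx2 (0 : F) z (- z^-1) 0) = 1 by rewrite det_mx2; field.
have HA := mem_gl2 dA; have HB := mem_gl2 dB.
have nz4 : 4%:R != 0 :> F by rewrite (natrM _ 2 2) mulf_neq0.
apply: (psl2_low_obstruction (g := g) HA HB Pg); rewrite !gl2E // ?mx2M ?tr_mx2.
- by move=> s; rewrite mx2M !tr_mx2 => -[] e; apply: (eq_lin (k := 1) e); ring.
- move=> s; rewrite mx2M !tr_mx2 => -[] e; apply: (mulIf z0); apply: (eq_lin (k := 1) e); ring.
- by rewrite addr0 expr0n eq_sym.
- by rewrite addr0 expr0n eq_sym.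
- apply: contraNneq z1 => e; rewrite -subr_eq0 -[_ == 0]orbb -mulf_eq0; apply/eqP.
  by apply: (eq_lin (k := z ^+ 2) e); field.
- apply: contraNneq s0 => e; rewrite -[slope g == 0]orbb -mulf_eq0; apply/eqP.
  apply: (mulIf z0); apply: (eq_lin (k := - 1) e); by field.
apply: contraNneq sd => e; apply/eqP; apply: (mulIf z0); rewrite /d.
by apply: (eq_lin (k := - 1) e); field.
Qed.

End DefiningCharacteristic.

End PSL2.

(** * PSL2 in odd characteristic: four-groups *)

Section Klein.
Variables (F : finFieldType) (p : nat) (gT : finGroupType).
Local Notation H := (SLn_group 2 F).
Variable f : {morphism H >-> gT}.
Hypotheses (charF : p \in [pchar F]) (surj_f : (f @* H)%g = [set: gT]).
Hypothesis ker_f : ('ker f = 'Z(SLn 2 F))%g.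
Hypothesis odd_p : odd p.
Local Notation low s := (mx2 1 0 s 1).

Let nz2 : 2%:R != 0 :> F.
Proof. by apply: (psl2_odd_nz2 charF); apply: contraTneq odd_p => ->. Qed.

(** Elements of trace 0 are the lifts of involutions. *)
Definition traceless (W : {'GL_2[F]}) (a b c : F) :=
  [/\ W \in H, GLval W = mx2 a b c (- a) & a * a + b * c = -1].

Lemma sl2_traceless W : W \in H -> \tr (GLval W) = 0 ->
  exists a b c, traceless W a b c.
Proof.
move=> HW; have [a [b [c [d [EW dW]]]]] := sl2E HW; rewrite EW tr_mx2 => t0.
have Ed : d = - a by apply: (eq_lin (k := 1) t0); ring.
rewrite Ed in EW dW; exists a, b, c; split=> //.
by apply: (eq_lin (k := - 1) dW); ring.
Qed.

Lemma psl2_involution_lift W : W \in H -> f W != 1%g -> (f W * f W = 1)%g ->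
  exists a b c, traceless W a b c.
Proof.
move=> HW fW1 fW2; apply: sl2_traceless => //; apply: contraNeq fW1.
have : (W * W)%g \in ('ker f)%g by apply/kerP; rewrite ?groupM ?morphM.
move/(psl2_ker ker_f) => [e e2]; have [a [b [c [d [EW dW]]]]] := sl2E HW.
rewrite GLvalM EW tr_mx2 mx2M mx2_scalar => /mx2_inj[e1 e3 e4 e5] nt.
have b0 : b = 0 by apply: (mulIf nt); apply: (eq_lin (k := 1) e3); ring.
have c0 : c = 0 by apply: (mulIf nt); apply: (eq_lin (k := 1) e4); ring.
have da : d = a.
  by apply: (mulIf nt); apply: (eq_lin2 (k := - 1) (l := 1) e1 e5); ring.
apply/eqP/(psl2_scalar ker_f HW (e := a)).
by rewrite EW b0 c0 da mx2_scalar.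
Qed.

Lemma traceless_sqr W a b c : traceless W a b c -> GLval (W * W)%g = (-1)%:M.
Proof.
case=> _ E e; rewrite GLvalM E mx2M mx2_scalar.
by congr mx2; first [exact: e | rewrite -e; ring | ring].
Qed.

Lemma psl2_traceless_sqr W a b c : traceless W a b c -> (f W * f W = 1)%g.
Proof.
move=> tW; have [HW _ _] := tW; rewrite -morphM //.
exact: (psl2_scalar ker_f (groupM HW HW) (traceless_sqr tW)).
Qed.

(** In the quadratic space of traceless matrices, the cross product of N with
    A and with B vanishes while A is orthogonal to B, so N = 0. *)
Lemma sl2_klein_cent D A B a b c a' b' c' : D \in H ->
    traceless A a b c -> traceless B a' b' c' -> 2%:R * (a * a') + b * c' + c * b' = 0 ->
    commute D A -> commute D B -> f D = 1%g.
Proof.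
move=> HD [HA EA nA] [HB EB nB] orth cA cB.
have [x [q [r [y [ED dD]]]]] := sl2E HD.
move/(congr1 GLval): cA; move/(congr1 GLval): cB.
rewrite !GLvalM ED EA EB !mx2M => /mx2_inj[e1 e2 e3 e4] /mx2_inj[h1 h2 h3 h4].
pose N := x - y; pose beta := N * a' + q * c' + r * b'.
have p1 : q * c = b * r by apply: (eq_lin (k := 1) h1); ring.
have p2 : N * b = 2%:R * a * q by rewrite /N; apply: (eq_lin (k := 1) h2); ring.
have p3 : N * c = 2%:R * a * r by rewrite /N; apply: (eq_lin (k := - 1) h3); ring.
have q1 : q * c' = b' * r by apply: (eq_lin (k := 1) e1); ring.
have q2 : N * b' = 2%:R * a' * q by rewrite /N; apply: (eq_lin (k := 1) e2); ring.
have q3 : N * c' = 2%:R * a' * r by rewrite /N; apply: (eq_lin (k := - 1) e3); ring.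
have bb : b * beta = 0.
  transitivity (N * b * a' + b * (q * c') + (b * r) * b'); first by rewrite /beta; ring.
  by rewrite p2 -p1; apply: (eq_lin (k := q) orth); ring.
have cb : c * beta = 0.
  transitivity (N * c * a' + (q * c) * c' + r * c * b'); first by rewrite /beta; ring.
  by rewrite p3 p1; apply: (eq_lin (k := r) orth); ring.
have ab : 2%:R * a * beta = 0.
  transitivity (2%:R * a * a' * N + (2%:R * a * q) * c' + (2%:R * a * r) * b').
    by rewrite /beta; ring.
  by rewrite -p2 -p3; apply: (eq_lin (k := N) orth); ring.
have beta0 : beta = 0.
  apply: (mulfI nz2); rewrite mulr0.
  transitivity (- (a * (2%:R * a * beta) + 2%:R * b * (c * beta))).
    by apply: (eq_lin (k := 2%:R * beta) nA); ring.
  by rewrite ab cb; ring.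
have q0 : q = 0.
  apply: (mulfI nz2); rewrite mulr0; transitivity (- (2%:R * (a' * a' + b' * c') * q)).
    by rewrite nB; ring.
  transitivity (- b' * beta); last by rewrite beta0 mulr0.
  rewrite /beta; apply: (eq_lin2 (k := a') (l := - b') q2 q1); ring.
have r0 : r = 0.
  apply: (mulfI nz2); rewrite mulr0; transitivity (- (2%:R * (a' * a' + b' * c') * r)).
    by rewrite nB; ring.
  transitivity (- c' * beta); last by rewrite beta0 mulr0.
  rewrite /beta; apply: (eq_lin2 (k := a') (l := c') q3 q1); ring.
have N0 : N = 0.
  transitivity (- ((a' * a' + b' * c') * N)); first by rewrite nB; ring.
  transitivity (- (a' * beta)); last by rewrite beta0 mulr0 oppr0.
  rewrite /beta q0 r0; rewrite q0 in q2.
  by apply: (eq_lin (k := - c') q2); ring.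
apply: (psl2_scalar ker_f HD (e := x)); rewrite ED q0 r0 mx2_scalar.
by congr mx2; apply/eqP; rewrite eq_sym -subr_eq0 -/N N0.
Qed.

Lemma psl2_commute_lift D A : D \in H -> A \in H -> commute (f D) (f A) ->
  commute D A \/ GLval (D * A)%g = - GLval (A * D)%g.
Proof.
move=> HD HA cDA.
have [|e [-> | ->]] := @psl2_comm _ _ f ker_f D A HD HA.
- apply/kerP; rewrite ?groupM ?groupV // !morphM ?morphV ?groupM ?groupV //.
  by rewrite cDA mulgK mulgV.
- by rewrite scale1r => E; left; apply: GLval_inj.
by rewrite scaleN1r; right.
Qed.

(** Lifts A and B of two independent involutions of M anticommute. For every
    lift D of an element of M, one of D, D A, D B and D A B commutes with both A
    and B, hence is scalar. *)
Lemma psl2_klein (M : {group gT}) :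
    abelian M -> central_type M -> (2.-group M)%g -> M :!=: 1%g ->
  exists A B a b c a' b' c', [/\ traceless A a b c, traceless B a' b' c',
    2%:R * (a * a') + b * c' + c * b' = 0, f A \in M /\ f B \in M &
    forall u, u \in M -> [\/ u = 1, u = f A, u = f B | u = f (A * B)]%g].
Proof.
move=> abM ctM M2 ntM; have [_ M2' _] := pgroup_pdiv M2 ntM.
have [x [y [Mx My ox oy nyx]]] := central_type_order2 ctM (isT : prime 2) M2'.
have sq z : #[z]%g = 2%N -> (z * z = 1)%g.
  by move=> oz; rewrite -[LHS]/(z ^+ 2)%g -oz expg_order.
have [A HA fA] := morph_surj surj_f x; have [B HB fB] := morph_surj surj_f y.
have [a [b [c tA]]] : exists a b c, traceless A a b c.
  apply: psl2_involution_lift; rewrite ?fA ?sq //.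
  by apply: contra_eq_neq ox => ->; rewrite order1.
have [a' [b' [c' tB]]] : exists a b c, traceless B a b c.
  apply: psl2_involution_lift; rewrite ?fB ?sq //.
  by apply: contra_eq_neq oy => ->; rewrite order1.
have cxy : commute x y by apply: (centsP abM).
have [a2 [b2 [c2 [_ EAB _]]]] : exists a b c, traceless (A * B)%g a b c.
  apply: psl2_involution_lift; rewrite ?groupM // morphM // fA fB.
    apply: contraNneq nyx => /eqP; rewrite -eq_invg_mul => /eqP <-.
    by rewrite groupV cycle_id.
  by rewrite {1}cxy mulgA -[(y * x * x)%g]mulgA sq // mulg1 sq.
have [_ EA _] := tA; have [_ EB _] := tB.
have orth : 2%:R * (a * a') + b * c' + c * b' = 0.
  move: EAB; rewrite GLvalM EA EB mx2M => /mx2_inj[h1 _ _ h4].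
  by apply: (eq_lin2 (k := 1) (l := 1) h1 h4); ring.
have cBA : GLval (B * A)%g = - GLval (A * B)%g.
  rewrite !GLvalM EA EB !mx2M -scaleN1r mx2Z; congr mx2; try by ring.
    by apply: (eq_lin (k := 1) orth); ring.
  by apply: (eq_lin (k := 1) orth); ring.
exists A, B, a, b, c, a', b', c'; split=> //; first by rewrite fA fB.
move=> u Mu; have [D HD fD] := morph_surj surj_f u.
have comm W : W \in H -> f W \in M -> commute (f D) (f W).
  by move=> HW MW; rewrite fD; apply: (centsP abM).
have cl E : E \in H -> commute E A -> commute E B -> f E = 1%g.
  by move=> HE; apply: (sl2_klein_cent HE tA tB orth).
have GN (X Y Z : {'GL_2[F]}) : GLval (X * Y)%g = - GLval (Y * X)%g ->
    GLval (X * Z)%g = - GLval (Z * X)%g -> commute X (Y * Z)%g.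
  rewrite !GLvalM => e1 e2; apply: GLval_inj.
  by rewrite !GLvalM mulmxA e1 mulNmx -(mulmxA (GLval Y) (GLval X)) e2 mulmxN opprK mulmxA.
have GP (X Y Z : {'GL_2[F]}) : commute X Y ->
    GLval (X * Z)%g = - GLval (Z * X)%g -> GLval (X * (Y * Z))%g = - GLval (Y * Z * X)%g.
  move/(congr1 GLval); rewrite !GLvalM => e1 e2.
  by rewrite mulmxA e1 -(mulmxA (GLval Y) (GLval X)) e2 mulmxN mulmxA.
have GS (X Y : {'GL_2[F]}) : GLval (X * Y)%g = - GLval (Y * X)%g ->
    GLval (Y * X)%g = - GLval (X * Y)%g by move=> ->; rewrite opprK.
have ff W a1 b1 c1 : traceless W a1 b1 c1 -> f (D * W)%g = 1%g -> u = f W.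
  move=> tW; have [HW _ _] := tW; rewrite morphM // fD => e.
  by rewrite -[u]mulg1 -(psl2_traceless_sqr tW) mulgA e mul1g.
have cDA := psl2_commute_lift HD HA (comm A HA _).
have cDB := psl2_commute_lift HD HB (comm B HB _).
case: cDA => [|cA|cA]; first by rewrite fA.
  case: cDB => [|cB|cB]; first by rewrite fB.
    by constructor 1; rewrite -fD; apply: cl.
  constructor 2; apply: (ff _ _ _ _ tA); apply: cl; rewrite ?groupM //.
    by apply/commute_sym/commuteM => //; apply: commute_sym.
  by apply/commute_sym/GN => //; apply: GS.
case: cDB => [|cB|cB]; first by rewrite fB.
  constructor 3; apply: (ff _ _ _ _ tB); apply: cl; rewrite ?groupM //.
    by apply/commute_sym/GN => //; apply: GS.
  by apply/commute_sym/commuteM => //; apply: commute_sym.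
have HAB := groupM HA HB.
have [a3 [b3 [c3 tAB]]] : exists a b c, traceless (A * B)%g a b c.
  apply: sl2_traceless => //; rewrite EAB tr_mx2; ring.
constructor 4; apply: (ff _ _ _ _ tAB); apply: cl; rewrite ?groupM //.
  apply/commute_sym/GN; first exact: GS.
  by apply: GP => //; apply: GS.
apply/commute_sym/GN; first exact: GS.
by move: cBA; rewrite !GLvalM mulmxA => ->; rewrite mulNmx.
Qed.

(** Up to sign, only transvections commute with a transvection, and these have
    order p. *)
Lemma low_cent_odd (l : F) : l != 0 -> (2%N^'.-group 'C[f (gl2 (low l))])%g.
Proof.
move=> nl; have dl : \det (low l) = 1 by exact: det_low.
apply: (morph_cent1_pgroup surj_f) => //; first exact: mem_gl2.
move=> g Hg g2 /(psl2_comm ker_f Hg (mem_gl2 dl))[e e1].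
have [x [y [z [w [Eg dg]]]]] := sl2E Hg.
rewrite !GLvalM gl2E // Eg !mx2M mx2Z => /mx2_inj[h1 h2 h3 h4].
case: e1 h1 h2 h3 h4 => -> h1 h2 h3 h4; last first.
  have y0 : y = 0 by apply: (mulfI nz2); apply: (eq_lin (k := 1) h2); ring.
  have x0 : x = 0 by apply: (mulfI nz2); apply: (eq_lin2 (k := 1) (l := - l) h1 y0); ring.
  by move/eqP: dg; rewrite y0 x0 !mul0r subrr eq_sym oner_eq0.
have y0 : y = 0 by apply: (mulIf nl); apply: (eq_lin (k := 1) h1); ring.
have xw : w = x by apply: (mulIf nl); apply: (eq_lin (k := 1) h3); ring.
rewrite y0 xw in Eg dg.
have x2 : x * x = 1 by rewrite -dg; ring.
have Eg2 : GLval (g * g)%g = low (2%:R * x * z).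
  by rewrite GLvalM Eg mx2M; congr mx2; first [by rewrite -x2; ring | ring].
have gg1 : (g * g = 1)%g.
  have gg2 : (2.-elt (g * g))%g by rewrite -[(g * g)%g]/(g ^+ 2)%g p_eltX.
  apply/eqP; rewrite -order_eq1; apply/eqP/(pnat_1 gg2).
  apply: pi_pnat (low_p_elt charF Eg2) _; rewrite !inE.
  by apply: contraTneq odd_p => ->.
have nx : x != 0 by apply: contra_eq_neq x2 => ->; rewrite mul0r eq_sym oner_eq0.
have z0 : z = 0.
  apply: (mulfI (mulf_neq0 nz2 nx)); rewrite mulr0.
  have := congr1 GLval gg1; rewrite Eg2 GLval1 mx2_scalar => /mx2_inj[_ _ -> _] //.
by apply: (psl2_scalar ker_f Hg (e := x)); rewrite Eg z0 mx2_scalar.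
Qed.

(** Let W t = e t^g with e = 1 or -1, and let y be the upper right entry of g.
    Comparing traces gives l b = 2 e, and comparing the upper right entries gives
    b = - e l y ^ 2; so (l y) ^ 2 = -2. *)
Lemma low_isol W a b c (l : F) : traceless W a b c ->
    (f W * f (gl2 (low l)) \in f (gl2 (low l)) ^: [set: gT])%g ->
  (l * b) ^+ 2 = 4%:R /\ exists mu, mu * mu = - 2%:R :> F.
Proof.
case=> HW EW _; have dl : \det (low l) = 1 by exact: det_low.
have Hl := mem_gl2 dl; rewrite -morphM //.
case/(psl2_class surj_f ker_f Hl (groupM HW Hl)) => g [e [Hg e1]].
have [x [y [z [w [Eg dg]]]]] := sl2E Hg.
rewrite conjgE !GLvalM (sl2V dg Eg) gl2E // Eg EW !mx2M mx2Z => /mx2_inj[h1 h2 h3 h4].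
have t2 : l * b = 2%:R * e.
  transitivity (2%:R * e * (x * w - y * z)); last by rewrite dg mulr1.
  by apply: (eq_lin2 (k := 1) (l := 1) h1 h4); ring.
split; first by rewrite t2; case: e1 => ->; ring.
exists (l * y); case: e1 t2 h2 => -> t2 h2.
  by apply: (eq_lin2 (k := - 1) (l := l) t2 h2); ring.
by apply: (eq_lin2 (k := 1) (l := - l) t2 h2); ring.
Qed.

End Klein.

Section PSL2Theorem.
Variables (F : finFieldType) (p m : nat) (gT : finGroupType).
Local Notation H := (SLn_group 2 F).
Variable f : {morphism H >-> gT}.
Hypotheses (pr_p : prime p) (cardF : #|F| = (p ^ m)%N).
Hypotheses (surj_f : (f @* H)%g = [set: gT]) (ker_f : ('ker f = 'Z(SLn 2 F))%g).
Local Notation low s := (mx2 1 0 s 1).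

Let charF : p \in [pchar F] := card_finPcharP cardF pr_p.

(** In the fields with 5 and 7 elements, -2 is not a square. *)
Lemma card_odd_sqr_neg2 (mu : F) : odd p -> (p = 3 -> (1 < m)%N) ->
  mu * mu = - 2%:R -> (8 <= #|F|)%N.
Proof.
move=> odd_p p3 mu2; rewrite leqNgt; apply/negP=> ltF.
have m0 : (0 < m)%N by have := finNzRing_gt1 F; rewrite cardF; case: (m).
have nz2 : 2%:R != 0 :> F by apply: (psl2_odd_nz2 charF); apply: contraTneq odd_p => ->.
have p_ge3 : (2 < p)%N by have := prime_gt1 pr_p; move: odd_p; case: (p) => [|[|[|k]]].
have m1 : m = 1%N.
  apply/eqP; rewrite eqn_leq m0 andbT leqNgt; apply: contraL ltF => lt1m.
  rewrite -leqNgt cardF (leq_trans _ (leq_pexp2l _ lt1m)) ?prime_gt0 //.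
  by apply: (leq_trans (n := 9)); rewrite // (@leq_exp2r 3 p 2).
have Fp : #|F| = p by rewrite cardF m1 expn1.
have nmu : mu != 0.
  by apply: contra_eq_neq mu2 => ->; rewrite mul0r eq_sym oppr_eq0.
have charp : p%:R = 0 :> F by exact: pcharf0 charF.
have fermat := expf_card mu; rewrite Fp in fermat; rewrite Fp in ltF.
case: p odd_p p_ge3 ltF p3 charp fermat => [|[|[|[|[|[|[|[|k]]]]]]]] //= _ _ _ p3.
- by move: (p3 erefl); rewrite m1.
- move=> c5 mu5; have : mu * (2%:R * 2%:R - 1) = 0.
    transitivity (mu * ((mu * mu) * (mu * mu) - 1)); first by rewrite mu2; ring.
    by apply: (eq_lin (k := 1) mu5); ring.
  move/eqP; rewrite mulf_eq0 (negPf nmu) /= => /eqP e3; case/eqP: nz2.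
  by apply: (eq_lin2 (k := 1) (l := - 1) c5 e3); ring.
move=> c7 mu7; have : mu * (8%:R + 1) = 0.
  transitivity (- (mu * ((mu * mu) * (mu * mu) * (mu * mu) - 1))); first by rewrite mu2; ring.
  by apply: (eq_lin (k := - 1) mu7); ring.
move/eqP; rewrite mulf_eq0 (negPf nmu) /= => /eqP e9; case/eqP: nz2.
by apply: (eq_lin2 (k := 1) (l := - 1) e9 c7); ring.
Qed.

(** Here t = t' is a transvection with parameter l. Let b, b', b'' be the upper
    right entries of A, B and A B; they are not all zero, and the sum of their
    squares is zero. If -2 is not a square, then l = 1 is suitable: were all
    three squares 0 or 4, their sum 0 would be 4, 8 or 12, so that p = 3 and
    -2 = 1 is a square. If -2 is a square, then F has enough elements for l to
    avoid 0 and the values 2 / b and - 2 / b. *)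
Lemma psl2_klein_obstruction (M : {group gT}) :
    odd p -> (p = 3 -> (1 < m)%N) ->
    abelian M -> central_type M -> (2.-group M)%g -> M :!=: 1%g ->
  twist_obstruction M.
Proof.
move=> odd_p p3 abM ctM M2 ntM.
have nz2 : 2%:R != 0 :> F by apply: (psl2_odd_nz2 charF); apply: contraTneq odd_p => ->.
have nz4 : 4%:R != 0 :> F by rewrite (natrM _ 2 2) mulf_neq0.
have [A [B [a [b [c [a' [b' [c' [tA tB orth [MA MB] ofM]]]]]]]]] :=
  psl2_klein charF surj_f ker_f odd_p abM ctM M2 ntM.
have [HA EA nA] := tA; have [HB EB nB] := tB.
pose b'' := a * b' - b * a'.
have [a2 [c2 tAB]] : exists a2 c2, traceless (A * B)%g a2 b'' c2.
  have [|a2 [b2 [c2 tAB]]] := sl2_traceless (groupM HA HB).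
    rewrite GLvalM EA EB mx2M tr_mx2; rewrite -[RHS]orth; ring.
  exists a2, c2; have [HAB EAB nAB] := tAB; suff -> : b'' = b2 by [].
  move: EAB; rewrite GLvalM EA EB mx2M => /mx2_inj[_ <- _ _]; rewrite /b''; ring.
have sum0 : b ^+ 2 + b' ^+ 2 + b'' ^+ 2 = 0.
  transitivity (- (b * b' * (2%:R * (a * a') + b * c' + c * b'))); last by rewrite orth; ring.
  by rewrite /b''; apply: (eq_lin2 (k := b' ^+ 2) (l := b ^+ 2) nA nB); ring.
have nb : (b != 0) || (b' != 0).
  rewrite -negb_and; apply/negP=> /andP[/eqP b0 /eqP b0'].
  move: nA nB orth; rewrite b0 b0' => nA nB orth.
  have : a * a' = 0 by apply: (mulfI nz2); apply: (eq_lin (k := 1) orth); ring.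
  move/eqP; rewrite mulf_eq0 => /orP[] /eqP z.
    by move/eqP: nA; rewrite z !mul0r addr0 eq_sym oppr_eq0 oner_eq0.
  by move/eqP: nB; rewrite z !mul0r addr0 eq_sym oppr_eq0 oner_eq0.
suff [l [nl isol [W [aW [bW [cW [tW MW nbW nbW4]]]]]]] : exists l, [/\ l != 0,
    (exists mu, mu * mu = - 2%:R :> F) ->
      [/\ (l * b) ^+ 2 != 4%:R, (l * b') ^+ 2 != 4%:R & (l * b'') ^+ 2 != 4%:R] &
    exists W a b c, [/\ traceless W a b c, f W \in M, l * b != 0 & (l * b) ^+ 2 != 4%:R]].
  have Hl := mem_gl2 (det_low l); pose t := gl2 (low l).
  have isolM u : u \in M -> (u * f t)%g \in (f t ^: [set: gT])%g -> u = 1%g.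
    move=> Mu; case: (ofM u Mu) => -> // /(low_isol surj_f ker_f).
    - by case/(_ _ _ _ tA) => e /isol[]; rewrite e eqxx.
    - by case/(_ _ _ _ tB) => e /isol[_]; rewrite e eqxx.
    by case/(_ _ _ _ tAB) => e /isol[_ _]; rewrite e eqxx.
  have [HW EW nW] := tW.
  exists 2%N, (f t), (f t), (f W); split=> //.
    have tt : (t * t)%g = gl2 (low (l + l)).
      by apply: GLval_inj; rewrite GLvalM !gl2E ?det_low // lowM.
    split; try exact: (low_cent_odd charF surj_f ker_f).
    rewrite -morphM // tt; apply: (low_cent_odd charF surj_f ker_f odd_p).
    by rewrite -mulr2n -mulr_natl mulf_neq0.
  split=> //; rewrite -morphJ // -!morphM ?groupJ //; apply/negP.
  have dW : aW * - aW - bW * cW = 1 by apply: (eq_lin (k := - 1) nW); ring.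
  case/(psl2_class_tr surj_f ker_f (groupM Hl Hl) (groupM Hl (groupJ Hl HW)));
    rewrite conjgE !GLvalM (sl2V dW EW) gl2E ?det_low // EW !mx2M !tr_mx2 => e.
    case/eqP: nbW; apply/eqP; rewrite -[_ == 0]orbb -mulf_eq0; apply/eqP.
    by apply: (eq_lin2 (k := - 1) (l := - 2%:R) e nW); ring.
  case/eqP: nbW4.
  by apply: (eq_lin2 (k := - 1) (l := - 2%:R) e nW); ring.
have [/existsP[mu /eqP mu2]|nsq] := boolP [exists mu : F, mu * mu == - 2%:R].
  pose pl (s : F) : {poly F} := (s ^+ 2)%:P * 'X^2 - (4%:R)%:P.
  have plE s l : (pl s).[l] = (l * s) ^+ 2 - 4%:R by rewrite /pl hornerD hornerN hornerM !hornerC hornerXn; ring.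
  have npl s : pl s != 0.
    apply: contra_neq nz4 => pl0; have := plE s 0; rewrite pl0 horner0 => e.
    by apply: (eq_lin (k := 1) e); ring.
  have szpl s : (size (pl s) <= 3)%N.
    rewrite (leq_trans (size_polyD _ _)) // geq_max size_polyN.
    rewrite (leq_trans (size_polyC_leq1 _)) // andbT.
    by rewrite mul_polyC (leq_trans (size_scale_leq _ _)) // size_polyXn.
  have szM (q1 q2 : {poly F}) k1 k2 : (size q1 <= k1 -> size q2 <= k2 -> size (q1 * q2)%R <= (k1 + k2).-1)%N.
    move=> h1 h2; apply: leq_trans (size_polyMleq _ _) _.
    by rewrite -!subn1 leq_sub2r // leq_add.
  have [l _] : exists2 l, l \in [set: F] & (pl b * pl b' * pl b'' * 'X).[l] != 0.
    apply: poly_nonroot; first by rewrite !mulf_neq0 ?polyX_eq0.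
    rewrite cardsT (leq_trans _ (card_odd_sqr_neg2 odd_p p3 mu2)) //.
    have szX : (size ('X : {poly F}) <= 2)%N by rewrite size_polyX.
    exact: (szM _ _ 7 2 (szM _ _ 5 3 (szM _ _ 3 3 (szpl _) (szpl _)) (szpl _)) szX).
  rewrite !hornerM !plE hornerX !mulf_eq0 !negb_or !subr_eq0 => /andP[/andP[/andP[n1 n2] n3] nl].
  exists l; split=> //; case/orP: nb => nb.
    by exists A, a, b, c; split; rewrite ?mulf_neq0.
  by exists B, a', b', c'; split; rewrite ?mulf_neq0.
exists 1; split; first exact: oner_neq0.
  by case=> mu mu2; case/existsP: nsq; exists mu; apply/eqP.
apply: contrapT => none.
have sqs W x y z : traceless W x y z -> f W \in M -> y ^+ 2 = 0 \/ y ^+ 2 = 4%:R.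
  move=> tW MW; have [->|ny] := eqVneq y 0; first by left; rewrite expr0n.
  right; apply/eqP; apply: contraT => n4; case: none; exists W, x, y, z.
  by split; rewrite ?mul1r.
have MAB : f (A * B)%g \in M by rewrite morphM // groupM.
have n12 : 3%:R != 0 :> F.
  apply: contraNneq nsq => e3; apply/existsP; exists 1; apply/eqP.
  by apply: (eq_lin (k := 1) e3); ring.
have no k : (k \in [:: 1; 2; 3])%N -> (4 * k)%:R != 0 :> F.
  by rewrite natrM => k3; rewrite mulf_neq0 //; move: k3; rewrite !inE => /or3P[] /eqP-> //; exact: oner_neq0.
have sq0 (y : F) : y != 0 -> y ^+ 2 != 0 by move=> ny; rewrite expf_neq0.
move/eqP: sum0.
case: (sqs _ _ _ _ tA MA) (sqs _ _ _ _ tB MB) (sqs _ _ _ _ tAB MAB) => eA [] eB [] eC.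
all: rewrite eA eB eC ?add0r ?addr0 -?natrD; try by apply/negP; apply: (no 1%N) || apply: (no 2%N) || apply: (no 3%N).
by case/orP: nb => /sq0; rewrite ?eA ?eB eqxx.
Qed.

End PSL2Theorem.

Section PSL2Final.
Variables (F : finFieldType) (p m : nat) (gT : finGroupType).
Local Notation H := (SLn_group 2 F).
Hypotheses (pr_p : prime p) (cardF : #|F| = (p ^ m)%N).

Lemma psl2_morphism : [set: gT] \isog PSLn 2 F ->
  exists f : {morphism H >-> gT},
    (f @* H)%g = [set: gT] /\ ('ker f = 'Z(SLn 2 F))%g.
Proof.
move=> /isog_symr/isogP[g injg gE].
have nZ : H \subset 'N('Z(SLn 2 F))%g by rewrite normal_norm ?center_normal.
have sHD : H \subset (coset 'Z(SLn 2 F) @*^-1 (SLn 2 F / 'Z(SLn 2 F)))%g.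
  by rewrite quotientGK ?center_normal.
exists [morphism of restrm sHD (g \o coset 'Z(SLn 2 F))]; split.
  by rewrite morphim_restrm setIid morphim_comp.
rewrite ker_restrm ker_comp (trivgP injg) -[RHS](setIidPr (center_sub H)).
congr (_ :&: _); exact: ker_coset.
Qed.

Lemma psl2_pgroup_conj (P : {group {'GL_2[F]}}) : P \subset H -> (p.-group P)%g ->
  exists2 h, h \in H & forall g, g \in (P :^ h)%g -> exists s, GLval g = mx2 1 0 s 1.
Proof.
move=> sPH pP; have charF : p \in [pchar F] := card_finPcharP cardF pr_p.
have Ex := gl2E (det_low (1 : F)); have Hx := mem_gl2 (det_low (1 : F)).
have [Q [h [pQ Qx Hh sQH sPQ]]] := pgroup_conj_Sylow Hx (low_p_elt charF Ex) sPH pP.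
exists h => // g /(subsetP sPQ) Qg.
have : delta_mx 0 (ord2 0) *m GLval g = delta_mx (0 : 'I_1) (ord2 0).
  apply: (pgroup_fixes_only_row charF pQ Qx) => // v.
  rewrite Ex => /rowP/(_ (ord2 0)); rewrite !mxE sum2 !mxE /= => E.
  exists (v 0 (ord2 0)); apply/rowP; apply: forall2; rewrite !mxE /= ?mulr1 ?mulr0 //.
  by apply: (eq_lin (k := 1) E); ring.
have [a [b [c [d [Eg dg]]]]] := sl2E (subsetP sQH _ Qg).
rewrite -rowE => /rowP r0; move: (r0 (ord2 0)) (r0 (ord2 1)).
rewrite Eg !mxE /= => a1 b0; exists c; congr mx2 => //.
by rewrite -dg a1 b0; ring.
Qed.

(** The prime divisors of #|M| are among 2 and p. If p is odd and M contains an
    involution, which lifts to a matrix of trace 0, then M, centralizing it, has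
    order prime to p. *)
Theorem psl2_twist_obstruction (M : {group gT}) :
    (p \in [:: 2; 3]%N -> (1 < m)%N) -> [set: gT] \isog PSLn 2 F ->
    M :!=: 1%g -> abelian M -> central_type M ->
  twist_obstruction M.
Proof.
move=> m1 /psl2_morphism[f [surj_f ker_f]] ntM abM ctM.
have charF : p \in [pchar F] := card_finPcharP cardF pr_p.
have primes l : prime l -> (l %| #|M|)%N -> l = 2%N \/ l = p.
  exact: (psl2_central_type_primes charF surj_f ker_f abM ctM).
have pgroup_case : (p.-group M)%g -> twist_obstruction M.
  move=> pM; have [P [sPH pP fP]] := morph_pgroup_lift surj_f pM.
  have [h Hh ofP] := psl2_pgroup_conj sPH pP.
  apply: (@twist_obstructionJ _ _ (f h)).
  have -> : (M :^ f h)%G = (f @* (P :^ h))%G.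
    by apply/val_inj; rewrite /= morphimJ // fP.
  have sPhH : (P :^ h)%G \subset H by rewrite -(conjGid Hh) conjSg.
  have pPh : (p.-group (P :^ h)%G)%g by rewrite /= pgroupJ.
  have leMP : (#|M| <= #|(P :^ h)%G|)%N by rewrite cardJg -fP leq_morphim.
  have pM' : (p %| #|M|)%N by have [] := pgroup_pdiv pM ntM.
  have [odd_p|even_p] := boolP (odd p).
    apply: (psl2_low_odd charF surj_f ker_f sPhH pPh ofP odd_p).
    exact: leq_trans (central_type_prime_square ctM pr_p pM') leMP.
  apply: (psl2_low_even charF surj_f ker_f sPhH pPh ofP); first exact/(prime_oddPn pr_p).
  by rewrite -cardG_gt1 (leq_trans _ leMP) // cardG_gt1.
have [p2|p2] := eqVneq p 2%N.
  apply: pgroup_case; apply/pgroupP=> l pr_l /(primes l pr_l).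
  by rewrite -p2 => -[] ->; rewrite !inE.
have [M2|n2] := boolP (2 %| #|M|)%N; last first.
  apply: pgroup_case; apply/pgroupP=> l pr_l lM; have := lM.
  by case/(primes l pr_l) => l_eq; rewrite inE l_eq // -l_eq lM in n2 *.
have odd_p : odd p by apply: contraNT p2 => /(prime_oddPn pr_p)->.
apply: (psl2_klein_obstruction pr_p cardF surj_f ker_f) => //.
  by move=> p3; apply: m1; rewrite p3.
have nz4 : 4%:R != 0 :> F by rewrite (natrM _ 2 2) mulf_neq0 // (psl2_odd_nz2 charF).
have [x Mx ox] := Cauchy (isT : prime 2) M2.
have [A HA fA] := morph_surj surj_f x.
have [||a [b [c [_ EA _]]]] := psl2_involution_lift ker_f HA.
- by rewrite fA; apply: contra_eq_neq ox => ->; rewrite order1.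
- by rewrite fA -[LHS]/(x ^+ 2)%g -ox expg_order.
have p'C : (p^'.-group 'C[x])%g.
  rewrite -fA; apply: (psl2_cent_p' charF surj_f ker_f HA).
  by rewrite EA tr_mx2 subrr expr0n eq_sym.
apply/pgroupP=> l pr_l lM; case: (primes l pr_l lM) => l_eq; rewrite inE l_eq //.
have sMC : M \subset 'C[x]%g.
  by rewrite (subset_trans abM) // -cent_cycle centS // cycle_subG.
have := pnat_dvd (cardSg sMC) p'C; rewrite p'natE // -{2}l_eq => /negP[].
by rewrite l_eq in lM.
Qed.

End PSL2Final.

(** * Conclusion *)

Lemma isog_surjective_morphism (hT gT : finGroupType) (H : {group hT}) :
  [set: gT] \isog H -> exists f : {morphism H >-> gT},
    (f @* H)%g = [set: gT] /\ ('injm f)%g.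
Proof. by move=> /isog_symr/isogP[f inj_f surj_f]; exists f. Qed.

Theorem mainTheorem3 (R : realType) (p m : nat) (F : finFieldType)
    (gT : finGroupType) (M : {group gT})
    (p_prime : prime p) (m_ge1 : (1 <= m)%N) (cardF : #|F| = (p ^ m)%N)
    (GM : [\/ (p \in [:: 2; 3]%N -> (1 < m)%N) /\ [set: gT] \isog PSLn 2 F,
              [/\ p = 2%N, (1 < m)%N, odd m & [set: gT] \isog Suzuki F m./2] |
              [set: gT] \isog SLn 3 'F_p /\ (p.-group M)%g])
    (M_nontrivial : M :!=: 1%g) (M_abelian : abelian M)
    (M_central_type : central_type M)
    (K : fieldExtType rat) (iotaK : {rmorphism K -> R[i]})
    (K_split : split_galg K M)
    (omega : lchar R[i] M -> lchar R[i] M -> K)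
    (omega_cocycle : cocycle2 omega) (omega_normalized : cocycle_normalized omega)
    (omega_nondegenerate : cocycle_nondegenerate omega)
    (L : fieldExtType rat) (iotaL : {rmorphism L -> R[i]})
    (X : lmodType (number_ring L))
    (j : {linear X -> galg R[i] gT | number_ring_embedding iotaL \; *:%R}) :
  ~ hopf_order
      (twisted (twist_Omega (fun phi psi => iotaK (omega phi psi)))) j.
Proof.
apply: twist_obstruction_no_hopf_order => //.
case: GM => [[m1 isoG]|[p2 m1 odd_m isoG]|[isoG pM]].
- exact: (psl2_twist_obstruction p_prime cardF m1 isoG).
- have cardF2 : #|F| = (2 ^ (m./2.*2.+1))%N.
    by rewrite cardF p2 -{1}(odd_double_half m) odd_m.
  have [f [surj_f inj_f]] := isog_surjective_morphism isoG.
  exact: (suzuki_twist_obstruction cardF2 surj_f inj_f).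
have [f [surj_f inj_f]] := isog_surjective_morphism isoG.
exact: (sl3_twist_obstruction p_prime (card_Fp p_prime) surj_f inj_f).
Qed.
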